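(* Let $\overline{\,\cdot\,}$ be a continuous antilinear involution on $V$ and $\Lambda$ a continuous Hermitian bilinear form on $V$. Let $\omega:\mathcal{S}^\bullet(V)^{\mathrm{cpl}}\to\mathbb{C}$ be a continuous linear functional on $\mathcal{S}^\bullet(V)^{\mathrm{cpl}}$ that is positive with respect to $\star_\Lambda$. Then for every $X=X^*\in\mathcal{S}^{(2)}(V)^{\mathrm{cpl}}$ all vectors in the GNS pre-Hilbert space $\mathcal{H}_\omega$ are analytic for $\pi_\omega(X)$, which is therefore essentially self-adjoint.
   Context: $V$ is a complex Hausdorff locally convex space whose topology is given by its continuous Hilbert seminorms: let $\mathcal{I}_V$ be the set of continuous positive Hermitian forms $\langle\cdot\,|\,\cdot\rangle_\alpha$ on $V$ (sesquilinear, antilinear in the first argument, Hermitian, positive semi-definite), put $\|v\|_\alpha:=\sqrt{\langle v|v\rangle_\alpha}$, and let $\mathcal{P}_V$ be the set of all these seminorms; it is assumed that $\mathcal{P}_V$ is cofinal in the set of all continuous seminorms on $V$. Let $\mathcal{T}^k_{\mathrm{alg}}(V)$ be the algebraic $k$-th tensor power ($\mathcal{T}^0_{\mathrm{alg}}(V)=\mathbb{C}$), $\mathcal{T}^\bullet_{\mathrm{alg}}(V)=\bigoplus_{k\ge 0}\mathcal{T}^k_{\mathrm{alg}}(V)$, and $\langle X\rangle_k$ the degree-$k$ component of $X$. Each $\langle\cdot|\cdot\rangle_\alpha\in\mathcal{I}_V$ is extended to a positive Hermitian form $\langle X|Y\rangle_\alpha^\bullet:=\sum_{k}\langle\langle X\rangle_k|\langle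 Y\rangle_k\rangle_\alpha^\bullet$ on $\mathcal{T}^\bullet_{\mathrm{alg}}(V)$, where $\langle x_1\otimes\cdots\otimes x_k|y_1\otimes\cdots\otimes y_k\rangle_\alpha^\bullet:=k!\prod_{m=1}^k\langle x_m|y_m\rangle_\alpha$; set $\|X\|_\alpha^\bullet:=\sqrt{\langle X|X\rangle_\alpha^\bullet}$. $\mathcal{T}^\bullet(V)$ is $\mathcal{T}^\bullet_{\mathrm{alg}}(V)$ with the locally convex topology defined by all seminorms $\|\cdot\|_\alpha^\bullet$, $\|\cdot\|_\alpha\in\mathcal{P}_V$. Let $\mathrm{Sym}^\bullet$ be the symmetrisation operator, $\mathrm{Sym}^\bullet(x_1\otimes\cdots\otimes x_k)=\frac1{k!}\sum_{\sigma\in\mathfrak{S}_k}x_{\sigma(1)}\otimes\cdots\otimes x_{\sigma(k)}$, and let $\mathcal{S}^\bullet(V)$ be its image (the symmetric tensors) with the subspace topology, $\mathcal{S}^k(V)$ the symmetric tensors of degree $k$; $\mathcal{S}^\bullet(V)^{\mathrm{cpl}}$ is the completion of $\mathcal{S}^\bullet(V)$. $\mathcal{S}^{(2)}(V):=\mathcal{S}^0(V)\oplus\mathcal{S}^1(V)\oplus\mathcal{S}^2(V)$, and $\mathcal{S}^{(2)}(V)^{\mathrm{cpl}}$ is its closure in $\mathcal{S}^\bullet(V)^{\mathrm{cpl}}$. For a continuous bilinear form $\Lambda$ on $V$, let $P_\Lambda$ be the linear endomorphism of $\mathcal{T}^\bullet(V)\otimes\mathcal{T}^\bullet(V)$ (outer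 tensor product) with $P_\Lambda\big((x_1\otimes\cdots\otimes x_k)\otimes(y_1\otimes\cdots\otimes y_\ell)\big)=k\ell\,\Lambda(x_k,y_1)\,(x_1\otimes\cdots\otimes x_{k-1})\otimes(y_2\otimes\cdots\otimes y_\ell)$ for $k,\ell\ge1$, and zero if $k=0$ or $\ell=0$ (the tensor sign between the two brackets is the outer one). With $\mu_\vee(X\otimes Y):=\mathrm{Sym}^\bullet(X\otimes Y)$ (product in the tensor algebra on the right), $X\star_\Lambda Y:=\sum_{t=0}^\infty\frac1{t!}\mu_\vee\big((P_\Lambda)^t(X\otimes Y)\big)$ for $X,Y\in\mathcal{S}^\bullet(V)$. The $^*$-involution is the antilinear map with $(x_1\otimes\cdots\otimes x_k)^*:=\overline{x_k}\otimes\cdots\otimes\overline{x_1}$ (complex conjugation on scalars). $\star_\Lambda$ and $^*$ are continuous and extended to $\mathcal{S}^\bullet(V)^{\mathrm{cpl}}$ by continuity. $\Lambda$ is Hermitian if $\Lambda(v,w)=\overline{\Lambda(\overline{w},\overline{v})}$ for all $v,w\in V$; then $\mathcal{A}:=\big(\mathcal{S}^\bullet(V)^{\mathrm{cpl}},\star_\Lambda,{}^*\big)$ is a unital $^*$-algebra. $\omega$ is positive with respect to $\star_\Lambda$ if $\omega(Y^*\star_\Lambda Y)\ge0$ for all $Y\in\mathcal{S}^\bullet(V)^{\mathrm{cpl}}$. GNS representation: $\mathcal{J}_\omega:=\{Y\in\mathcal{A}:\omega(Y^*\star_\Lambda Y)=0\}$, $\mathcal{H}_\omega:=\mathcal{A}/\mathcal{J}_\omega$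 with inner product $\langle[Y]|[Z]\rangle_\omega:=\omega(Y^*\star_\Lambda Z)$, and $\pi_\omega(X)[Y]:=[X\star_\Lambda Y]$. A vector $\psi\in\mathcal{H}_\omega$ is analytic for an operator $A:\mathcal{H}_\omega\to\mathcal{H}_\omega$ if $\sum_{n=0}^\infty\frac{\epsilon^n}{n!}\|A^n\psi\|<\infty$ for some $\epsilon>0$. Essential self-adjointness refers to $\pi_\omega(X)$ as an operator with domain $\mathcal{H}_\omega$ in the Hilbert space completion of $\mathcal{H}_\omega$. *)

(* Defs.v *)
From HB Require Import structures.
From mathcomp Require Import all_boot all_order perm all_algebra.
From mathcomp Require Import all_classical all_reals all_analysis.
From mathcomp Require Import complex.
From mathcomp Require Import freeg.

Set Implicit Arguments.
Unset Strict Implicit.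
Unset Printing Implicit Defensive.

Import Order.TTheory GRing.Theory Num.Theory.
Import numFieldNormedType.Exports.

Local Open Scope classical_set_scope.
Local Open Scope ring_scope.
Local Open Scope quotient_scope.

Definition submodule_set (K : nzRingType) (U : lmodType K) (M : set U) :=
  M 0 /\ forall (a : K) (u v : U), M u -> M v -> M (a *: u + v).

Definition lspan (K : nzRingType) (U : lmodType K) (N : set U) : set U :=
  smallest (@submodule_set K U) N.

Lemma lspan_submodule (K : nzRingType) (U : lmodType K) (N : set U) :
  submodule_set (lspan N).
Proof.
split; first by move=> M [[]].
by move=> a u v Nu Nv M sM; case: (sM) => -[_ MZ] _; apply: MZ; [apply: Nu|apply: Nv].
Qed.

Lemma lspan_id (K : nzRingType) (U : lmodType K) (N : set U) :
  submodule_set N -> lspan N = N.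
Proof. by move=> subN; apply: smallest_id. Qed.

Section QuotMod.
Context (K : nzRingType) (U : lmodType K) (N : set U).

Definition quot_rel (x y : U) : bool := `[< lspan N (x - y) >].

Lemma lspan0 : lspan N 0. Proof. by case: (lspan_submodule N). Qed.
Lemma lspanP (a : K) u v : lspan N u -> lspan N v -> lspan N (a *: u + v).
Proof. by case: (lspan_submodule N) => _; apply. Qed.
Lemma lspanD u v : lspan N u -> lspan N v -> lspan N (u + v).
Proof. by move=> Nu Nv; rewrite -[u]scale1r; apply: lspanP. Qed.
Lemma lspanZ a u : lspan N u -> lspan N (a *: u).
Proof. by move=> Nu; rewrite -[_ *: _]addr0; apply: lspanP => //; apply: lspan0. Qed.
Lemma lspanN u : lspan N u -> lspan N (- u).
Proof. by rewrite -scaleN1r; apply: lspanZ. Qed.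

Lemma quot_rel_refl : reflexive quot_rel.
Proof. by move=> x; apply/asboolP; rewrite subrr; apply: lspan0. Qed.
Lemma quot_rel_sym : symmetric quot_rel.
Proof.
move=> x y; apply/asboolP/asboolP => /lspanN; by rewrite opprB.
Qed.
Lemma quot_rel_trans : transitive quot_rel.
Proof.
move=> y x z /asboolP xy /asboolP yz; apply/asboolP.
by rewrite -(subrK y x) -addrA; apply: lspanD.
Qed.

Canonical quot_equiv := EquivRel quot_rel quot_rel_refl quot_rel_sym quot_rel_trans.

Definition quotmod := {eq_quot quot_equiv}.
HB.instance Definition _ := Choice.on quotmod.
HB.instance Definition _ := EqQuotient.on quotmod.

Definition qproj (u : U) : quotmod := \pi u.

Lemma qprojP u v : qproj u = qproj v <-> lspan N (u - v).
Proof.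
split=> [/eqP|uv]; first by rewrite eqmodE => /asboolP.
by apply/eqP; rewrite eqmodE; apply/asboolP.
Qed.

Lemma repr_qproj u : lspan N (repr (qproj u) - u).
Proof. by apply/qprojP; rewrite /qproj reprK. Qed.

Definition qadd (x y : quotmod) := qproj (repr x + repr y).
Definition qopp (x : quotmod) := qproj (- repr x).
Definition qscale (a : K) (x : quotmod) := qproj (a *: repr x).

Lemma qaddE u v : qadd (qproj u) (qproj v) = qproj (u + v).
Proof.
apply/qprojP; rewrite opprD addrACA.
by apply: lspanD; apply: repr_qproj.
Qed.
Lemma qoppE u : qopp (qproj u) = qproj (- u).
Proof. by apply/qprojP; rewrite -opprD; apply: lspanN; apply: repr_qproj. Qed.
Lemma qscaleE a u : qscale a (qproj u) = qproj (a *: u).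
Proof. by apply/qprojP; rewrite -scalerBr; apply: lspanZ; apply: repr_qproj. Qed.

Lemma qprojW (x : quotmod) : exists u, x = qproj u.
Proof. by exists (repr x); rewrite /qproj reprK. Qed.

Lemma qaddA : associative qadd.
Proof.
move=> x y z; case: (qprojW x) (qprojW y) (qprojW z) => [u ->] [v ->] [w ->].
by rewrite !qaddE addrA.
Qed.
Lemma qaddC : commutative qadd.
Proof.
by move=> x y; case: (qprojW x) (qprojW y) => [u ->] [v ->]; rewrite !qaddE addrC.
Qed.
Lemma qadd0 : left_id (qproj 0) qadd.
Proof. by move=> x; case: (qprojW x) => u ->; rewrite qaddE add0r. Qed.
Lemma qaddN : left_inverse (qproj 0) qopp qadd.
Proof. by move=> x; case: (qprojW x) => u ->; rewrite qoppE qaddE addNr. Qed.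

HB.instance Definition _ := GRing.isZmodule.Build quotmod qaddA qaddC qadd0 qaddN.

Lemma qprojD u v : qproj u + qproj v = qproj (u + v).
Proof. exact: qaddE. Qed.

Lemma qscaleA a b (x : quotmod) : qscale a (qscale b x) = qscale (a * b) x.
Proof. by case: (qprojW x) => u ->; rewrite !qscaleE scalerA. Qed.
Lemma qscale1 : left_id 1 qscale.
Proof. by move=> x; case: (qprojW x) => u ->; rewrite qscaleE scale1r. Qed.
Lemma qscaleDr : right_distributive qscale +%R.
Proof.
move=> a x y; case: (qprojW x) (qprojW y) => [u ->] [v ->].
by rewrite qprojD !qscaleE qprojD scalerDr.
Qed.
Lemma qscaleDl (x : quotmod) : {morph qscale^~ x : a b / a + b}.
Proof.
by move=> a b; case: (qprojW x) => u ->; rewrite !qscaleE qprojD scalerDl.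
Qed.

HB.instance Definition _ :=
  GRing.Zmodule_isLmodule.Build K quotmod qscaleA qscale1 qscaleDr qscaleDl.

Lemma qproj_linear : linear qproj.
Proof. by move=> a u v; rewrite -qaddE -qscaleE. Qed.
HB.instance Definition _ := GRing.isLinear.Build K U quotmod _ qproj qproj_linear.

End QuotMod.

Section Presentation.
Context (K : nzRingType) (G : choiceType) (Rel : set {freeg G / K}).

Definition presmod := quotmod Rel.
HB.instance Definition _ := GRing.Lmodule.on presmod.

Definition pgen (g : G) : presmod := qproj Rel << g >>.

Section Extension.
Context (W : lmodType K) (theta : {rmorphism K -> K}) (f : G -> W).

Definition fext (D : {freeg G / K}) : W :=
  \sum_(g <- dom D) theta (coeff g D) *: f g.

(* The [theta]-semilinear extension of [f] to the presented module.  It is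
   computed on a representative, so it is meaningful only when [f] respects
   the relations: see [pextP] and [pext_gen]. *)
Definition pext (X : presmod) : W := fext (repr X).

Lemma fext_sub (s : seq G) (D : {freeg G / K}) : uniq s -> {subset dom D <= s} ->
  fext D = \sum_(g <- s) theta (coeff g D) *: f g.
Proof.
move=> us sub; rewrite [RHS](bigID (mem (dom D))) /= [X in _ + X]big1 ?addr0.
  rewrite -big_filter; apply: perm_big; apply: uniq_perm; rewrite ?filter_uniq ?uniq_dom//.
  by move=> g; rewrite mem_filter; case: (boolP (g \in dom D)) => //= /sub ->.
by move=> g gD; rewrite coeff_outdom // rmorph0 scale0r.
Qed.

Lemma fextP (a : K) D E : fext (a *: D + E) = theta a *: fext D + fext E.
Proof.
pose s := undup (dom D ++ dom E ++ dom (a *: D + E)).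
have us : uniq s by apply: undup_uniq.
rewrite !(@fext_sub s) //; try by move=> g gD; rewrite mem_undup !mem_cat gD ?orbT.
rewrite scaler_sumr -big_split; apply: eq_bigr => g _ /=.
by rewrite coeffD coeffZ rmorphD rmorphM scalerDl scalerA.
Qed.

Lemma fextU g : fext << g >> = f g.
Proof. by rewrite /fext domU1 big_seq1 coeffU eqxx !mulr1 rmorph1 scale1r. Qed.

Definition compatible := forall r, Rel r -> fext r = 0.

Lemma fext0 : fext 0 = 0. Proof. by rewrite /fext dom0 big_nil. Qed.

Lemma pext_proj D : compatible -> pext (qproj Rel D) = fext D.
Proof.
move=> fRel; have := @repr_qproj _ _ Rel D.
have ker_sub : submodule_set [set E | fext E = 0].
  by split=> [|a u v /= u0 v0]; rewrite /= ?fext0 // fextP u0 v0 scaler0 addr0.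
move=> /(_ [set E | fext E = 0] (conj ker_sub fRel)) /= kerD.
have := fextP (-1) D (repr (qproj Rel D)).
rewrite scaleN1r addrC kerD rmorphN rmorph1 scaleN1r => /eqP.
by rewrite eq_sym addrC subr_eq0 => /eqP.
Qed.

Lemma pextP : compatible -> forall (a : K) X Y,
  pext (a *: X + Y) = theta a *: pext X + pext Y.
Proof.
move=> fRel a X Y; case: (qprojW X) (qprojW Y) => [D ->] [E ->].
by rewrite -linearP !pext_proj // fextP.
Qed.

Lemma pext_gen g : compatible -> pext (pgen g) = f g.
Proof. by move=> fRel; rewrite pext_proj // fextU. Qed.

End Extension.
End Presentation.

Section Seminorms.
Context (R : realType).
Local Notation C := R[i].

Definition positive_hermitian (E : lmodType C) (h : E -> E -> C) :=
  [/\ forall x (a : C) y z, h x (a *: y + z) = a * h x y + h x z,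
      forall x y, h y x = (h x y)^* &
      forall x, 0 <= h x x].

Definition hnorm (E : Type) (h : E -> E -> C) (x : E) : R :=
  Num.sqrt (complex.Re (h x x)).

Definition is_seminorm (E : lmodType C) (p : E -> R) :=
  (forall x y, p (x + y) <= p x + p y) /\
  (forall (a : C) x, (p (a *: x))%:C%C = `|a| * (p x)%:C%C).

Definition seminorm_open (E : lmodType C) (P : set (E -> R)) : set (set E) :=
  [set U | forall x, U x -> exists (Q : set (E -> R)) (e : R),
     [/\ finite_set Q, Q `<=` P, 0 < e &
         forall y, (forall p, Q p -> p (y - x) < e) -> U y]].

Section SeminormTopology.
Variables (E : lmodType C) (P : set (E -> R)).

Lemma seminorm_openT : seminorm_open P setT.
Proof. by move=> x _; exists set0, 1; split=> //; exact: sub0set. Qed.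

Lemma seminorm_openI : setI_closed (seminorm_open P).
Proof.
move=> U1 U2 o1 o2 x [U1x U2x].
have [Q1 [e1 [f1 s1 e10 h1]]] := o1 x U1x.
have [Q2 [e2 [f2 s2 e20 h2]]] := o2 x U2x.
exists (Q1 `|` Q2), (Num.min e1 e2); split.
- by rewrite finite_setU.
- by rewrite subUset.
- by rewrite lt_min e10.
- move=> y hy; split; [apply: h1|apply: h2] => p Qp.
    by have := hy p (or_introl Qp); rewrite lt_min => /andP[].
  by have := hy p (or_intror Qp); rewrite lt_min => /andP[].
Qed.

Lemma seminorm_open_bigU (I : Type) (f : I -> set E) :
  (forall i, seminorm_open P (f i)) -> seminorm_open P (\bigcup_i f i).
Proof.
move=> fo x [i _ fix_]; have [Q [e [fQ sQ e0 h]]] := fo i x fix_.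
by exists Q, e; split=> // y /h fy; exists i.
Qed.

End SeminormTopology.

Definition hilbert_form (V : tvsType C) : set (V -> V -> C) :=
  [set h | positive_hermitian h /\
           continuous (fun p : V * V => h p.1 p.2 : C^o)].

(* The topology of [V] is given by its continuous Hilbert seminorms. *)
Definition hilbert_seminorms_cofinal (V : tvsType C) :=
  forall p : V -> R, is_seminorm p -> continuous p ->
    exists2 h, hilbert_form h & forall x, p x <= hnorm h x.

End Seminorms.

Section TensorAlgebra.
Context (R : realType) (V : tvsType R[i]).
Local Notation C := R[i].

Definition multilinear (W : lmodType C) (theta : C -> C) (f : seq V -> W) :=
  forall (u v : seq V) (a : C) (x y : V),
    f (u ++ (a *: x + y) :: v) = theta a *: f (u ++ x :: v) + f (u ++ y :: v).

Definition tensor_rel : set {freeg (seq V) / C} :=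
  [set r | exists (u v : seq V) (a : C) (x y : V),
     r = << u ++ (a *: x + y) :: v >> -
         (a *: << u ++ x :: v >> + << u ++ y :: v >>)].

(* Words of length [k] generate the [k]-th tensor power; the relations are
   homogeneous, so this is the direct sum of the tensor powers. *)
Definition tensor : Type := presmod tensor_rel.
HB.instance Definition _ := GRing.Lmodule.on tensor.

(* [tpure [:: x1; x2; x3]] is x1 (x) x2 (x) x3. *)
Definition tpure (w : seq V) : tensor := pgen tensor_rel w.

Definition tens2_rel : set {freeg (tensor * tensor) / C} :=
  [set r | exists (a : C) (X X' Y : tensor),
     r = << (a *: X + X', Y) >> - (a *: << (X, Y) >> + << (X', Y) >>)] `|`
  [set r | exists (a : C) (X Y Y' : tensor),
     r = << (X, a *: Y + Y') >> - (a *: << (X, Y) >> + << (X, Y') >>)].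

(* The outer tensor product T(V) (x) T(V), kept apart from the product
   [tmul] inside T(V). *)
Definition tens2 : Type := presmod tens2_rel.
HB.instance Definition _ := GRing.Lmodule.on tens2.

Definition touter (X Y : tensor) : tens2 := pgen tens2_rel (X, Y).

Definition text (W : lmodType C) (theta : {rmorphism C -> C}) (f : seq V -> W) :
  tensor -> W := @pext C (seq V) tensor_rel W theta f.

Definition text2 (W : lmodType C) (f : tensor -> tensor -> W) : tens2 -> W :=
  @pext C (tensor * tensor)%type tens2_rel W idfun (fun p => f p.1 p.2).

Section Specification.
Variable (W : lmodType C).

Lemma text_compat (theta : {rmorphism C -> C}) (f : seq V -> W) :
  multilinear theta f -> compatible tensor_rel theta f.
Proof.
move=> fM _ [u [v [a [x [y ->]]]]].
rewrite -scaleN1r addrC fextP rmorphN rmorph1 scaleN1r fextP !fextU fM.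
by rewrite addNr.
Qed.

Lemma text_tpure (theta : {rmorphism C -> C}) (f : seq V -> W) w :
  multilinear theta f -> text theta f (tpure w) = f w.
Proof. by move=> /text_compat; apply: pext_gen. Qed.

Lemma textP (theta : {rmorphism C -> C}) (f : seq V -> W) :
  multilinear theta f -> forall (a : C) X Y,
  text theta f (a *: X + Y) = theta a *: text theta f X + text theta f Y.
Proof. by move=> /text_compat; apply: pextP. Qed.

Definition bilinear_map (f : tensor -> tensor -> W) :=
  (forall Y, linear (f^~ Y)) /\ forall X, linear (f X).

Lemma text2_compat (f : tensor -> tensor -> W) :
  bilinear_map f -> compatible tens2_rel idfun (fun p => f p.1 p.2).
Proof.
move=> [fl fr] _ [[a [X [X' [Y ->]]]]|[a [X [Y [Y' ->]]]]];
rewrite -scaleN1r addrC fextP rmorphN rmorph1 scaleN1r fextP !fextU /=.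
- by rewrite (fl Y a) addNr.
- by rewrite (fr X a) addNr.
Qed.

Lemma text2_touter (f : tensor -> tensor -> W) X Y :
  bilinear_map f -> text2 f (touter X Y) = f X Y.
Proof. by move=> /text2_compat fc; rewrite /text2 /touter (pext_gen _ fc). Qed.

Lemma text2P (f : tensor -> tensor -> W) : bilinear_map f -> linear (text2 f).
Proof. by move=> /text2_compat fc a X Y; rewrite /text2 (pextP fc). Qed.

End Specification.

Lemma tpureM : multilinear idfun tpure.
Proof.
move=> u v a x y; rewrite /tpure /pgen /= -linearP.
by apply/qprojP => M [_]; apply; exists u, v, a, x, y.
Qed.

Lemma touter_bilinear : bilinear_map touter.
Proof.
split=> Z a X Y; rewrite /touter /pgen -linearP; apply/qprojP => M [_]; apply.
- by left; exists a, X, Y, Z.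
- by right; exists a, Z, X, Y.
Qed.

Lemma tensor_ind (P : tensor -> Prop) : P 0 ->
  (forall a w X, P X -> P (a *: tpure w + X)) -> forall X, P X.
Proof.
move=> P0 PZ X; case: (qprojW X) => D ->; rewrite -[D]freeg_sumE.
elim: (dom D) => [|w s IHs]; first by rewrite big_nil linear0.
rewrite big_cons linearD /=; move: (PZ (coeff w D) w _ IHs).
by rewrite /tpure /pgen -linearZ /=; congr (P (qproj _ _ + _)); apply/eqP/freeg_eqP => z;
   rewrite coeffZ !coeffU mul1r.
Qed.

Section Bimultilinear.
Variables (W : lmodType C) (f : seq V -> seq V -> W).

Definition bimultilinear :=
  (forall w', multilinear idfun (f^~ w')) /\ forall w, multilinear idfun (f w).

Definition text_bi (X Y : tensor) : W :=
  text idfun (fun w => text idfun (f w) Y) X.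

Hypothesis fM : bimultilinear.

Let textl (Y : tensor) : multilinear idfun (fun w => text idfun (f w) Y).
Proof.
case: fM => fl fr u v a x y.
have E w b w' Z : text idfun (f w) (b *: tpure w' + Z) = b *: f w w' + text idfun (f w) Z.
  by rewrite (textP (fr w) b (tpure w') Z) (text_tpure w' (fr w)).
elim/tensor_ind: Y => [|b w Y IH].
  have text0 w : text idfun (f w) 0 = 0.
    have := textP (fr w) (-1) 0 0; rewrite scaler0 addr0 scaleN1r addNr.
    exact.
  by rewrite !text0 scaler0 addr0.
rewrite !E IH (fl w) /= !scalerDr !scalerA [a * b]mulrC.
by rewrite addrACA.
Qed.

Lemma text_bi_tpure w w' : text_bi (tpure w) (tpure w') = f w w'.
Proof. by rewrite /text_bi (text_tpure w (textl _)) (text_tpure w' (proj2 fM w)). Qed.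

Lemma text_bilinear : bilinear_map text_bi.
Proof.
case: fM => fl fr; split=> [Y a X X'|X]; first exact: textP (textl Y) a X X'.
have E b w Z Y : text_bi (b *: tpure w + Z) Y = b *: text idfun (f w) Y + text_bi Z Y.
  by rewrite /text_bi (textP (textl Y) b (tpure w) Z) (text_tpure w (textl Y)).
move=> a Y Z; elim/tensor_ind: X => [|b w X IH].
  have text0 Y' : text_bi 0 Y' = 0.
    have := textP (textl Y') (-1) 0 0; rewrite scaler0 addr0 scaleN1r addNr.
    exact.
  by rewrite !text0 scaler0 addr0.
rewrite !E IH (textP (fr w) a Y Z) /= !scalerDr !scalerA [a * b]mulrC.
by rewrite addrACA.
Qed.

End Bimultilinear.

Definition tdeg (k : nat) : tensor -> tensor :=
  text idfun (fun w => if size w == k then tpure w else 0).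

Definition tmul (X Y : tensor) : tensor :=
  text_bi (fun w w' => tpure (w ++ w')) X Y.

Definition word_perm (w : seq V) (k : nat) (s : 'S_k) : seq V :=
  [seq nth 0 w (s i) | i : 'I_k].

Definition tsym_word (w : seq V) : tensor :=
  (size w)`!%:R^-1 *: \sum_(s : 'S_(size w)) tpure (word_perm w s).

Definition tsym : tensor -> tensor := text idfun tsym_word.

Lemma size_word_perm (w : seq V) (k : nat) (s : 'S_k) : size (word_perm w s) = k.
Proof. by rewrite size_map size_enum_ord. Qed.

Lemma word_perm_nth (w : seq V) (k : nat) (s : 'S_k) (i : 'I_k) :
  nth 0 (word_perm w s) i = nth 0 w (s i).
Proof. by rewrite (nth_map i) ?size_enum_ord // nth_ord_enum. Qed.

Lemma word_permE (u v : seq V) (x : V) (k : nat) (s : 'S_k)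
    (sz : (size u < k)%N) (p := (s^-1)%g (Ordinal sz)) :
  word_perm (u ++ x :: v) s =
  take p (word_perm (u ++ 0 :: v) s) ++ x :: drop p.+1 (word_perm (u ++ 0 :: v) s).
Proof.
pose f y := fun i : 'I_k => nth 0 (u ++ y :: v) (s i).
have fE i : i != p -> f x i = f 0 i.
  rewrite /f !nth_cat => ip; case: ltnP => // le.
  case E: (s i - size u)%N => [|n] //; case/eqP: ip.
  apply/(canRL (permK s))/val_inj => /=.
  by apply/eqP; rewrite eqn_leq le -subn_eq0 E.
have fp : f x p = x.
  by rewrite /f permKV nth_cat ltnn subnn.
have szw y : size (word_perm (u ++ y :: v) s) = k := size_word_perm _ s.
have nthw y (i : 'I_k) : nth 0 (word_perm (u ++ y :: v) s) i = f y i.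
  by rewrite (nth_map i) ?size_enum_ord // nth_ord_enum.
apply: (@eq_from_nth _ 0) => [|i]; rewrite !szw.
  rewrite size_cat /= size_drop size_takel szw ?(ltnW (ltn_ord _)) //.
  by rewrite addnS -addSn subnKC.
move=> ik; pose j := Ordinal ik; rewrite (nthw x j) nth_cat.
rewrite size_takel ?szw ?(ltnW (ltn_ord _)) //; case: ltnP => [ip|pi].
  rewrite nth_take // (nthw 0 j) fE //; apply: contraTneq ip => <-.
  by rewrite ltnn.
move: pi; rewrite leq_eqVlt => /orP [/eqP pi|pi].
  by rewrite -pi subnn /=; have -> : j = p by apply: val_inj.
rewrite -(subnSK pi) /= nth_drop addnC subnK // (nthw 0 j) fE //.
by apply: contraTneq pi => <-; rewrite ltnn.
Qed.

Lemma tsym_wordM : multilinear idfun tsym_word.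
Proof.
move=> u v a x y; rewrite /tsym_word.
have szE z : size (u ++ z :: v) = (size u + (size v).+1)%N by rewrite size_cat.
rewrite !szE; set k := (size u + _)%N.
rewrite scalerA [_ * _]mulrC -scalerA -scalerDr; congr (_ *: _).
rewrite scaler_sumr -big_split; apply: eq_bigr => s _ /=.
have sz : (size u < k)%N by rewrite /k addnS ltnS leq_addr.
rewrite (@word_permE u v (a *: x + y) k s sz) (@word_permE u v x k s sz).
by rewrite (@word_permE u v y k s sz) tpureM.
Qed.

Lemma tsym_linear : linear tsym.
Proof. exact: textP tsym_wordM. Qed.
HB.instance Definition _ := GRing.isLinear.Build C tensor tensor _ tsym tsym_linear.

Lemma tsym_tpure w : tsym (tpure w) = tsym_word w.
Proof. exact: text_tpure tsym_wordM. Qed.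

Definition symmetric_tensor : {pred tensor} := fun X => `[< range tsym X >].

Lemma symmetric_tensorP X : reflect (range tsym X) (X \in symmetric_tensor).
Proof. exact: asboolP. Qed.

Lemma symmetric_submod_closed : submod_closed symmetric_tensor.
Proof.
split; first by apply/symmetric_tensorP; exists 0; rewrite ?linear0.
move=> a X Y /symmetric_tensorP [X' _ <-] /symmetric_tensorP [Y' _ <-].
by apply/symmetric_tensorP; exists (a *: X' + Y'); rewrite ?linearP.
Qed.
HB.instance Definition _ :=
  GRing.isSubmodClosed.Build C tensor symmetric_tensor symmetric_submod_closed.

Record symt := Symt { symt_val :> tensor; symt_valP : symt_val \in symmetric_tensor }.
HB.instance Definition _ := [isSub for symt_val].
HB.instance Definition _ := [Choice of symt by <:].
HB.instance Definition _ := [SubChoice_isSubLmodule of symt by <:].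

Lemma to_symt_subproof X : tsym X \in symmetric_tensor.
Proof. by apply/symmetric_tensorP; exists X. Qed.

Definition to_symt (X : tensor) : symt := Symt (to_symt_subproof X).

Definition symt_le2 : set symt :=
  [set X | exists X0 X1 X2 : symt,
     [/\ tdeg 0 X0 = X0, tdeg 1 X1 = X1, tdeg 2 X2 = X2 & X = X0 + X1 + X2]].

Lemma tdeg_linear k : linear (tdeg k).
Proof.
apply: textP => u v a x y; rewrite !size_cat /=.
by case: eqP => _; rewrite ?tpureM // scaler0 addr0.
Qed.

Lemma bimultilinear_cat : bimultilinear (fun w w' => tpure (w ++ w')).
Proof.
split=> [w' u v a x y|w u v a x y]; first by rewrite -!catA tpureM.
by rewrite !catA tpureM.
Qed.

Lemma tmul_bilinear : bilinear_map tmul.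
Proof. exact: text_bilinear bimultilinear_cat. Qed.

Lemma tmul_tpure w w' : tmul (tpure w) (tpure w') = tpure (w ++ w').
Proof. exact: text_bi_tpure bimultilinear_cat _ _. Qed.

Definition word_form (h : V -> V -> C) (w w' : seq V) : C :=
  if size w == size w' then (size w)`!%:R * \prod_(p <- zip w w') h p.1 p.2
  else 0.

(* The sesquilinear extension of [word_form h], antilinear in [X]. *)
Definition tform (h : V -> V -> C) (X Y : tensor) : C :=
  text (W := C^o) idfun
    (fun w' => text (W := C^o) Num.conj (fun w => word_form h w w') X) Y.

Section FormSpecification.
Variables (h : V -> V -> C) (hh : positive_hermitian h).

Let hr x (a : C) y z : h x (a *: y + z) = a * h x y + h x z.
Proof. by case: hh. Qed.

Let hl z (a : C) x y : h (a *: x + y) z = a^* * h x z + h y z.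
Proof. by case: hh => _ hC _; rewrite hC hr rmorphD rmorphM [in RHS]hC [h y z]hC. Qed.

Lemma word_formMr w : multilinear (W := C^o) idfun (word_form h w).
Proof.
move=> u v a x y; rewrite /word_form !size_cat /=.
case: eqP => [sz|_]; last by rewrite scaler0 addr0.
have [u1 [z [v1 [-> su]]]] : exists u1 z v1, w = u1 ++ z :: v1 /\ size u1 = size u.
  have lt : (size u < size w)%N by rewrite sz addnS ltnS leq_addr.
  exists (take (size u) w), (nth 0 w (size u)), (drop (size u).+1 w).
  by rewrite -drop_nth // cat_take_drop size_takel // ltnW.
rewrite !zip_cat // !big_cat /= !big_cons /= hr.
by rewrite mulrDl !mulrDr -!mulrA !(mulrCA _ a).
Qed.

Lemma word_formMl w' : multilinear (W := C^o) Num.conj (fun w => word_form h w w').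
Proof.
move=> u v a x y; rewrite /word_form !size_cat /=.
case: eqP => [sz|_]; last by rewrite scaler0 addr0.
have [u1 [z [v1 [-> su]]]] : exists u1 z v1, w' = u1 ++ z :: v1 /\ size u1 = size u.
  have lt : (size u < size w')%N by rewrite -sz addnS ltnS leq_addr.
  exists (take (size u) w'), (nth 0 w' (size u)), (drop (size u).+1 w').
  by rewrite -drop_nth // cat_take_drop size_takel // ltnW.
rewrite !zip_cat // !big_cat /= !big_cons /= hl.
by rewrite mulrDl !mulrDr -!mulrA !(mulrCA _ a^*).
Qed.

Lemma tform_tpurel w Y : tform h (tpure w) Y = text (W := C^o) idfun (word_form h w) Y.
Proof.
rewrite /tform; congr (text _ _ _); apply/funext => w'.
exact: text_tpure (word_formMl w').
Qed.

Lemma tform_tpure w w' : tform h (tpure w) (tpure w') = word_form h w w'.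
Proof. by rewrite tform_tpurel (text_tpure w' (word_formMr w)). Qed.

End FormSpecification.

(* T(V) carries the locally convex topology defined by the seminorms of the
   extended forms, S(V) the subspace topology. *)
Definition tensor_seminorms : set (tensor -> R) :=
  [set hnorm (tform h) | h in @hilbert_form R V].

HB.instance Definition _ := isOpenTopological.Build tensor
  (seminorm_openT tensor_seminorms) (@seminorm_openI _ _ tensor_seminorms)
  (@seminorm_open_bigU _ _ tensor_seminorms).

HB.instance Definition _ :=
  Topological.copy symt (initial_topology symt_val).

(* P_Lambda on a pair of pure tensors; [contract] is its bilinear extension. *)
Definition contract_word (Lam : V -> V -> C) (w w' : seq V) : tens2 :=
  match rev w, w' with
  | x :: u, y :: v =>
      ((size w * size w')%:R * Lam x y) *: touter (tpure (rev u)) (tpure v)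
  | _, _ => 0
  end.

Definition contract (Lam : V -> V -> C) : tens2 -> tens2 :=
  text2 (text_bi (contract_word Lam)).

Definition bilinear_form (Lam : V -> V -> C) :=
  (forall y (a : C) x x', Lam (a *: x + x') y = a * Lam x y + Lam x' y) /\
  (forall x (a : C) y y', Lam x (a *: y + y') = a * Lam x y + Lam x y').

Lemma contract_wordM Lam : bilinear_form Lam -> bimultilinear (contract_word Lam).
Proof.
have [tl tr] := touter_bilinear; case=> [Ll Lr]; split.
  move=> [|z w'] u v a x y; rewrite /contract_word.
    by do 3![case: (rev _) => [|? ?]]; rewrite ?scaler0 ?addr0.
  have szE t : size (u ++ t :: v) = (size u + (size v).+1)%N by rewrite size_cat.
  rewrite !szE; case/lastP: v {szE} => [|v t].
    by rewrite !cats1 !rev_rcons Ll mulrDr scalerDl scalerA mulrCA.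
  rewrite -!rcons_cons -!rcons_cat !rev_rcons !revK tpureM (tl _ a) scalerDr !scalerA.
  by rewrite [_ * a]mulrC.
move=> w u v a x y; rewrite /contract_word.
case: (rev w) => [|z w']; first by rewrite scaler0 addr0.
have szE t : size (u ++ t :: v) = (size u + (size v).+1)%N by rewrite size_cat.
rewrite !szE; case: u {szE} => [|t u] /=.
  by rewrite Lr mulrDr scalerDl scalerA mulrCA.
by rewrite tpureM (tr _ a) scalerDr !scalerA [_ * a]mulrC.
Qed.

Lemma contract_tpure Lam w w' : bilinear_form Lam ->
  contract Lam (touter (tpure w) (tpure w')) = contract_word Lam w w'.
Proof.
move=> /contract_wordM LM.
rewrite /contract (text2_touter _ _ (text_bilinear LM)).
exact: text_bi_tpure LM _ _.
Qed.

Definition mu_vee : tens2 -> symt := text2 (fun X Y => to_symt (tmul X Y)).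

(* The sum has finite support since [contract] lowers degrees. *)
Definition star (Lam : V -> V -> C) (X Y : symt) : symt :=
  \sum_(t \in [set: nat])
    (t`!%:R^-1 *: mu_vee (iter t (contract Lam) (touter X Y))).

Definition antilinear_involution (c : V -> V) :=
  (forall (a : C) x y, c (a *: x + y) = a^* *: c x + c y) /\ involutive c.

Definition tinv (c : V -> V) : tensor -> tensor :=
  text Num.conj (fun w => tpure (rev (map c w))).

(* [insubd] views the symmetric tensor [tinv c X] as an element of [symt]:
   see [sinvE]. *)
Definition sinv (c : V -> V) (X : symt) : symt := insubd 0 (tinv c X).

Section Involution.
Variables (c : V -> V) (hc : antilinear_involution c).

Lemma tinv_wordM : multilinear Num.conj (fun w => tpure (rev (map c w))).
Proof.
move=> u v a x y; rewrite !map_cat /= (proj1 hc) !rev_cat !rev_cons -!cats1 -!catA.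
by rewrite tpureM.
Qed.

Lemma tinv_tpure w : tinv c (tpure w) = tpure (rev (map c w)).
Proof. exact: text_tpure tinv_wordM. Qed.

Lemma tinvP (a : C) X Y : tinv c (a *: X + Y) = a^* *: tinv c X + tinv c Y.
Proof. exact: textP tinv_wordM _ _ _. Qed.

Lemma tinv0 : tinv c 0 = 0.
Proof. by rewrite -[X in tinv c X](addNr 0) -scaleN1r tinvP rmorphN rmorph1 scaleN1r addNr. Qed.

Lemma tinvZ (a : C) X : tinv c (a *: X) = a^* *: tinv c X.
Proof. by rewrite -[_ *: X]addr0 tinvP tinv0 addr0. Qed.

Lemma tinv_sum I (r : seq I) (F : I -> tensor) :
  tinv c (\sum_(i <- r) F i) = \sum_(i <- r) tinv c (F i).
Proof.
elim: r => [|i r IH]; first by rewrite !big_nil tinv0.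
by rewrite !big_cons -[F i]scale1r tinvP rmorph1 !scale1r IH.
Qed.

Lemma tsym_tinv_word w : tinv c (tsym_word w) = tsym_word (rev (map c w)).
Proof.
rewrite /tsym_word tinvZ tinv_sum size_rev size_map fmorphV rmorph_nat.
congr (_ *: _); set k := size w.
pose rho : 'S_k := perm (@rev_ord_inj k).
have rhoK : cancel (fun s : 'S_k => (rho * s * rho)%g) (fun s => (rho * s * rho)%g).
  have rr : (rho * rho = 1)%g.
    by apply/permP => i; rewrite permM !permE rev_ordK.
  by move=> s; rewrite !mulgA rr mul1g -mulgA rr mulg1.
rewrite [RHS](reindex_inj (can_inj rhoK)) /=; apply: eq_bigr => s _.
rewrite tinv_tpure; congr tpure; apply: (@eq_from_nth _ 0) => [|i].
  by rewrite size_rev size_map !size_word_perm.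
rewrite size_rev size_map size_word_perm => ik; pose j := Ordinal ik.
have jk := ltn_ord (rev_ord j); have szm : size (map c (word_perm w s)) = k.
  by rewrite size_map size_word_perm.
rewrite nth_rev szm //.
rewrite (nth_map 0) ?size_word_perm //.
rewrite (word_perm_nth w s (rev_ord j)) (word_perm_nth _ _ j) !permM !permE.
rewrite nth_rev ?size_map ?ltn_ord // (nth_map 0); last exact: (ltn_ord (rev_ord _)).
congr (c (nth 0 w _)).
by rewrite -[RHS]/(nat_of_ord (rev_ord (rev_ord (s (rev_ord j))))) rev_ordK.
Qed.

Lemma tinv_tsym X : tinv c (tsym X) = tsym (tinv c X).
Proof.
elim/tensor_ind: X => [|a w X IH]; first by rewrite tinv0 linear0 tinv0.
by rewrite tinvP !linearP /= tinvP IH tinv_tpure !tsym_tpure tsym_tinv_word.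
Qed.

Lemma sinvE X : sinv c X = tinv c X :> tensor.
Proof.
have -> // : sinv c X = insubd 0 (tinv c X) by [].
rewrite insubdK //; case: X => X /= /symmetric_tensorP [Y _ <-].
by apply/symmetric_tensorP; exists (tinv c Y); rewrite // tinv_tsym.
Qed.

End Involution.
End TensorAlgebra.

Section Completion.
Context (R : realType).
Local Notation C := R[i].

(* Cauchy filters for the uniformity of the topological vector space; the one
   carried by a [tvsType] is only required to induce its topology. *)
Definition tvs_cauchy (A : tvsType C) (F : set_system A) :=
  forall U : set A, nbhs 0 U ->
    exists2 B, F B & forall x y, B x -> B y -> U (x - y).

Definition tvs_complete (A : tvsType C) :=
  forall F : set_system A, ProperFilter F -> tvs_cauchy F ->
    exists x : A, F --> x.

(* [j] exhibits [A] as the (Hausdorff) completion of [E]. *)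
Definition is_completion (E : preTopologicalLmodType C) (A : tvsType C)
    (j : {linear E -> A}) :=
  [/\ hausdorff_space A, tvs_complete A,
      forall U : set E, open U <-> exists2 W : set A, open W & U = j @^-1` W &
      dense (range j)].

End Completion.

(* The continuous map [g] with [g \o i = k]; it is unique when [i] has dense
   range and [F] is Hausdorff.  The default value [y0] is returned when no
   such map exists. *)
Definition continuous_extension (D : Type) (E F : topologicalType)
    (i : D -> E) (k : D -> F) (y0 : F) : E -> F :=
  xget (fun=> y0) [set g : E -> F | continuous g /\ forall x, g (i x) = k x].

Section CompletedAlgebra.
Context (R : realType) (V : tvsType R[i]) (A : tvsType R[i]).
Variable (j : {linear symt V -> A}).

Definition cpl_star (Lam : V -> V -> R[i]) (X Y : A) : A :=
  continuous_extension (fun p : symt V * symt V => (j p.1, j p.2))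
    (fun p => j (star Lam p.1 p.2)) 0 (X, Y).

Definition cpl_inv (c : V -> V) : A -> A :=
  continuous_extension j (fun X => j (sinv c X)) 0.

End CompletedAlgebra.

Section GNS.
Context (R : realType) (A : lmodType R[i]).
Variables (mul : A -> A -> A) (inv : A -> A) (omega : A -> R[i]).

Definition positive_functional := forall Y, 0 <= omega (mul (inv Y) Y).

Definition gns_kernel : set A := [set Y | omega (mul (inv Y) Y) = 0].

Lemma gns_kernel_submodule :
  positive_hermitian (fun Y Z => omega (mul (inv Y) Z)) ->
  submodule_set gns_kernel.
Proof.
set h := fun Y Z => _; case=> hr hC h0.
have hl (a : R[i]) x y z : h (a *: x + y) z = a^* * h x z + h y z.
  by rewrite hC hr rmorphD rmorphM [in RHS]hC [h y z]hC.
have h00 z : h z 0 = 0.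
  by have := hr z (-1) 0 0; rewrite scaler0 addr0 mulN1r addNr.
split; first exact: h00.
move=> a u v; rewrite /gns_kernel /= -!/(h _ _) => u0 v0.
have E b : h (b *: u + v) (b *: u + v) = b^* * h u v + b * h v u.
  by rewrite hl !hr u0 v0 mulr0 add0r addr0.
apply/eqP; rewrite eq_le h0 andbT E.
have := h0 (- a *: u + v); rewrite E rmorphN !mulNr -opprD oppr_ge0.
exact.
Qed.

(* The quotient of [A] by (the span of) [gns_kernel], which is a subspace
   when [omega] is positive: see [gns_kernel_submodule] and [lspan_id]. *)
Definition gns_space : lmodType R[i] := quotmod gns_kernel.

Definition gns_class (Y : A) : gns_space := qproj gns_kernel Y.

Definition gns_inner (y z : gns_space) : R[i] :=
  omega (mul (inv (repr y)) (repr z)).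

Definition gns_rep (X : A) (y : gns_space) : gns_space :=
  gns_class (mul X (repr y)).

End GNS.

Section Operators.
Context (R : realType).
Local Notation C := R[i].

Definition analytic_vector (H : lmodType C) (ip : H -> H -> C) (T : H -> H)
    (psi : H) :=
  exists2 e : R, 0 < e &
    cvgn (series (fun n => e ^+ n / n`!%:R * hnorm ip (iter n T psi))).

(* [iota] exhibits [K], with inner product [ipK], as the Hilbert space
   completion of [H]. *)
Definition is_hilbert_completion (H : lmodType C) (ip : H -> H -> C)
    (K : completeNormedModType C) (ipK : K -> K -> C) (iota : {linear H -> K}) :=
  [/\ positive_hermitian ipK, forall x, `|x| ^+ 2 = ipK x x,
      forall x y, ipK (iota x) (iota y) = ip x y &
      dense (range iota)].

Section Graphs.
Variables (K : completeNormedModType C) (ip : K -> K -> C).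

(* Unbounded operators are represented by their graphs. *)
Definition adjoint_graph (G : set (K * K)) : set (K * K) :=
  [set p | forall q, G q -> ip q.2 p.1 = ip q.1 p.2].

Definition self_adjoint (G : set (K * K)) :=
  [/\ forall x y y', G (x, y) -> G (x, y') -> y = y',
      dense (fst @` G) & adjoint_graph G = G].

End Graphs.

(* The closure of [T], as an operator with domain [H] in the completion of
   [H], is self-adjoint. *)
Definition essentially_self_adjoint (H : lmodType C) (ip : H -> H -> C)
    (T : H -> H) :=
  forall (K : completeNormedModType C) (ipK : K -> K -> C)
    (iota : {linear H -> K}), is_hilbert_completion ip ipK iota ->
  self_adjoint ipK (closure [set (iota x, iota (T x)) | x in [set: H]]).

End Operators.

(* Main.v *)
Require Import Defs.
From HB Require Import structures.
From mathcomp Require Import all_boot all_order perm all_algebra.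
From mathcomp Require Import all_classical all_reals all_analysis.
From mathcomp Require Import complex.
From mathcomp Require Import zify ring lra.

Set Implicit Arguments.
Unset Strict Implicit.
Unset Printing Implicit Defensive.

Import Order.TTheory GRing.Theory Num.Theory.
Import numFieldNormedType.Exports.

Local Open Scope classical_set_scope.
Local Open Scope ring_scope.

(** Self-adjointness comes from analyticity, and analyticity from a factorial
    bound. In the GNS space [|pi(X)^n [Y]|^2 = omega(Y^* X^(2n) Y)], products
    being star products; if [|omega(Y^* X^m Y)| <= D K^m m!] for all [m], then
    [|pi(X)^n [Y]|] is at most [M L^n n!] and the exponential series converges
    for small arguments ([gns_analytic]).

    The factorial bound is first proved for symmetric tensors. There [star] is
    the symmetrisation of a simpler product on the whole tensor algebra, the
    Wick product [wick], in which a letter [x] on the left acts on [Y] as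
    multiplication by [x] plus the derivation that contracts [Lam x] with [Y].
    The Wick product is associative and is reversed by the involution, as an
    induction on words shows. By polarization symmetric tensors are combinations
    of powers, and on powers both products are given by the same binomial formula
    ([star_to_symt]). Let [h] be a Hilbert form dominating [Lam], let [X] have
    degree at most two and let [Z] be symmetric and homogeneous of degree [k].
    The product of [X] and [Z] has at most six homogeneous terms of degree at most
    [k + 2], each of norm at most [2 (k + 2) |X| |Z|] in the norm that [h] induces
    on tensors. For the terms in which
    letters of the quadratic part of [X] are contracted this is a Hilbert-Schmidt
    estimate, obtained from Gram-Schmidt vectors and the Parseval and Bessel
    relations for the first tensor factor ([quadratic_estimates]). The [m]-th
    power lives in degree at most [2 m], so its norm is at most
    [(24 |X|)^m m!] ([wick_power_norm]).

    The algebraic laws pass to the completion by density. The functional sending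
    [Z] to [omega(Y^* Z Y)] is continuous, hence bounded by the norm of one
    Hilbert form, and [X] is a limit of elements of degree at most two that are
    bounded in this norm; so the factorial bound passes to the limit ([power_growth]).

    Nelson's theorem [nelson_analytic], that a symmetric operator [T] whose domain
    consists of analytic vectors is essentially self-adjoint, reduces to the
    density of the ranges of [T + i] and [T - i]. It is proved without a
    functional calculus. If [|T^n psi| <= D n! r^n], the truncated exponentials
    of [w T], with [w] imaginary of modulus [1 / (16 r)], hardly increase the
    norm of [psi] ([texp_norm_le]), whereas modulo the range of [T - z], where [z]
    is [i] or [-i], they multiply [psi] by a real number at least [1 + |w|]. The
    distance of [psi] to the range is therefore zero ([shift_range_dense]). *)

(** * Complex scalars and positive Hermitian forms *)

Section ComplexScalars.
Context (R : realType).
Local Notation C := R[i].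
Implicit Types x y : C.

Lemma conjCD x y : (x + y)^* = x^* + y^*. Proof. exact: rmorphD. Qed.
Lemma conjCM x y : (x * y)^* = x^* * y^*. Proof. exact: rmorphM. Qed.
Lemma conjCN x : (- x)^* = - x^*. Proof. exact: rmorphN. Qed.
Lemma conjC_sum (I : Type) (r : seq I) (P : pred I) (F : I -> C) :
  (\sum_(i <- r | P i) F i)^* = \sum_(i <- r | P i) (F i)^*.
Proof. exact: rmorph_sum. Qed.
Lemma conjCR (r : R) : (r%:C%C)^* = r%:C%C :> C.
Proof. by rewrite conj_Creal // complex_real. Qed.
Implicit Types a b : R.
Lemma RcD a b : (a + b)%:C%C = a%:C%C + b%:C%C :> C. Proof. exact: rmorphD. Qed.
Lemma RcB a b : (a - b)%:C%C = a%:C%C - b%:C%C :> C. Proof. exact: rmorphB. Qed.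
Lemma RcM a b : (a * b)%:C%C = a%:C%C * b%:C%C :> C. Proof. exact: rmorphM. Qed.
Lemma RcX a n : (a ^+ n)%:C%C = a%:C%C ^+ n :> C. Proof. exact: rmorphXn. Qed.
Lemma RcV a : (a^-1)%:C%C = a%:C%C^-1 :> C. Proof. exact: fmorphV. Qed.
Lemma Rc_nat n : (n%:R : R)%:C%C = n%:R :> C. Proof. exact: rmorph_nat. Qed.
Lemma Rc_sum (I : Type) (r : seq I) (P : pred I) (F : I -> R) :
  (\sum_(i <- r | P i) F i)%:C%C = \sum_(i <- r | P i) (F i)%:C%C :> C.
Proof. exact: rmorph_sum. Qed.
Implicit Types z : C.

(** The norm of [R[i]] takes its values in [R[i]]; [nrm] is the same norm with
    values in [R]. *)
Definition nrm (z : C) : R := complex.Re `|z|.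

Lemma nrmE z : `|z| = (nrm z)%:C%C.
Proof. by rewrite /nrm normc_def. Qed.
Lemma nrm_ge0 z : 0 <= nrm z.
Proof. by rewrite -lecR -nrmE normr_ge0. Qed.
Lemma nrmM x y : nrm (x * y) = nrm x * nrm y.
Proof. by apply: (@complexI R); rewrite RcM -!nrmE normrM. Qed.
Lemma nrmD x y : nrm (x + y) <= nrm x + nrm y.
Proof. by rewrite -lecR RcD -!nrmE ler_normD. Qed.
Lemma nrm0 : nrm 0 = 0.
Proof. by apply: (@complexI R); rewrite -nrmE normr0. Qed.
Lemma nrmR (a : R) : 0 <= a -> nrm a%:C%C = a.
Proof. by move=> a0; apply: (@complexI R); rewrite -nrmE ger0_norm // ler0c. Qed.
Lemma nrmV z : nrm z^-1 = (nrm z)^-1.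
Proof. by apply: (@complexI R); rewrite RcV -!nrmE normfV. Qed.
End ComplexScalars.

Section LinearPredicates.
Context (K : pzRingType) (U W : lmodType K) (f : U -> W) (fl : linear f).

Lemma linpred0 : f 0 = 0.
Proof. by have := fl (-1) 0 0; rewrite scaler0 addr0 scaleN1r addNr. Qed.
Lemma linpredD x y : f (x + y) = f x + f y.
Proof. by rewrite -[x in LHS]scale1r fl scale1r. Qed.
Lemma linpredZ a x : f (a *: x) = a *: f x.
Proof. by rewrite -[_ *: x in LHS]addr0 fl linpred0 addr0. Qed.
Lemma linpredN x : f (- x) = - f x.
Proof. by rewrite -scaleN1r linpredZ scaleN1r. Qed.
Lemma linpredB x y : f (x - y) = f x - f y.
Proof. by rewrite linpredD linpredN. Qed.
Lemma linpred_sum (I : Type) (r : seq I) (P : pred I) (F : I -> U) :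
  f (\sum_(i <- r | P i) F i) = \sum_(i <- r | P i) f (F i).
Proof. exact: (big_morph f linpredD linpred0). Qed.
End LinearPredicates.

Section PosHerm.
Context (R : realType) (E : lmodType R[i]).
Local Notation C := R[i].
Variables (h : E -> E -> C) (hh : positive_hermitian h).

Lemma herm_Dr x y z : h x (y + z) = h x y + h x z.
Proof. by case: hh => H _ _; rewrite -[y]scale1r H mul1r scale1r. Qed.

Lemma herm_0r x : h x 0 = 0.
Proof. by apply: (addrI (h x 0)); rewrite -herm_Dr !addr0. Qed.

Lemma herm_Zr a x y : h x (a *: y) = a * h x y.
Proof. by case: hh => H _ _; rewrite -[_ *: y]addr0 H herm_0r addr0. Qed.

Lemma herm_C x y : h y x = (h x y)^*.
Proof. by case: hh. Qed.

Lemma herm_Dl x y z : h (x + y) z = h x z + h y z.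
Proof. by rewrite herm_C herm_Dr conjCD [in RHS]herm_C [h y z]herm_C. Qed.

Lemma herm_0l x : h 0 x = 0.
Proof. by rewrite herm_C herm_0r conjC0. Qed.

Lemma herm_Zl a x y : h (a *: x) y = a^* * h x y.
Proof. by rewrite herm_C herm_Zr conjCM -herm_C. Qed.

Lemma herm_Nr x y : h x (- y) = - h x y.
Proof. by rewrite -scaleN1r herm_Zr mulN1r. Qed.

Lemma herm_Nl x y : h (- x) y = - h x y.
Proof. by rewrite herm_C herm_Nr conjCN -herm_C. Qed.

Lemma herm_Br x y z : h x (y - z) = h x y - h x z.
Proof. by rewrite herm_Dr herm_Nr. Qed.

Lemma herm_Bl x y z : h (x - y) z = h x z - h y z.
Proof. by rewrite herm_Dl herm_Nl. Qed.

Lemma herm_sumr (I : Type) (r : seq I) (P : pred I) (F : I -> E) x :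
  h x (\sum_(i <- r | P i) F i) = \sum_(i <- r | P i) h x (F i).
Proof. exact: (big_morph (h x) (herm_Dr x) (herm_0r x)). Qed.

Lemma herm_suml (I : Type) (r : seq I) (P : pred I) (F : I -> E) x :
  h (\sum_(i <- r | P i) F i) x = \sum_(i <- r | P i) h (F i) x.
Proof. exact: (big_morph (h^~ x) (fun y z => herm_Dl y z x) (herm_0l x)). Qed.

Lemma herm_ge0 x : 0 <= h x x.
Proof. by case: hh. Qed.

Lemma hnorm_ge0 x : 0 <= hnorm h x.
Proof. exact: sqrtr_ge0. Qed.

Lemma hnormE x : h x x = ((hnorm h x) ^+ 2)%:C%C.
Proof.
have := herm_ge0 x; rewrite /hnorm; case: (h x x) => a b.
rewrite lecE /= => /andP[/eqP -> a0].
by rewrite sqr_sqrtr.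
Qed.

(** The form may be degenerate. A vector that is not null allows the usual
    projection; if both are null, the square of [x - h y x *: y] is
    [- 2 |h x y|^2]. *)
Lemma cauchy_schwarz x y : `|h x y| ^+ 2 <= h x x * h y y.
Proof.
have key u v : h v v * `|h u v| ^+ 2 <= h v v * (h u u * h v v).
  have := herm_ge0 (h v v *: u - h v u *: v).
  rewrite herm_Br !herm_Bl !herm_Zr !herm_Zl normCK -(herm_C u v) -(herm_C v u).
  rewrite -(herm_C v v) => ge0; rewrite -subr_ge0; apply: le_trans ge0 _.
  by rewrite le_eqVlt; apply/orP; left; apply/eqP; ring.
have [hv|hv] := eqVneq (h y y) 0; last first.
  have: 0 < h y y by rewrite lt_def hv herm_ge0.
  by move=> vp; rewrite -(ler_pM2l vp) key.
have [hu|hu] := eqVneq (h x x) 0; last first.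
  have: 0 < h x x by rewrite lt_def hu herm_ge0.
  move=> up; rewrite -(ler_pM2l up) [h x x * h y y]mulrC.
  by rewrite (herm_C y x) norm_conjC key.
have := herm_ge0 (x - h y x *: y).
rewrite herm_Br !herm_Bl !herm_Zr !herm_Zl hu hv !mulr0 subr0 sub0r.
rewrite normCK -(herm_C x y) -(herm_C y x) [h y x * _]mulrC.
by rewrite -opprD oppr_ge0 -mulr2n pmulrn_lle0.
Qed.

Lemma cauchy_schwarz_norm x y : `|h x y| <= (hnorm h x * hnorm h y)%:C%C.
Proof.
rewrite -(@ler_pXn2r _ 2) ?nnegrE ?normr_ge0 //; last first.
  by rewrite ler0c mulr_ge0 // hnorm_ge0.
by rewrite -(RcX (_ * _)) exprMn RcM -!hnormE cauchy_schwarz.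
Qed.

Lemma hnorm_eq0 x : h x x = 0 -> hnorm h x = 0.
Proof. by rewrite /hnorm => ->; rewrite sqrtr0. Qed.

Lemma herm_kernel x y : h x x = 0 -> h x y = 0.
Proof.
move=> x0; have := cauchy_schwarz x y; rewrite x0 mul0r => le0.
have/eqP : `|h x y| ^+ 2 = 0 by apply/eqP; rewrite eq_le le0 exprn_ge0.
by rewrite expf_eq0 /= normr_eq0 => /eqP.
Qed.

Lemma hnormD x y : hnorm h (x + y) <= hnorm h x + hnorm h y.
Proof.
rewrite -(@ler_pXn2r _ 2) ?nnegrE ?addr_ge0 ?hnorm_ge0 //.
rewrite -lecR -hnormE herm_Dl !herm_Dr !hnormE sqrrD !RcD.
rewrite -!addrA lerD2l !addrA lerD2r.
apply: le_trans (lerD (cauchy_schwarz_norm x y) (cauchy_schwarz_norm x y)).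
rewrite (herm_C x y) -[X in _ <= _ + X]norm_conjC.
apply: le_trans (ler_normD _ _); apply: real_ler_norm.
by rewrite CrealE conjCD conjCK addrC.
Qed.

Lemma hnormZ a x : (hnorm h (a *: x))%:C%C = `|a| * (hnorm h x)%:C%C.
Proof.
apply/eqP; rewrite -(@eqrXn2 _ 2) //; first last.
- by rewrite mulr_ge0 // ler0c hnorm_ge0.
- by rewrite ler0c hnorm_ge0.
rewrite exprMn -!(RcX (hnorm _ _)) -!hnormE herm_Zr herm_Zl normCK.
by apply/eqP; ring.
Qed.

Lemma hnormZr (a : R) x : 0 <= a -> hnorm h (a%:C%C *: x) = a * hnorm h x.
Proof.
move=> a0; apply: (@complexI R); rewrite hnormZ ger0_norm ?ler0c //.
by rewrite RcM.
Qed.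

Lemma hnorm0 : hnorm h 0 = 0.
Proof. by rewrite hnorm_eq0 // herm_0l. Qed.

Lemma hnormN x : hnorm h (- x) = hnorm h x.
Proof. by rewrite /hnorm herm_Nr herm_Nl opprK. Qed.

Lemma hnorm_sum (I : Type) (r : seq I) (P : pred I) (F : I -> E) :
  hnorm h (\sum_(i <- r | P i) F i) <= \sum_(i <- r | P i) hnorm h (F i).
Proof.
elim/big_rec2: _ => [|i y x _ le]; first by rewrite hnorm0.
by apply: le_trans (hnormD _ _) _; rewrite lerD2l.
Qed.

(** Families are indexed by [nat] so that Gram-Schmidt lengthens them without casts. *)
Definition orthonormal_upto (n : nat) (e : nat -> E) :=
  forall i j, (i < n)%N -> (j < n)%N -> h (e i) (e j) = (i == j)%:R.

(** The expansion of [x] along [e], tested against all [y]. As [h] may be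
    degenerate, this replaces membership of [x] in the span of the [e i]. *)
Definition resolves (n : nat) (e : nat -> E) (x : E) :=
  forall y, h x y = \sum_(i < n) h x (e i) * h (e i) y.

Section Orthonormal.
Variables (n : nat) (e : nat -> E) (on : orthonormal_upto n e).

Lemma orthonormal_comb (a : nat -> C) k : (k < n)%N ->
  h (e k) (\sum_(i < n) a i *: e i) = a k.
Proof.
move=> kn; rewrite herm_sumr (bigD1 (Ordinal kn)) //= big1 ?addr0.
  by rewrite herm_Zr on // eqxx mulr1.
move=> i ik; rewrite herm_Zr on // (_ : _ == _ = false) ?mulr0 //.
by apply/eqP => ki; case/eqP: ik; apply: val_inj.
Qed.

Lemma orthonormal_comb_norm (a : nat -> C) :
  h (\sum_(i < n) a i *: e i) (\sum_(i < n) a i *: e i) = \sum_(i < n) `|a i| ^+ 2.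
Proof.
rewrite [LHS]herm_suml; apply: eq_bigr => i _.
by rewrite herm_Zl orthonormal_comb // normCK mulrC.
Qed.

Lemma bessel y : \sum_(i < n) `|h (e i) y| ^+ 2 <= h y y.
Proof.
pose p := \sum_(i < n) h (e i) y *: e i.
have := herm_ge0 (y - p); rewrite herm_Br !herm_Bl.
have py : h p y = \sum_(i < n) `|h (e i) y| ^+ 2.
  by rewrite herm_suml; apply: eq_bigr => i _; rewrite herm_Zl normCK mulrC.
have yp : h y p = \sum_(i < n) `|h (e i) y| ^+ 2.
  by rewrite herm_C py conjC_sum; apply: eq_bigr => i _; rewrite normCK conjCM conjCK mulrC.
have pp : h p p = \sum_(i < n) `|h (e i) y| ^+ 2 := orthonormal_comb_norm (fun i => h (e i) y).
by rewrite py yp pp subrr subr0 subr_ge0.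
Qed.

Lemma resolves_defect x (z := x - \sum_(i < n) h (e i) x *: e i) :
  resolves n e x -> h z z = 0.
Proof.
move=> rx; have kz y : h z y = 0.
  rewrite /z herm_Bl herm_suml rx -sumrB big1 // => i _.
  by rewrite herm_Zl -herm_C subrr.
exact: kz.
Qed.
End Orthonormal.

(** What is left of a vector after projection is normalized and appended, unless
    it is null, in which case the vector is already resolved. *)
Lemma gram_schmidt (s : seq E) : exists n e,
  orthonormal_upto n e /\ forall x, x \in s -> resolves n e x.
Proof.
elim: s => [|x s [n [e [on rs]]]]; first by exists 0, (fun=> 0).
pose z := x - \sum_(i < n) h (e i) x *: e i.
have hxy y : h x y = \sum_(i < n) h x (e i) * h (e i) y + h z y.
  rewrite /z herm_Bl herm_suml [X in _ - X](eq_bigr (fun i : 'I_n => h x (e i) * h (e i) y)).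
    by rewrite addrC subrK.
  by move=> i _; rewrite herm_Zl -herm_C.
have zo k : (k < n)%N -> h (e k) z = 0.
  move=> kn; rewrite /z herm_Br (orthonormal_comb on (fun i => h (e i) x)) //.
  by rewrite subrr.
have [z0|z0] := eqVneq (h z z) 0.
  exists n, e; split=> // y; rewrite inE => /orP[/eqP -> w|]; last exact: rs.
  by rewrite hxy (herm_kernel w z0) addr0.
pose u := (hnorm h z)^-1%:C%C *: z.
have nz : hnorm h z != 0.
  by apply: contra_neq z0 => nz; rewrite hnormE nz expr0n.
have uu : h u u = 1.
  rewrite herm_Zl herm_Zr conjCR hnormE -!RcM exprS expr1.
  by rewrite mulKf // mulVf // rmorph1.
have uo k : (k < n)%N -> h (e k) u = 0.
  by move=> kn; rewrite herm_Zr zo // mulr0.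
pose e' k := if (k < n)%N then e k else u.
have e'n (i : 'I_n) : e' i = e i by rewrite /e' ltn_ord.
have e'l : e' n = u by rewrite /e' ltnn.
have xy y : h x y = \sum_(i < n.+1) h x (e' i) * h (e' i) y.
  rewrite big_ord_recr /= e'l.
  rewrite [X in X + _](eq_bigr (fun i : 'I_n => h x (e i) * h (e i) y)); last first.
    by move=> i _; rewrite e'n.
  rewrite hxy; congr (_ + _).
  have -> : h x u = (hnorm h z)%:C%C.
    rewrite hxy big1 ?add0r; last by move=> i _; rewrite uo // mulr0.
    by rewrite herm_Zr hnormE -RcM exprS expr1 mulKf.
  by rewrite herm_Zl conjCR mulrA -RcM divff // mul1r.
exists n.+1, e'; split.
  move=> i j; rewrite !ltnS /e' leq_eqVlt => /orP[/eqP ->|li]; rewrite leq_eqVlt.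
    move=> /orP[/eqP ->|lj]; first by rewrite ltnn eqxx.
    by rewrite ltnn lj herm_C uo // conjC0 gtn_eqF.
  move=> /orP[/eqP ->|lj]; first by rewrite li ltnn uo // ltn_eqF.
  by rewrite li lj on.
move=> y; rewrite inE => /orP[/eqP -> //|/rs ry w].
rewrite ry big_ord_recr /= e'l.
rewrite [X in _ = X + _](eq_bigr (fun i : 'I_n => h y (e i) * h (e i) w)); last first.
  by move=> i _; rewrite e'n.
have -> : h y u = 0 by rewrite ry big1 // => i _; rewrite uo // mulr0.
by rewrite mul0r addr0.
Qed.

End PosHerm.

(** * Analytic vectors and essential self-adjointness *)

Lemma bin_le_exp n m : ('C(n, m) <= 2 ^ n)%N.
Proof.
elim: n m => [|n IH] [|m] //; first by rewrite bin0 expn_gt0.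
by rewrite binS expnS mul2n -addnn leq_add.
Qed.

Lemma fact_add_le n m : ((n + m)`! <= 2 ^ (n + m) * (n`! * m`!))%N.
Proof.
have := bin_fact (leq_addr m n); rewrite addKn => <-.
by rewrite leq_mul // bin_le_exp.
Qed.

Lemma sum_triangle (U : nmodType) (f : nat -> nat -> U) N :
  \sum_(0 <= n < N) \sum_(0 <= m < N - n) f n m =
  \sum_(0 <= J < N) \sum_(0 <= n < J.+1) f n (J - n)%N.
Proof.
elim: N => [|N IH]; first by rewrite !big_geq.
rewrite [RHS]big_nat_recr //= -IH.
have -> : \sum_(0 <= n < N.+1) \sum_(0 <= m < N.+1 - n) f n m =
    \sum_(0 <= n < N.+1) (\sum_(0 <= m < N - n) f n m + f n (N - n)%N).
  by apply: eq_big_nat => n /andP[_ nN]; rewrite subSn // big_nat_recr.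
by rewrite big_split /= [in LHS]big_nat_recr //= subnn [X in _ + X + _]big_geq // addr0.
Qed.

Section Nelson.
Context (R : realType) (H : lmodType R[i]).
Local Notation C := R[i].
Variables (ip : H -> H -> C) (hip : positive_hermitian ip).
Variables (T : H -> H) (T_lin : linear T).
Hypothesis (T_sym : forall x y, ip (T x) y = ip x (T y)).

Lemma iter_lin n : linear (iter n T).
Proof. by move=> a x y; elim: n => //= n ->; rewrite T_lin. Qed.

Lemma ip_iter n m x y : ip (iter n T x) (iter m T y) = ip x (iter (n + m) T y).
Proof. by elim: n m => [|n IH] m //=; rewrite T_sym -iterS IH -addSnnS. Qed.

(** An application of [T] only increases the shift [k]: the truncated exponentials
    of a vector keep its rate [r]. *)
Definition exp_bounded (r : R) (psi : H) := exists D k, 0 <= D /\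
  forall n, hnorm ip (iter n T psi) <= D * (n + k)`!%:R * r ^+ n.

Lemma analytic_exp_bounded psi : analytic_vector ip T psi ->
  exists2 r, 0 < r & exp_bounded r psi.
Proof.
case=> e e0 /cvg_series_cvg_0 /(cvgP (0 : R)) /cvg_seq_bounded.
rewrite /bounded_near => /pinfty_ex_gt0 [M M0 bM].
exists e^-1; first by rewrite invr_gt0.
exists M, 0%N; split=> [|n]; first exact: ltW.
have /= := bM n I; rewrite ger0_norm; last first.
  by rewrite !mulr_ge0 ?invr_ge0 ?exprn_ge0 ?hnorm_ge0 ?ler0n // ltW.
rewrite addn0 exprVn mulrAC ler_pdivrMr ?ltr0n ?fact_gt0 // => le.
by rewrite ler_pdivlMr ?exprn_gt0 // mulrC.
Qed.

Lemma exp_bounded0 r : exp_bounded r 0.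
Proof.
have i0 n : iter n T 0 = 0 by elim: n => //= n ->; exact: linpred0 T_lin.
by exists 0, 0%N; split=> // n; rewrite i0 (hnorm0 hip) !mul0r.
Qed.

Lemma exp_boundedP r a x y : 0 < r ->
  exp_bounded r x -> exp_bounded r y -> exp_bounded r (a *: x + y).
Proof.
move=> r0 [D [k [D0 Dx]]] [D' [k' [D'0 Dy]]].
exists (nrm a * D + D'), (k + k')%N; split; first by rewrite addr_ge0 // mulr_ge0 // nrm_ge0.
move=> n; rewrite iter_lin; apply: le_trans (hnormD hip _ _) _.
have -> : hnorm ip (a *: iter n T x) = nrm a * hnorm ip (iter n T x).
  by apply: (@complexI R); rewrite hnormZ // RcM -nrmE.
rewrite -!mulrA mulrDl; apply: lerD; rewrite -?mulrA.
  rewrite ler_wpM2l ?nrm_ge0 //.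
  apply: le_trans (Dx n) _; rewrite -mulrA ler_wpM2l //.
  by rewrite ler_wpM2r ?exprn_ge0 ?(ltW r0) // ler_nat leq_fact // leq_add2l leq_addr.
apply: le_trans (Dy n) _; rewrite -mulrA ler_wpM2l //.
by rewrite ler_wpM2r ?exprn_ge0 ?(ltW r0) // ler_nat leq_fact // leq_add2l leq_addl.
Qed.

Lemma exp_boundedT r x : 0 < r -> exp_bounded r x -> exp_bounded r (T x).
Proof.
move=> r0 [D [k [D0 Dx]]]; exists (D * r), k.+1; split; first by rewrite mulr_ge0 // ltW.
move=> n; rewrite -iterSr; apply: le_trans (Dx n.+1) _.
by rewrite addSnnS exprS le_eqVlt; apply/orP; left; apply/eqP; ring.
Qed.

Section TruncatedExponential.
Variables (w : C) (s : R).
Hypotheses (w_norm : `|w| = s%:C%C) (w_conj : w^* = - w).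

Definition texp N psi := \sum_(0 <= n < N) (w ^+ n / n`!%:R) *: iter n T psi.

Lemma texp_exp_bounded r N psi : 0 < r -> exp_bounded r psi -> exp_bounded r (texp N psi).
Proof.
move=> r0 pb; rewrite /texp; elim: N => [|N IH]; first by rewrite big_geq //; exact: exp_bounded0.
rewrite big_nat_recr //= addrC; apply: exp_boundedP => //.
by elim: N {IH} => //= N; apply: exp_boundedT.
Qed.

(** [texp] truncates the exponential of the skew-symmetric operator [w T], which
    would be an isometry. In the square of the norm the terms of total degree below
    [N] cancel; the others are bounded by a geometric series and carry a factor
    [2^-N]. *)
Lemma texp_norm_le r psi (d : R) : 0 < r -> s = (16 * r)^-1 -> exp_bounded r psi ->
  0 < d -> exists2 N, (1 < N)%N & hnorm ip (texp N psi) <= hnorm ip psi + d.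
Proof.
move=> r0 sr [D [k [D0 Db]]] d0.
pose mu J := ip psi (iter J T psi).
pose A := hnorm ip psi * D * (2 ^+ k * k`!%:R).
have A0 : 0 <= A by rewrite !mulr_ge0 ?hnorm_ge0 ?exprn_ge0.
have s0 : 0 <= s by rewrite sr invr_ge0 mulr_ge0 // ltW.
pose c n m : C := (- w) ^+ n / n`!%:R * (w ^+ m / m`!%:R).
have muE N : ip (texp N psi) (texp N psi) =
    \sum_(0 <= n < N) \sum_(0 <= m < N) c n m * mu (n + m)%N.
  rewrite /texp (herm_suml hip); apply: eq_bigr => n _.
  rewrite (herm_sumr hip); apply: eq_bigr => m _.
  rewrite (herm_Zl hip) (herm_Zr hip) ip_iter /c conjCM rmorphXn /= w_conj fmorphV /=.
  by rewrite rmorph_nat mulrA.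
(* The terms of total degree [J] add up to a multiple of [(w - w)^J]. *)
have low N : \sum_(0 <= n < N.+1) \sum_(0 <= m < N.+1 - n) c n m * mu (n + m)%N = mu 0%N.
  rewrite sum_triangle big_nat_recl // [X in _ + X]big1_seq ?addr0.
    by rewrite big_nat1 /c !expr0 fact0 divr1 !mul1r.
  move=> J _; rewrite (eq_big_nat _ _ (F2 := fun n => c n (J.+1 - n)%N * mu J.+1)); last first.
    by move=> n /andP[_ nJ]; rewrite subnKC.
  rewrite -big_distrl /= (_ : \sum_(0 <= n < _) _ = 0) ?mul0r //.
  have f0 : (J.+1)`!%:R != 0 :> C by rewrite pnatr_eq0 -lt0n fact_gt0.
  apply: (mulfI f0); rewrite mulr0.
  transitivity ((w - w) ^+ J.+1); last by rewrite subrr expr0n.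
  rewrite exprDn big_distrr /= big_mkord; apply: eq_bigr => -[n /=]; rewrite ltnS => nJ _.
  rewrite -(bin_fact nJ) /c !natrM -mulr_natr.
  have n0 : n`!%:R != 0 :> C by rewrite pnatr_eq0 -lt0n fact_gt0.
  have m0 : (J.+1 - n)`!%:R != 0 :> C by rewrite pnatr_eq0 -lt0n fact_gt0.
  by field; rewrite n0 m0.
(* [(n + m + k)! <= 4^(n + m) 2^k k! n! m!], and [4 r s = 1 / 4]; one half of the
   resulting [4^-(n + m)] gives the factor [2^-N]. *)
have cbound N n m : (N <= n + m)%N ->
    `|c n m * mu (n + m)%N| <= (A / 2 ^+ N * (2^-1 ^+ n * 2^-1 ^+ m))%:C%C.
  move=> Nnm; rewrite normrM.
  have -> : `|c n m| = (s ^+ n / n`!%:R * (s ^+ m / m`!%:R))%:C%C.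
    rewrite !normrM !normfV !normrX normrN w_norm !normr_nat.
    by rewrite !RcM !RcX !RcV !Rc_nat.
  apply: le_trans (ler_wpM2l _ (cauchy_schwarz_norm hip _ _)) _.
    by rewrite ler0c !mulr_ge0 ?invr_ge0 ?exprn_ge0.
  rewrite -RcM lecR.
  apply: le_trans (ler_wpM2l _ (ler_wpM2l (hnorm_ge0 _ _) (Db (n + m)%N))) _.
    by rewrite !mulr_ge0 ?invr_ge0 ?exprn_ge0.
  have f1 : ((n + m + k)`! <= 2 ^ (n + m + k) * (2 ^ (n + m) * (n`! * m`!) * k`!))%N.
    apply: leq_trans (fact_add_le _ _) _; rewrite leq_mul2l expn_eq0 /=.
    by rewrite leq_mul2r fact_add_le orbT.
  have {f1} f2 : (n + m + k)`!%:R <=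
      (4 ^+ (n + m)) * (2 ^+ k * k`!%:R) * (n`!%:R * m`!%:R) :> R.
    move: f1; rewrite -(ler_nat R) => /le_trans; apply.
    rewrite !natrM !natrX (exprD _ (n + m)) (_ : (4 : R) = 2 * 2) ?exprMn; last by lra.
    by rewrite le_eqVlt; apply/orP; left; apply/eqP; ring.
  have n0 : n`!%:R != 0 :> R by rewrite pnatr_eq0 -lt0n fact_gt0.
  have m0 : m`!%:R != 0 :> R by rewrite pnatr_eq0 -lt0n fact_gt0.
  apply: (@le_trans _ _ (s ^+ n / n`!%:R * (s ^+ m / m`!%:R) * (hnorm ip psi * (D *
     (4 ^+ (n + m) * (2 ^+ k * k`!%:R) * (n`!%:R * m`!%:R)) * r ^+ (n + m))))).
    rewrite ler_wpM2l ?mulr_ge0 ?invr_ge0 ?exprn_ge0 // ler_wpM2l ?hnorm_ge0 //.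
    by rewrite ler_wpM2r ?exprn_ge0 ?(ltW r0) // ler_wpM2l.
  have -> : s ^+ n / n`!%:R * (s ^+ m / m`!%:R) * (hnorm ip psi * (D *
     (4 ^+ (n + m) * (2 ^+ k * k`!%:R) * (n`!%:R * m`!%:R)) * r ^+ (n + m))) =
     A * (s ^+ (n + m) * 4 ^+ (n + m) * r ^+ (n + m)).
    by rewrite /A (exprD s); field; rewrite n0 m0.
  rewrite -(mulrA A) ler_wpM2l // -!exprMn -mulrA.
  have -> : s * (4 * r) = 2^-1 * 2^-1.
    by rewrite sr invfM; field; rewrite gt_eqF.
  rewrite exprMn -(exprD _ n m) -exprVn ler_wpM2r ?exprn_ge0 ?invr_ge0 //.
  by rewrite ler_wiXn2l ?invr_ge0 ?invf_le1 // ler1n.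
have geom N : \sum_(0 <= n < N) (2^-1 : R) ^+ n <= 2.
  suff: \sum_(0 <= n < N) (2^-1 : R) ^+ n <= 2 - 2 * 2^-1 ^+ N.
    by move=> /le_trans; apply; rewrite gerBl mulr_ge0 ?exprn_ge0 ?invr_ge0.
  elim: N => [|N IH]; first by rewrite big_geq // expr0; lra.
  rewrite big_nat_recr //= exprS; lra.
have AN N : 0 <= A / 2 ^+ N by rewrite divr_ge0.
have upper N : hnorm ip (texp N.+1 psi) ^+ 2 <= hnorm ip psi ^+ 2 + A / 2 ^+ N.+1 * 4.
  rewrite -lerBlDl -lecR.
  apply: (@le_trans _ _ `|(hnorm ip (texp N.+1 psi) ^+ 2 - hnorm ip psi ^+ 2)%:C%C|).
    by apply: real_ler_norm; rewrite complex_real.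
  rewrite RcB -!hnormE // muE.
  have -> : ip psi psi = mu 0%N by [].
  rewrite -(low N) -sumrB.
  rewrite (eq_big_nat _ _ (F2 := fun n => \sum_(N.+1 - n <= m < N.+1) c n m * mu (n + m)%N)).
    apply: le_trans (ler_norm_sum _ _ _) _.
    apply: (@le_trans _ _ (\sum_(0 <= n < N.+1) (A / 2 ^+ N.+1 * (2^-1 ^+ n * 2))%:C%C)).
      apply: ler_sum_nat => n /andP[_ nN]; apply: le_trans (ler_norm_sum _ _ _) _.
      apply: (@le_trans _ _ (\sum_(N.+1 - n <= m < N.+1)
          (A / 2 ^+ N.+1 * (2^-1 ^+ n * 2^-1 ^+ m))%:C%C)).
        apply: ler_sum_nat => m /andP[mN _]; apply: cbound.
        by rewrite -leq_subLR.
      rewrite -Rc_sum lecR -!big_distrr /= ler_wpM2l ?AN //.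
      rewrite ler_wpM2l ?exprn_ge0 ?invr_ge0 //.
      apply: le_trans (geom N.+1).
      rewrite [leRHS](@big_cat_nat _ _ _ (N.+1 - n)%N) //= ?leq_subr //.
      by rewrite lerDr sumr_ge0 // => i _; rewrite exprn_ge0.
    rewrite -Rc_sum lecR -big_distrr /= ler_wpM2l ?AN //.
    rewrite -big_distrl /= (_ : (4 : R) = 2 * 2); last by lra.
    by rewrite ler_wpM2r.
  move=> n /andP[_ nN].
  rewrite [X in X - _](@big_cat_nat _ _ _ (N.+1 - n)%N) //= ?leq_subr //.
  by rewrite addrAC subrr add0r.
pose N := (Num.bound (A * 4 / d ^+ 2)).+1; exists N.+1; first by rewrite ltnS.
rewrite -(@ler_pXn2r _ 2) ?nnegrE ?addr_ge0 ?hnorm_ge0 ?(ltW d0) //.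
apply: le_trans (upper N) _; rewrite sqrrD -addrA lerD2l.
apply: (@le_trans _ _ (d ^+ 2)); last by rewrite lerDr mulrn_wge0 // mulr_ge0 ?hnorm_ge0 ?ltW.
rewrite mulrAC ler_pdivrMr ?exprn_gt0 // [leRHS]mulrC -ler_pdivrMr ?exprn_gt0 //.
by apply/ltW/upper_nthrootP; rewrite ltnW.
Qed.

End TruncatedExponential.

(** The scalar [z] is [i] or [-i]. Modulo the range of [T - z] the operator [T] is
    multiplication by [z], so that [texp] is multiplication by a number [q]; the
    sign of [w] makes all terms of [q] positive, whence [q >= 1 + s]. As [texp]
    hardly increases the norm, each use of it divides the distance to the range
    by [1 + s]. *)
Lemma shift_range_dense (z : C) (psi : H) (d : R) : `|z| = 1 -> z^* = - z ->
  (forall x, analytic_vector ip T x) -> 0 < d ->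
  exists x, hnorm ip (psi - (T x - z *: x)) <= d.
Proof.
move=> z1 zc an d0; have [r r0 pb] := analytic_exp_bounded (an psi).
have [s sE] : exists s : R, s = (16 * r)^-1 by exists (16 * r)^-1.
pose w : C := s%:C%C * z^*; have s0 : 0 < s by rewrite sE invr_gt0 mulr_gt0.
have wn : `|w| = s%:C%C by rewrite normrM norm_conjC z1 mulr1 ger0_norm // ler0c ltW.
have wc : w^* = - w by rewrite /w conjCM conjCR conjCK zc mulrN opprK.
have wz : w * z = s%:C%C by rewrite /w -mulrA [_ * z]mulrC -normCK z1 expr1n mulr1.
pose ran y := exists x, y = T x - z *: x.
have T0 : T 0 = 0 := linpred0 T_lin.
have ranP a x y : ran x -> ran y -> ran (a *: x + y).
  move=> [x' ->] [y' ->]; exists (a *: x' + y'); rewrite T_lin !scalerBr !scalerDr.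
  by rewrite opprD !scalerA [a * z]mulrC addrACA.
have ran0 : ran 0 by exists 0; rewrite T0 scaler0 subrr.
have ran_iter n y : ran (iter n T y - z ^+ n *: y).
  elim: n => [|n IH]; first by rewrite expr0 scale1r subrr.
  have -> : iter n.+1 T y - z ^+ n.+1 *: y =
     1 *: (T (iter n T y) - z *: iter n T y) + (z *: (iter n T y - z ^+ n *: y) + 0).
    by rewrite scale1r addr0 scalerBr scalerA -exprS addrA subrK.
  by apply: (@ranP 1); [exists (iter n T y)|apply: (@ranP z)].
pose q N : C := \sum_(0 <= n < N) (w ^+ n / n`!%:R) * z ^+ n.
have ran_texp N y : ran (texp w N y - q N *: y).
  rewrite /texp /q scaler_suml -sumrB; elim: N => [|N IH]; first by rewrite big_geq.
  rewrite big_nat_recr //= addrC -[(_ * z ^+ N) *: y]scalerA -scalerBr; exact: ranP.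
have q_ge N : (1 < N)%N -> exists2 t : R, 1 + s <= t & q N = t%:C%C.
  move=> N1; exists (\sum_(0 <= n < N) s ^+ n / n`!%:R).
    rewrite (@big_cat_nat _ _ _ 2) //= 2?big_ltn // big_geq // addr0.
    rewrite expr0 expr1 !fact0 !divr1 lerDl sumr_ge0 // => n _.
    by rewrite divr_ge0 // exprn_ge0 // ltW.
  rewrite Rc_sum; apply: eq_bigr => n _.
  by rewrite mulrAC -exprMn wz RcM RcV RcX Rc_nat.
have improve (M : R) : 0 <= M ->
    (forall y e, exp_bounded r y -> 0 < e ->
       exists x, hnorm ip (y - (T x - z *: x)) <= M * hnorm ip y + e) ->
    (forall y e, exp_bounded r y -> 0 < e ->
       exists x, hnorm ip (y - (T x - z *: x)) <= M / (1 + s) * hnorm ip y + e).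
  move=> M0 hM y e yb e0.
  have e1 : 0 < e / (M + 1) by rewrite divr_gt0 // ltr_wpDl.
  have [N N1 le] := texp_norm_le wn wc r0 sE yb e1.
  have e2 : 0 < s * e by rewrite mulr_gt0.
  have [x xle] := hM (texp w N y) (s * e) (texp_exp_bounded w N r0 yb) e2.
  have [t ts qt] := q_ge N N1; have [x' x'E] := ran_texp N y.
  have t0 : 0 < t by apply: lt_le_trans ts; rewrite addr_gt0.
  exists (t^-1%:C%C *: (x - x')).
  have -> : y - (T (t^-1%:C%C *: (x - x')) - z *: (t^-1%:C%C *: (x - x'))) =
      t^-1%:C%C *: (texp w N y - (T x - z *: x)).
    rewrite (linpredZ T_lin) (linpredB T_lin).
    have ty : y = t^-1%:C%C *: (t%:C%C *: y).
      by rewrite scalerA -RcM mulVf ?scale1r // gt_eqF.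
    rewrite [X in X - _ = _]ty.
    rewrite [z *: (_ *: _)]scalerA [z * _]mulrC -scalerA -!scalerBr; congr (_ *: _).
    have -> : texp w N y = t%:C%C *: y + (T x' - z *: x').
      by rewrite -x'E qt addrC subrK.
    rewrite scalerBr !opprB -!addrA; congr (_ + _).
    by rewrite addrCA [_ + (T x' + _)]addrCA; exact: addrCA.
  rewrite (hnormZr hip) ?invr_ge0 ?(ltW t0) // ler_pdivrMl //.
  apply: le_trans xle _; apply: (@le_trans _ _ (M * (hnorm ip y + e / (M + 1)) + s * e)).
    by rewrite lerD2r ler_wpM2l.
  have s1 : 0 < 1 + s by rewrite addr_gt0.
  rewrite !mulrDr -addrA; apply: lerD.
    rewrite (_ : t * _ = t / (1 + s) * (M * hnorm ip y)); last by ring.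
    by rewrite ler_peMl ?mulr_ge0 ?hnorm_ge0 // ler_pdivlMr // mul1r.
  apply: (@le_trans _ _ ((1 + s) * e)); last by rewrite ler_pM2r.
  rewrite mulrDl mul1r lerD2r mulrA ler_pdivrMr ?ltr_wpDl //.
  by rewrite mulrDr mulr1 mulrC lerDl ltW.
have iterate k y e : exp_bounded r y -> 0 < e ->
    exists x, hnorm ip (y - (T x - z *: x)) <= (1 + s)^-1 ^+ k * hnorm ip y + e.
  elim: k y e => [|k IH] y e yb e0.
    exists 0; rewrite T0 scaler0 !subr0 expr0 mul1r lerDl; exact: ltW.
  by rewrite exprSr; apply: improve => //; rewrite exprn_ge0 // invr_ge0 addr_ge0 // ltW.
pose k := (Num.bound (hnorm ip psi * 2 / (d * s))).
have [|x xle] := iterate k psi (d / 2) pb; first by rewrite divr_gt0.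
exists x; apply: le_trans xle _.
rewrite [leRHS]splitr lerD2r exprVn mulrC ler_pdivrMr ?exprn_gt0 ?addr_gt0 //.
rewrite -ler_pdivrMl ?divr_gt0 // invfM invrK.
apply: (@le_trans _ _ (s * k%:R)).
  rewrite -ler_pdivrMl // mulrC.
  have -> : d^-1 * 2 * hnorm ip psi / s = hnorm ip psi * 2 / (d * s).
    by rewrite invfM; ring.
  by apply/ltW/archi_boundP; rewrite divr_ge0 ?mulr_ge0 ?hnorm_ge0 // ltW.
have bern n : 1 + s * n%:R <= (1 + s) ^+ n.
  elim: n => [|n IH]; first by rewrite mulr0 addr0 expr0.
  rewrite exprS; apply: le_trans (ler_wpM2l (addr_ge0 ler01 (ltW s0)) IH).
  rewrite -natr1 -subr_ge0 (_ : _ - _ = s * s * n%:R); last by ring.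
  by rewrite !mulr_ge0 // ltW.
by apply: le_trans (bern k); rewrite lerDr.
Qed.
End Nelson.

Lemma normc_small_eq0 (R : realType) (z : R[i]) (M : R) : 0 <= M ->
  (forall e : R, 0 < e -> `|z| <= (e * M)%:C%C) -> z = 0.
Proof.
move=> M0 hz; apply: contrapT => z0.
pose t := nrm z.
have zt : `|z| = t%:C%C := nrmE z.
have t0 : 0 < t by rewrite -ltcR -zt normr_gt0; apply/eqP.
have e0 : 0 < t / (2 * (M + 1)) by rewrite divr_gt0 // mulr_gt0 // ltr_wpDl.
have := hz _ e0; rewrite zt lecR mulrAC ler_pdivlMr ?mulr_gt0 ?ltr_wpDl //.
by apply/negP; rewrite -ltNge; nra.
Qed.

Section EssentialSelfAdjointness.
Context (R : realType) (H : lmodType R[i]).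
Local Notation C := R[i].
Variables (ip : H -> H -> C) (hip : positive_hermitian ip).
Variables (T : H -> H) (T_lin : linear T).
Hypothesis (T_sym : forall x y, ip (T x) y = ip x (T y)).
Hypothesis (T_an : forall x, analytic_vector ip T x).

Section InCompletion.
Variables (K : completeNormedModType C) (ipK : K -> K -> C) (iota : {linear H -> K}).
Hypotheses (hK : positive_hermitian ipK) (normK : forall x, `|x| ^+ 2 = ipK x x)
  (iotaK : forall x y, ipK (iota x) (iota y) = ip x y) (iota_dense : dense (range iota)).

Let N := hnorm ipK.

Lemma completion_norm x : `|x| = (N x)%:C%C.
Proof.
apply/eqP; rewrite -(@eqrXn2 _ 2) ?ler0c ?hnorm_ge0 //.
by rewrite normK (hnormE hK) RcX.
Qed.

Lemma hnorm_iota x : N (iota x) = hnorm ip x.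
Proof. by rewrite /N /hnorm iotaK. Qed.

Lemma iota_approx (k : K) (e : R) : 0 < e -> exists x, N (k - iota x) < e.
Proof.
move=> e0; have eC : 0 < e%:C%C :> C by rewrite ltcR.
have ne : (ball k e%:C%C)^° !=set0 by exists k; apply: nbhsx_ballx.
have [y [/interior_subset ky [x _ xy]]] := iota_dense ne (open_interior _).
by exists x; move: ky; rewrite -ball_normE /ball_ /= -xy completion_norm ltcR.
Qed.

Let G := [set (iota x, iota (T x)) | x in [set: H]].

Lemma closure_graphP (p : K * K) : closure G p <->
  forall e : R, 0 < e -> exists x, N (p.1 - iota x) < e /\ N (p.2 - iota (T x)) < e.
Proof.
split=> [cp e e0|hp B /nbhs_ballP [e /= e0 eB]].
  have eC : 0 < e%:C%C :> C by rewrite ltcR.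
  have [_ [[x _ <-] [/= b1 b2]]] := cp (ball p e%:C%C) (nbhsx_ballx _ _ eC).
  exists x; move: b1 b2; rewrite -ball_normE /ball_ /= => b1 b2.
  by split; [move: b1|move: b2]; rewrite completion_norm ltcR.
have eE : e = (complex.Re e)%:C%C.
  by apply/esym/RRe_real/gtr0_real.
have r0 : 0 < complex.Re e by rewrite -ltcR -eE.
have [x [x1 x2]] := hp _ r0.
exists (iota x, iota (T x)); split; first by exists x.
apply: eB; split => /=; rewrite -ball_normE /ball_ /= completion_norm eE ltcR //.
Qed.

Lemma closure_graph_adjoint (u v : K) :
  (forall x, ipK (iota (T x)) u = ipK (iota x) v) ->
  forall q, closure G q -> ipK q.2 u = ipK q.1 v.
Proof.
move=> huv q /closure_graphP cq; apply/eqP; rewrite -subr_eq0; apply/eqP.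
apply: (@normc_small_eq0 _ _ (N u + N v)); first by rewrite addr_ge0 ?hnorm_ge0.
move=> e /cq [x [x1 x2]].
have -> : ipK q.2 u - ipK q.1 v =
    ipK (q.2 - iota (T x)) u - ipK (q.1 - iota x) v.
  by rewrite !(herm_Bl hK) huv opprB addrA subrK.
apply: le_trans (ler_normB _ _) _; rewrite mulrDr RcD.
apply: lerD; apply: le_trans (cauchy_schwarz_norm hK _ _) _; rewrite lecR.
  by rewrite ler_wpM2r ?hnorm_ge0 // ltW.
by rewrite ler_wpM2r ?hnorm_ge0 // ltW.
Qed.

Lemma closure_graph_symmetric p q : closure G p -> closure G q ->
  ipK q.2 p.1 = ipK q.1 p.2.
Proof.
move=> cp cq; apply: closure_graph_adjoint cq => x.
rewrite (herm_C hK p.1) (herm_C hK p.2); congr (_^*).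
apply/esym; apply: closure_graph_adjoint cp => y.
by rewrite !iotaK T_sym.
Qed.

Lemma hnorm_le_shift (y : H) (z : C) : `|z| = 1 -> z^* = - z ->
  hnorm ip y <= hnorm ip (T y - z *: y).
Proof.
move=> z1 zc; rewrite -(@ler_pXn2r _ 2) ?nnegrE ?hnorm_ge0 // -lecR -!hnormE //.
have zz : - (z * z) = 1 by rewrite -mulrN -zc -normCK z1 expr1n.
rewrite (herm_Br hip) !(herm_Bl hip) !(herm_Zr hip) !(herm_Zl hip) zc (T_sym y y).
rewrite [leRHS](_ : _ = ip (T y) (T y) + - (z * z) * ip y y); last by ring.
by rewrite zz mul1r lerDr herm_ge0.
Qed.

(** For [(u, v)] in the adjoint graph choose [x] with [(T - i) x] close to
    [v - i u]. The difference [(a, b)] of [(u, v)] and [(x, T x)] is in the adjoint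
    graph too, and [w = b - i a] is small. Testing [a] against the dense range of
    [T + i] gives [|a| <= |w|], so that [(x, T x)] is close to [(u, v)]. *)
Lemma adjoint_in_closure (u v : K) :
  (forall x, ipK (iota (T x)) u = ipK (iota x) v) -> closure G (u, v).
Proof.
move=> huv; apply/closure_graphP => e e0.
have i1 : `|'i : C| = 1 by rewrite normCi.
have ic : ('i : C)^* = - 'i by rewrite conjCi.
(* [N w] will be at most [2 e / 5]; then [N a] and [N b <= N w + N a] are below [e]. *)
have e4 : 0 < e / 5 by rewrite divr_gt0.
have [k kle] := iota_approx (v - 'i *: u) e4.
have [x xle] := shift_range_dense hip T_lin T_sym k i1 ic T_an e4.
exists x => /=; set a := u - _; set b := v - _.
pose w := b - 'i *: a.
have wle : N w <= e / 5 * 2.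
  have -> : w = (v - 'i *: u - iota k) + iota (k - (T x - 'i *: x)).
    rewrite !(raddfB iota) /= (linearZ_LR iota) [RHS]addrA subrK /w /a /b scalerBr.
    by rewrite opprD opprK addrACA [in RHS]opprD opprK.
  apply: le_trans (hnormD hK _ _) _; rewrite mulr_natr mulr2n lerD ?(ltW kle) //.
  by rewrite -/N hnorm_iota.
have aw : N a <= N w.
  rewrite leNgt; apply/negP => lt.
  have a0 : 0 < N a by apply: le_lt_trans lt; exact: hnorm_ge0.
  have w0 : 0 <= N w by exact: hnorm_ge0.
  (* For this [d] the upper bound [(N a + d) N w + d N a] found for [N a ^ 2] is too small. *)
  pose d := N a * (N a - N w) / (2 * (N a + N w)).
  have d0 : 0 < d by rewrite divr_gt0 ?mulr_gt0 ?subr_gt0 // ltr_wpDr.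
  have [k' k'le] := iota_approx a (divr_gt0 d0 (ltr0n _ 2)).
  have i1' : `|- 'i : C| = 1 by rewrite normrN.
  have ic' : (- 'i : C)^* = - - 'i by rewrite conjCN ic.
  have [y yle] := shift_range_dense hip T_lin T_sym k' i1' ic' T_an (divr_gt0 d0 (ltr0n _ 2)).
  pose Y := T y - - 'i *: y.
  have Yle : N (a - iota Y) < d.
    have -> : a - iota Y = (a - iota k') + iota (k' - Y) by rewrite (raddfB iota k') /= addrA subrK.
    apply: le_lt_trans (hnormD hK _ _) _; rewrite [ltRHS]splitr ltr_leD //.
    by rewrite -/N hnorm_iota.
  have Ya : ipK (iota Y) a = ipK (iota y) w.
    rewrite /Y (raddfB iota) /= (linearZ_LR iota) (herm_Bl hK) (herm_Zl hK) ic' opprK.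
    rewrite /w (herm_Br hK _ b) (herm_Zr hK _ _ a); congr (_ - _).
    by rewrite /a /b !(herm_Br hK) huv !iotaK T_sym.
  have Yw : `|ipK (iota Y) a| <= ((N a + d) * N w)%:C%C.
    rewrite Ya; apply: le_trans (cauchy_schwarz_norm hK _ _) _; rewrite lecR.
    rewrite ler_wpM2r // -/N hnorm_iota; apply: le_trans (hnorm_le_shift y i1' ic') _.
    rewrite -hnorm_iota -/Y.
    have -> : iota Y = a + - (a - iota Y) by rewrite opprB addrC subrK.
    by apply: le_trans (hnormD hK _ _) _; rewrite (hnormN hK) lerD2l ltW.
  have Yd : `|ipK (a - iota Y) a| <= (d * N a)%:C%C.
    apply: le_trans (cauchy_schwarz_norm hK _ _) _; rewrite lecR.
    by rewrite ler_wpM2r ?hnorm_ge0 // ltW.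
  have : N a ^+ 2 <= (N a + d) * N w + d * N a.
    rewrite -lecR -(hnormE hK) RcD.
    rewrite -[X in ipK X _](subrK (iota Y)) (herm_Dl hK).
    apply: le_trans (lerD Yw Yd); rewrite [leRHS]addrC.
    apply: le_trans (ler_normD _ _); rewrite -(herm_Dl hK) subrK.
    by rewrite (ger0_norm (herm_ge0 hK a)).
  have dE : d * (N a + N w) * 2 = N a * (N a - N w).
    by rewrite /d; field; rewrite gt_eqF // ltr_wpDr.
  by apply/negP; rewrite -ltNge; nra.
split; first by apply: le_lt_trans aw _; apply: le_lt_trans wle _; lra.
have -> : b = w + 'i *: a by rewrite subrK.
apply: le_lt_trans (hnormD hK _ _) _.
have -> : hnorm ipK ('i *: a) = N a.
  by apply: (@complexI R); rewrite (hnormZ hK) i1 mul1r.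
rewrite -/(N w); move: wle aw; lra.
Qed.

Lemma closure_graph_self_adjoint : self_adjoint ipK (closure G).
Proof.
have dK (k : K) : (forall x, ipK (iota x) k = 0) -> k = 0.
  move=> hk; have kk : ipK k k = 0.
    apply: (@normc_small_eq0 _ _ (N k)) => [|e /(iota_approx k) [x xk]].
      exact: hnorm_ge0.
    rewrite -[X in ipK X _](subrK (iota x)) (herm_Dl hK) hk addr0.
    apply: le_trans (cauchy_schwarz_norm hK _ _) _.
    by rewrite lecR ler_wpM2r ?hnorm_ge0 // ltW.
  by apply/eqP; rewrite -normr_eq0 -sqrf_eq0 normK kk.
split=> [x y y' xy xy'||].
- apply/eqP; rewrite -subr_eq0; apply/eqP/dK => z.
  have z1 : closure G (iota z, iota (T z)) by apply: subset_closure; exists z.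
  rewrite (herm_Br hK).
  have /= <- := closure_graph_symmetric xy z1.
  by have /= <- := closure_graph_symmetric xy' z1; rewrite subrr.
- move=> O [k Ok] oO; have [y [Oy [x _ xE]]] := iota_dense (ex_intro _ k Ok) oO.
  exists (iota x); split; first by rewrite xE.
  by exists (iota x, iota (T x)) => //; apply: subset_closure; exists x.
- apply/seteqP; split=> [[u v] /= huv|p cp q cq]; last exact: closure_graph_symmetric.
  apply: adjoint_in_closure => x.
  by apply: (huv (iota x, iota (T x))); apply: subset_closure; exists x.
Qed.
End InCompletion.

(** Nelson's analytic vector theorem, on a domain of analytic vectors. *)
Theorem nelson_analytic : essentially_self_adjoint ip T.
Proof.
move=> K ipK iota [hK nK iK dK]; exact: closure_graph_self_adjoint.
Qed.

End EssentialSelfAdjointness.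

(** * The Wick product on the tensor algebra *)

Section TensorModel.
Context (R : realType) (V : tvsType R[i]).
Local Notation C := R[i].

(** The tensor algebra by its universal property, its product and its
    symmetrisation. What follows is proved for any such model, so that the
    construction of [tensor V] as a quotient of a free module stays folded. *)
Record tensor_model := TensorModel {
  tm_sort :> lmodType C;
  tm_pure : seq V -> tm_sort;
  tm_ext : forall W : lmodType C, {rmorphism C -> C} -> (seq V -> W) -> tm_sort -> W;
  tm_mul : tm_sort -> tm_sort -> tm_sort;
  tm_sym : tm_sort -> tm_sort;
  tm_pureM : multilinear idfun tm_pure;
  tm_ext_semilinear : forall (W : lmodType C) (theta : {rmorphism C -> C}) (f : seq V -> W),
    multilinear theta f -> forall (a : C) X Y,
    tm_ext theta f (a *: X + Y) = theta a *: tm_ext theta f X + tm_ext theta f Y;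
  tm_ext_pure : forall (W : lmodType C) (theta : {rmorphism C -> C}) (f : seq V -> W) w,
    multilinear theta f -> tm_ext theta f (tm_pure w) = f w;
  tm_ind : forall P : tm_sort -> Prop, P 0 ->
    (forall a w X, P X -> P (a *: tm_pure w + X)) -> forall X, P X;
  tm_mul_linear_l : forall Y, linear (fun X => tm_mul X Y);
  tm_mul_linear_r : forall X, linear (tm_mul X);
  tm_mul_pure : forall u v, tm_mul (tm_pure u) (tm_pure v) = tm_pure (u ++ v);
  tm_sym_linear : linear tm_sym;
  tm_sym_pure : forall w, tm_sym (tm_pure w) =
    (size w)`!%:R^-1 *: \sum_(s : 'S_(size w)) tm_pure (word_perm w s)
}.

Definition tensor_algebra : tensor_model :=
  @TensorModel (tensor V) (@tpure R V) (@text R V) (@tmul R V) (@tsym R V)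
    (@tpureM R V) (@textP R V)
    (fun W theta f w => @text_tpure R V W theta f w)
    (@tensor_ind R V) (proj1 (@tmul_bilinear R V)) (proj2 (@tmul_bilinear R V))
    (@tmul_tpure R V) (@tsym_linear R V) (@tsym_tpure R V).
End TensorModel.

Section TensorCalculus.
Context (R : realType) (V : tvsType R[i]) (T : tensor_model V).
Local Notation C := R[i].
Local Notation pure := (@tm_pure R V T).
Local Notation mul := (@tm_mul R V T).
Local Notation pureM := (@tm_pureM R V T).
Local Notation ext := (@tm_ext R V T _).
Local Notation mull := (@tm_mul_linear_l R V T).
Local Notation mulr := (@tm_mul_linear_r R V T).
Implicit Types (w u v : seq V) (X Y Z : T) (l : {linear V -> C^o}).

Lemma tensor_ext (W : lmodType C) (theta : {rmorphism C -> C}) (f g : T -> W) :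
  (forall a X Y, f (a *: X + Y) = theta a *: f X + f Y) ->
  (forall a X Y, g (a *: X + Y) = theta a *: g X + g Y) ->
  (forall w, f (pure w) = g (pure w)) -> f =1 g.
Proof.
move=> fP gP fg; have z (k : T -> W) :
    (forall a X Y, k (a *: X + Y) = theta a *: k X + k Y) -> k 0 = 0.
  move=> kP; have := kP 1 0 0; rewrite scaler0 addr0 rmorph1 scale1r.
  by rewrite -[LHS]addr0 => /addrI.
by elim/tm_ind => [|a w X IH]; [rewrite !z|rewrite fP gP fg IH].
Qed.

Lemma linear_ext (W : lmodType C) (f g : T -> W) : linear f -> linear g ->
  (forall w, f (pure w) = g (pure w)) -> f =1 g.
Proof. by move=> fl gl; apply: (@tensor_ext W idfun). Qed.

Lemma linear_comp (W W' W'' : lmodType C) (f : W' -> W'') (g : W -> W') :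
  linear f -> linear g -> linear (fun x => f (g x)).
Proof. by move=> fl gl a x y; rewrite gl fl. Qed.

Lemma linear_add (W W' : lmodType C) (f g : W -> W') :
  linear f -> linear g -> linear (fun x => f x + g x).
Proof. by move=> fl gl a x y; rewrite fl gl scalerDr addrACA. Qed.

Lemma linear_scale (W W' : lmodType C) (b : C) (f : W -> W') :
  linear f -> linear (fun x => b *: f x).
Proof. by move=> fl a x y; rewrite fl scalerDr !scalerA [b * a]mulrC. Qed.

Lemma tmulA X Y Z : mul X (mul Y Z) = mul (mul X Y) Z.
Proof.
move: X; apply: linear_ext => [||u].
- exact: mull.
- exact: linear_comp (mull _) (mull _).
move: Y; apply: linear_ext => [||v].
- exact: linear_comp (mulr _) (mull _).
- exact: linear_comp (mull _) (mulr _).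
move: Z; apply: linear_ext => [||w].
- exact: linear_comp (mulr _) (mulr _).
- exact: mulr.
by rewrite !tm_mul_pure catA.
Qed.

Lemma tmul1l X : mul (pure [::]) X = X.
Proof.
by move: X; apply: linear_ext => [||w]; [exact: mulr|by []|rewrite tm_mul_pure].
Qed.

Lemma tmul1r X : mul X (pure [::]) = X.
Proof.
by move: X; apply: linear_ext => [||w]; [exact: mull|by []|rewrite tm_mul_pure cats0].
Qed.

(** The derivation of the tensor algebra that extends [l]. On symmetric tensors it
    is contraction of the first factor multiplied by the degree ([ann_head]). *)
Fixpoint ann_word l w : T :=
  if w is x :: u then l x *: pure u + mul (pure [:: x]) (ann_word l u) else 0.

Lemma ann_word_multilinear l : multilinear idfun (ann_word l).
Proof.
move=> u v a x y; elim: u => [|z u IH] /=.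
  rewrite linearP /= scalerDl -scalerA (pureM [::] [::] a x y).
  rewrite (mull _ a) !scalerDr /= addrACA; congr (_ + _).
rewrite IH (mulr _ a) (pureM u v a x y) !scalerDr !scalerA [a * _]mulrC.
by rewrite addrACA.
Qed.

Definition ann l : T -> T := ext idfun (ann_word l).

Lemma ann_linear l : linear (ann l).
Proof. exact: tm_ext_semilinear (@ann_word_multilinear l). Qed.

Lemma ann_tpure l w : ann l (pure w) = ann_word l w.
Proof. exact: tm_ext_pure _ (@ann_word_multilinear l). Qed.

Lemma ann_tmul l X Y : ann l (mul X Y) = mul (ann l X) Y + mul X (ann l Y).
Proof.
move: Y; apply: linear_ext => [||v].
- exact: linear_comp (ann_linear _) (mulr _).
- exact: linear_add (mulr _) (linear_comp (mulr _) (ann_linear _)).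
move: X; apply: linear_ext => [||u].
- exact: linear_comp (ann_linear _) (mull _).
- exact: linear_add (linear_comp (mull _) (ann_linear _)) (mull _).
rewrite tm_mul_pure !ann_tpure; elim: u => [|x u IH] /=.
  by rewrite (linpred0 (mull _)) add0r tmul1l.
rewrite IH (linpredD (mull _)) (linpredZ (mull _)) tm_mul_pure.
by rewrite (linpredD (mulr _)) -addrA !tmulA tm_mul_pure.
Qed.

Lemma pure_letter_linear : linear (fun x => pure [:: x]).
Proof. by move=> a x y; exact: (tm_pureM T [::] [::]). Qed.

Lemma ann_letter l x : ann l (pure [:: x]) = l x *: pure [::].
Proof. by rewrite ann_tpure /= (linpred0 (mulr _)) addr0. Qed.

Lemma ann_unit l : ann l (pure [::]) = 0.
Proof. by rewrite ann_tpure. Qed.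

Lemma tmul_scaled_unit a X : mul (a *: pure [::]) X = a *: X.
Proof. by rewrite (linpredZ (mull _)) tmul1l. Qed.

Lemma ann_lcons l x Y :
  ann l (mul (pure [:: x]) Y) = l x *: Y + mul (pure [:: x]) (ann l Y).
Proof. by rewrite ann_tmul ann_letter tmul_scaled_unit. Qed.

Lemma ann_rcons l x Y :
  ann l (mul Y (pure [:: x])) = mul (ann l Y) (pure [:: x]) + l x *: Y.
Proof.
by rewrite ann_tmul ann_letter (linpredZ (mulr _)) tmul1r.
Qed.

Lemma pure_cons x u : pure (x :: u) = mul (pure [:: x]) (pure u).
Proof. by rewrite tm_mul_pure. Qed.

Lemma annC l l' X : ann l (ann l' X) = ann l' (ann l X).
Proof.
move: X; apply: linear_ext => [||w]; try exact: linear_comp (ann_linear _) (ann_linear _).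
elim: w => [|x u IH]; first by rewrite !ann_unit !(linpred0 (ann_linear _)).
rewrite pure_cons !ann_lcons !(linpredD (ann_linear _)) !(linpredZ (ann_linear _)).
by rewrite !ann_lcons IH !addrA [_ *: _ + _ *: _]addrC.
Qed.

Section Wick.
Variables (Lam : V -> V -> C) (Lam_bilin : bilinear_form Lam).

Lemma lam_linear_r x : linear (Lam x : V -> C^o).
Proof. by case: Lam_bilin => _ H a y z; exact: H. Qed.
Lemma lam_linear_l y : linear (Lam ^~ y : V -> C^o).
Proof. by case: Lam_bilin => H _ a x z; exact: H. Qed.

Definition lamr x : {linear V -> C^o} :=
  HB.pack (Lam x : V -> C^o) (GRing.isLinear.Build C V C^o _ _ (lam_linear_r x)).
Definition laml y : {linear V -> C^o} :=
  HB.pack (Lam ^~ y : V -> C^o) (GRing.isLinear.Build C V C^o _ _ (lam_linear_l y)).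

(** A letter [x] on the left acts by multiplication and by the derivation
    [ann (lamr x)]; words act by composition. In contrast to [star] there is no
    symmetrisation and no sum over the number of contractions, so that the laws of
    this product are inductions on words. *)
Fixpoint wick_word w (Y : T) : T :=
  if w is x :: u then mul (pure [:: x]) (wick_word u Y) + wick_word u (ann (lamr x) Y)
  else Y.

Lemma wick_word_linear w : linear (wick_word w).
Proof.
elim: w => [|x u IH] //=; apply: linear_add.
  exact: linear_comp (mulr _) IH.
exact: linear_comp IH (ann_linear _).
Qed.

Lemma ann_lamP (a : C) x y Y :
  ann (lamr (a *: x + y)) Y = a *: ann (lamr x) Y + ann (lamr y) Y.
Proof.
move: Y; apply: linear_ext => [||w]; first exact: ann_linear.
  exact: linear_add (linear_scale _ (ann_linear _)) (ann_linear _).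
elim: w => [|z w IH]; first by rewrite !ann_unit scaler0 addr0.
rewrite pure_cons !ann_lcons IH (mulr _ a) /=.
case: Lam_bilin => H _; rewrite H scalerDl -scalerA scalerDr.
by rewrite addrACA.
Qed.

Lemma wick_word_multilinear Y : multilinear idfun (fun w => wick_word w Y).
Proof.
move=> u v a x y; elim: u Y => [|z u IH] Y /=.
  rewrite ann_lamP (wick_word_linear _ a) (pureM [::] [::] a x y) (mull _ a).
  by rewrite scalerDr addrACA.
by rewrite !IH (mulr _ a) scalerDr addrACA.
Qed.

Definition wick X Y : T := ext idfun (fun w => wick_word w Y) X.

Lemma wick_tpure w Y : wick (pure w) Y = wick_word w Y.
Proof. exact: tm_ext_pure _ (wick_word_multilinear Y). Qed.

Lemma wick_linear_l Y : linear (wick^~ Y).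
Proof. exact: tm_ext_semilinear (wick_word_multilinear Y). Qed.

Lemma wick_linear_r X : linear (wick X).
Proof.
move=> a Y Z; move: X; apply: linear_ext => [||w]; first exact: wick_linear_l.
  exact: linear_add (linear_scale _ (wick_linear_l _)) (wick_linear_l _).
by rewrite !wick_tpure (wick_word_linear _ a).
Qed.

Lemma wick_lcons x X Y : wick (mul (pure [:: x]) X) Y =
  mul (pure [:: x]) (wick X Y) + wick X (ann (lamr x) Y).
Proof.
move: X; apply: linear_ext => [||w].
- exact: linear_comp (wick_linear_l _) (mulr _).
- exact: linear_add (linear_comp (mulr _) (wick_linear_l _)) (wick_linear_l _).
by rewrite tm_mul_pure !wick_tpure.
Qed.

Lemma wick1l Y : wick (pure [::]) Y = Y.
Proof. by rewrite wick_tpure. Qed.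

Lemma wick1r X : wick X (pure [::]) = X.
Proof.
move: X; apply: linear_ext => [||w]; [exact: wick_linear_l|by []|].
elim: w => [|x u IH]; first by rewrite wick1l.
by rewrite pure_cons wick_lcons IH ann_unit (linpred0 (wick_linear_r _)) addr0.
Qed.

(** Since annihilators commute, they are derivations of the Wick product too; its
    associativity rests on this. *)
Lemma ann_wick l X Y : ann l (wick X Y) = wick (ann l X) Y + wick X (ann l Y).
Proof.
move: X Y; suff H w Y : ann l (wick (pure w) Y) = wick (ann l (pure w)) Y + wick (pure w) (ann l Y).
  move=> X Y; move: X; apply: linear_ext => [||w]; last exact: H.
    exact: linear_comp (ann_linear _) (wick_linear_l _).
  exact: linear_add (linear_comp (wick_linear_l _) (ann_linear _)) (wick_linear_l _).
elim: w Y => [|x u IH] Y.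
  by rewrite !wick1l ann_unit (linpred0 (wick_linear_l _)) add0r.
rewrite pure_cons !wick_lcons ann_lcons (linpredD (ann_linear _)) ann_lcons !IH.
rewrite (linpredD (wick_linear_l _)) (linpredZ (wick_linear_l _)) wick_lcons.
rewrite (linpredD (mulr _)) -!addrA; congr (_ + (_ + _)).
by rewrite addrCA; congr (_ + (_ + wick _ _)); exact: annC.
Qed.

Lemma wickA X Y Z : wick (wick X Y) Z = wick X (wick Y Z).
Proof.
move: X Y; suff H w Y : wick (wick (pure w) Y) Z = wick (pure w) (wick Y Z).
  move=> X Y; move: X; apply: linear_ext => [||w]; last exact: H.
    exact: linear_comp (wick_linear_l _) (wick_linear_l _).
  exact: wick_linear_l.
elim: w Y Z => [|x u IH] Y Z; first by rewrite !wick1l.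
rewrite pure_cons !wick_lcons (linpredD (wick_linear_l _)) wick_lcons !IH.
by rewrite ann_wick (linpredD (wick_linear_r _)) -addrA [_ + wick _ (wick (ann _ _) _)]addrC.
Qed.

(** The definition read from the other end: the last letter of the right factor
    acts on the left factor. This makes [wick] compatible with reversal
    ([conjt_wick]) and with symmetrisation of the left factor ([sym_wick_l]). *)
Lemma wick_rcons X Z z : wick X (mul Z (pure [:: z])) =
  mul (wick X Z) (pure [:: z]) + wick (ann (laml z) X) Z.
Proof.
move: X Z; suff H w Z : wick (pure w) (mul Z (pure [:: z])) =
    mul (wick (pure w) Z) (pure [:: z]) + wick (ann (laml z) (pure w)) Z.
  move=> X Z; move: X; apply: linear_ext => [||w]; last exact: H.
    exact: wick_linear_l.
  apply: linear_add; first exact: linear_comp (mull _) (wick_linear_l _).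
  exact: linear_comp (wick_linear_l _) (ann_linear _).
elim: w Z => [|x u IH] Z.
  by rewrite !wick1l ann_unit (linpred0 (wick_linear_l _)) addr0.
rewrite pure_cons !wick_lcons ann_rcons (linpredD (wick_linear_r _)) !IH.
rewrite (linpredZ (wick_linear_r _)) ann_lcons (linpredD (wick_linear_l _)).
rewrite (linpredZ (wick_linear_l _)) wick_lcons (linpredD (mulr _)).
rewrite (linpredD (mull _)) tmulA /= -!addrA; congr (_ + _).
rewrite addrCA; congr (_ + _); rewrite [RHS]addrCA; congr (_ + _).
by rewrite addrC.
Qed.

Section Involution.
Variables (c : V -> V) (c_inv : antilinear_involution c).
Hypothesis Lam_herm : forall v w : V, Lam v w = (Lam (c w) (c v))^*.

Lemma rev_map_multilinear : multilinear Num.conj (fun w => pure (rev (map c w))).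
Proof.
move=> u v a x y; rewrite !map_cat /= (proj1 c_inv) !rev_cat !rev_cons -!cats1 -!catA.
exact: pureM.
Qed.

Definition conjt : T -> T := ext Num.conj (fun w => pure (rev (map c w))).

Lemma conjtP a X Y : conjt (a *: X + Y) = a^* *: conjt X + conjt Y.
Proof. exact: tm_ext_semilinear rev_map_multilinear _ _ _. Qed.

Lemma conjt_pure w : conjt (pure w) = pure (rev (map c w)).
Proof. exact: tm_ext_pure rev_map_multilinear. Qed.

Lemma conjtD X Y : conjt (X + Y) = conjt X + conjt Y.
Proof. by rewrite -[X in LHS]scale1r conjtP conjC1 scale1r. Qed.

Lemma conjt0 : conjt 0 = 0.
Proof. by apply: (addrI (conjt 0)); rewrite -conjtD !addr0. Qed.

Lemma conjtZ a X : conjt (a *: X) = a^* *: conjt X.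
Proof. by rewrite -[_ *: X]addr0 conjtP conjt0 addr0. Qed.

Lemma conjt_mul X Y : conjt (mul X Y) = mul (conjt Y) (conjt X).
Proof.
move: X; apply: (tensor_ext (theta := Num.conj)) => [a X X'|a X X'|u].
- by rewrite (mull _ a) conjtP.
- by rewrite conjtP (linpredD (mulr _)) (linpredZ (mulr _)).
move: Y; apply: (tensor_ext (theta := Num.conj)) => [a X X'|a X X'|v].
- by rewrite (mulr _ a) conjtP.
- by rewrite conjtP (linpredD (mull _)) (linpredZ (mull _)).
by rewrite tm_mul_pure !conjt_pure tm_mul_pure map_cat rev_cat.
Qed.

Lemma conjt_letter x : conjt (pure [:: x]) = pure [:: c x].
Proof. by rewrite conjt_pure. Qed.

Lemma conjt_unit : conjt (pure [::]) = pure [::].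
Proof. by rewrite conjt_pure. Qed.

Lemma conjt_ann x Y : conjt (ann (lamr x) Y) = ann (laml (c x)) (conjt Y).
Proof.
move: Y; apply: (tensor_ext (theta := Num.conj)) => [a X X'|a X X'|w].
- by rewrite (ann_linear _ a) conjtP.
- by rewrite conjtP (linpredD (ann_linear _)) (linpredZ (ann_linear _)).
elim: w => [|y u IH]; first by rewrite conjt_unit !ann_unit conjt0.
rewrite pure_cons conjt_mul ann_lcons conjtD conjt_mul conjt_letter ann_rcons IH.
by rewrite conjtZ addrC; congr (_ + _ *: _); rewrite /= Lam_herm conjCK.
Qed.

Lemma conjt_wick X Y : conjt (wick X Y) = wick (conjt Y) (conjt X).
Proof.
move: X Y; suff H w Y : conjt (wick (pure w) Y) = wick (conjt Y) (conjt (pure w)).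
  move=> X Y; move: X; apply: (tensor_ext (theta := Num.conj)) => [a X X'|a X X'|w].
  - by rewrite (wick_linear_l _ a) conjtP.
  - by rewrite conjtP (linpredD (wick_linear_r _)) (linpredZ (wick_linear_r _)).
  exact: H.
elim: w Y => [|x u IH] Y; first by rewrite wick1l conjt_unit wick1r.
rewrite pure_cons wick_lcons conjtD !conjt_mul !IH conjt_letter wick_rcons.
by rewrite conjt_ann.
Qed.
End Involution.
End Wick.
End TensorCalculus.

(** * Symmetrisation and polarization *)

Section SymmetricTensors.
Context (R : realType) (V : tvsType R[i]) (T : tensor_model V).
Local Notation C := R[i].
Local Notation pure := (@tm_pure R V T).
Local Notation mul := (@tm_mul R V T).
Local Notation sym := (@tm_sym R V T).
Local Notation mull := (@tm_mul_linear_l R V T).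
Local Notation mulr := (@tm_mul_linear_r R V T).
Local Notation syml := (@tm_sym_linear R V T).
Implicit Types (w u v : seq V) (X Y Z : T) (l : {linear V -> C^o}).

Lemma sym_pureE k w : size w = k ->
  sym (pure w) = k`!%:R^-1 *: \sum_(s : 'S_k) pure (word_perm w s).
Proof. by move=> <-; exact: tm_sym_pure. Qed.

Lemma word_permM w k (p s : 'S_k) :
  word_perm (word_perm w p) s = word_perm w (s * p)%g.
Proof.
apply: (@eq_from_nth _ 0); rewrite !size_word_perm // => m mk.
by rewrite -[m]/(val (Ordinal mk)) !word_perm_nth permM.
Qed.

Lemma perm_eq_word_perm w w' : perm_eq w w' ->
  exists s : 'S_(size w'), w = word_perm w' s.
Proof.
move=> p; have /tuple_permP [s ws] : perm_eq w (in_tuple w') by [].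
exists s; rewrite ws; apply: (@eq_from_nth _ 0); rewrite size_tuple ?size_word_perm // => m mk.
rewrite -[m]/(val (Ordinal mk)) word_perm_nth -tnth_nth tnth_mktuple.
by rewrite (tnth_nth 0).
Qed.

Lemma sym_perm w w' : perm_eq w w' -> sym (pure w) = sym (pure w').
Proof.
move=> /perm_eq_word_perm [p ->]; rewrite (sym_pureE (size_word_perm _ _)).
rewrite (sym_pureE (erefl (size w'))); congr (_ *: _).
rewrite [RHS](reindex_inj (mulIg p)) /=.
by apply: eq_bigr => s _; rewrite word_permM.
Qed.

Lemma perm_word_perm w (s : 'S_(size w)) : perm_eq (word_perm w s) w.
Proof.
have -> : word_perm w s = [seq nth 0 w i | i <- [seq val (s i) | i : 'I_(size w)]].
  by rewrite -map_comp.
rewrite -[X in perm_eq _ X](mkseq_nth 0) /mkseq perm_map //.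
rewrite -val_enum_ord.
have -> : [seq val (s i) | i : 'I_(size w)] = map val (map s (enum 'I_(size w))).
  by rewrite -map_comp.
apply: perm_map.
apply: uniq_perm; rewrite ?enum_uniq ?(map_inj_uniq perm_inj) ?enum_uniq //.
move=> i; rewrite mem_enum; apply/mapP; exists (s^-1 i)%g; rewrite ?mem_enum //.
by rewrite permKV.
Qed.

Lemma linear_sym_pure (W : lmodType C) (f : T -> W) w : linear f ->
  (forall w', perm_eq w' w -> f (pure w') = f (pure w)) ->
  f (sym (pure w)) = f (pure w).
Proof.
move=> fl fp; rewrite (sym_pureE (erefl (size w))) (linpredZ fl) (linpred_sum fl).
rewrite (eq_bigr (fun=> f (pure w))) => [|s _]; last exact/fp/perm_word_perm.
rewrite sumr_const card_Sn -(scaler_nat _ (f _)) scalerA mulVf ?scale1r //.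
Qed.

Lemma linear_sym (W : lmodType C) (f : T -> W) : linear f ->
  (forall w w', perm_eq w' w -> f (pure w') = f (pure w)) ->
  forall X, f (sym X) = f X.
Proof.
move=> fl fp; apply: linear_ext => [||w]; last first.
  by apply: linear_sym_pure => // w'; apply: fp.
  exact: fl.
exact: linear_comp fl syml.
Qed.

Lemma sym_id X : sym (sym X) = sym X.
Proof. by apply: linear_sym => [|w w']; [exact: syml|exact: sym_perm]. Qed.

Lemma sym_mulC X Y : sym (mul X Y) = sym (mul Y X).
Proof.
move: X; apply: linear_ext => [||u].
- exact: linear_comp syml (mull _).
- exact: linear_comp syml (mulr _).
move: Y; apply: linear_ext => [||v].
- exact: linear_comp syml (mulr _).
- exact: linear_comp syml (mull _).
by rewrite !tm_mul_pure; apply: sym_perm; rewrite perm_catC.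
Qed.

Lemma sym_mul_r X Y : sym (mul X (sym Y)) = sym (mul X Y).
Proof.
apply: (linear_sym (f := fun Y => sym (mul X Y))) => [|w w' ww'].
  exact: linear_comp syml (mulr _).
move: X; apply: linear_ext => [||u].
- exact: linear_comp syml (mull _).
- exact: linear_comp syml (mull _).
by rewrite !tm_mul_pure; apply: sym_perm; rewrite perm_cat2l.
Qed.

Lemma sym_mul_l X Y : sym (mul (sym X) Y) = sym (mul X Y).
Proof. by rewrite sym_mulC sym_mul_r sym_mulC. Qed.

Lemma sym_mulCA X Y Z : sym (mul X (mul Y Z)) = sym (mul Y (mul X Z)).
Proof. by rewrite !tmulA -sym_mul_l (sym_mulC X Y) sym_mul_l. Qed.

(** Permutations of a word are generated by exchanges of adjacent blocks, for which
    the Leibniz rule and [sym_mulCA] apply. *)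
Lemma sym_ann l X : sym (ann l (sym X)) = sym (ann l X).
Proof.
apply: (linear_sym (f := fun X => sym (ann l X))) => [|w w'].
  exact: linear_comp syml (ann_linear _).
move: w' w; apply: catCA_perm_subst => a b d.
rewrite -!tm_mul_pure !ann_tmul.
rewrite !(linpredD syml) !(linpredD (mulr _)) !(linpredD syml).
rewrite [X in X + _]sym_mulCA [X in _ + (X + _)]sym_mulCA [X in _ + (_ + X)]sym_mulCA.
exact: addrCA.
Qed.

Section WickSymmetric.
Variables (Lam : V -> V -> C) (Lam_bilin : bilinear_form Lam).
Local Notation wick := (wick Lam_bilin).

Lemma sym_wick_r X Y : sym (wick X (sym Y)) = sym (wick X Y).
Proof.
move: X; apply: linear_ext => [||u]; try exact: linear_comp syml (wick_linear_l _ _).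
elim: u Y => [|x u IH] Y; first by rewrite !wick1l sym_id.
rewrite pure_cons !wick_lcons !(linpredD syml); congr (_ + _).
  by rewrite -sym_mul_r IH sym_mul_r.
by rewrite -IH sym_ann IH.
Qed.

Lemma sym_wick_l X Y : sym (wick (sym X) Y) = sym (wick X Y).
Proof.
move: Y; apply: linear_ext => [||v]; try exact: linear_comp syml (wick_linear_r _ _).
elim/last_ind: v X => [|v z IH] X; first by rewrite !wick1r sym_id.
rewrite -cats1 -tm_mul_pure !wick_rcons !(linpredD syml); congr (_ + _).
  by rewrite -sym_mul_l IH sym_mul_l.
by rewrite -IH sym_ann IH.
Qed.
End WickSymmetric.

Definition tpow x k : T := pure (nseq k x).

Lemma tpowS x k : tpow x k.+1 = mul (pure [:: x]) (tpow x k).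
Proof. by rewrite tm_mul_pure. Qed.

Lemma sym_tpow x k : sym (tpow x k) = tpow x k.
Proof.
apply: (@linear_sym_pure T id) => // w' p; congr pure.
have : all (pred1 x) w' by rewrite (perm_all _ p) all_pred1_nseq.
by move=> /all_pred1P ->; rewrite (perm_size p) size_nseq.
Qed.

Section LinearClosed.
Variable (P : T -> Prop) (P0 : P 0) (PD : forall a X Y, P X -> P Y -> P (a *: X + Y)).

Lemma closed_scale a X : P X -> P (a *: X).
Proof. by move=> PX; rewrite -[_ *: _]addr0; apply: PD. Qed.

Lemma closed_sum n (Z : nat -> T) : (forall i, (i < n)%N -> P (Z i)) -> P (\sum_(i < n) Z i).
Proof.
elim: n => [|n IH] PZ; first by rewrite big_ord0.
rewrite big_ord_recr /= addrC -[Z n]scale1r; apply: PD; first exact: PZ.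
by apply: IH => i lt; apply: PZ; rewrite ltnS ltnW.
Qed.

(** Induction on the degree of the polynomial [p]: the combination
    [p(2 s) - 2^n p(s)] has no term of degree [n]. *)
Lemma closed_coefficient n (Z : nat -> T) :
  (forall s : C, P (\sum_(i < n) s ^+ i *: Z i)) -> forall i, (i < n)%N -> P (Z i).
Proof.
elim: n Z => // n IH Z PZ.
have lower i : (i < n)%N -> P (Z i).
  move=> lt; have ne : (2 ^+ i - 2 ^+ n : C) != 0.
    by rewrite subr_eq0 -!natrX eqr_nat eqn_exp2l // ltn_eqF.
  rewrite -[Z i]scale1r -(mulVf ne) -scalerA; apply: closed_scale.
  apply: (IH (fun i => (2 ^+ i - 2 ^+ n) *: Z i)) => // s.
  have := PD (- 2 ^+ n) (PZ s) (PZ (2 * s)).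
  rewrite !big_ord_recr /= scalerDr addrACA scalerA exprMn mulNr.
  rewrite -[X in _ + X]scalerDl addNr scale0r addr0 scaler_sumr -big_split /=.
  congr P; apply: eq_bigr => j _.
  by rewrite !scalerA -scalerDl exprMn; congr (_ *: _); ring.
move=> i; rewrite ltnS leq_eqVlt => /orP[/eqP ->|]; last exact: lower.
have := PD (-1) (closed_sum lower) (PZ 1).
rewrite big_ord_recr /= expr1n scale1r scaleN1r.
rewrite [X in _ + (X + _)](eq_bigr (fun i : 'I_n => Z i)); last first.
  by move=> j _; rewrite expr1n scale1r.
by rewrite addrA addNr add0r.
Qed.
End LinearClosed.

(** The coefficients of the polynomial [(s x + y)^k] in [s]: the linear one
    symmetrises to [k x y^(k - 1)], which turns powers into products. *)
Lemma tpow_expand x y k : exists E : nat -> T,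
  [/\ forall s : C, tpow (s *: x + y) k = \sum_(i < k.+1) s ^+ i *: E i,
      E 0%N = tpow y k & sym (E 1%N) = k%:R *: sym (mul (pure [:: x]) (tpow y k.-1))].
Proof.
elim: k => [|k [E [Es E0 E1]]].
  exists (fun i => if i == 0%N then tpow y 0 else 0); split=> //.
    by move=> s; rewrite big_ord1 /= expr0 scale1r.
  by rewrite (linpred0 syml) scale0r.
pose E' i := (if (i <= k)%N then mul (pure [:: y]) (E i) else 0) +
             (if i is i'.+1 then mul (pure [:: x]) (E i') else 0).
exists E'; split.
- move=> s; rewrite tpowS (tm_pureM T [::] [::] s x y) (mull _ s) Es.
  rewrite /E' (eq_bigr _ (fun i _ => scalerDr _ _ _)) big_split /= addrC; congr (_ + _).
    rewrite [RHS]big_ord_recr /= ltnn scaler0 addr0 (linpred_sum (mulr _)).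
    apply: eq_bigr => i _; rewrite (linpredZ (mulr _)).
    by rewrite -ltnS ltn_ord.
  rewrite [RHS]big_ord_recl /= scaler0 add0r (linpred_sum (mulr _)) scaler_sumr.
  by apply: eq_bigr => i _; rewrite (linpredZ (mulr _)) scalerA exprS.
- by rewrite /E' /= addr0 E0 tpowS.
- rewrite /E' /= (linpredD syml) E0 -natr1 scalerDl scale1r; congr (_ + _).
  case: k {E0 E'} E1 {Es} => [|k] E1 /=; first by rewrite scale0r (linpred0 syml).
  rewrite -sym_mul_r E1 (linpredZ (mulr _)) (linpredZ syml) sym_mul_r; congr (_ *: _).
  by rewrite tpowS sym_mulCA.
Qed.

(** Polarization, as an induction principle. A letter [x] is multiplied into a
    power [y^k] by extracting the linear coefficient of [(s x + y)^(k + 1)]. *)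
Lemma sym_tpow_ind (P : T -> Prop) : P 0 ->
  (forall a X Y, P X -> P Y -> P (a *: X + Y)) ->
  (forall x k, P (tpow x k)) -> forall X, P (sym X).
Proof.
move=> P0 PD Ppow.
suff Pw w : P (sym (pure w)).
  elim/tm_ind => [|a w X PX]; first by rewrite (linpred0 syml).
  by rewrite syml; apply: PD.
elim: w P P0 PD Ppow => [|x u IH] P P0 PD Ppow.
  by rewrite -/(tpow 0 0) sym_tpow; apply: Ppow.
rewrite pure_cons -sym_mul_r.
apply: (IH (fun Z => P (sym (mul (pure [:: x]) Z)))) => [|a X Y PX PY|y k].
- by rewrite (linpred0 (mulr _)) (linpred0 syml).
- by rewrite (mulr _ a) syml; apply: PD.
have [E [Es _ E1]] := tpow_expand x y k.+1.
have : P (sym (E 1%N)).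
  apply: (@closed_coefficient (fun Z => P (sym Z)) _ _ k.+2) => //.
  - by rewrite (linpred0 syml).
  - by move=> a X Y PX PY; rewrite syml; apply: PD.
  - by move=> s; rewrite -Es sym_tpow.
rewrite E1 => /(closed_scale P0 PD (k.+1%:R)^-1).
by rewrite scalerA mulVf ?scale1r // pnatr_eq0.
Qed.

Lemma ann_tpow l x k : ann l (tpow x k) = (k%:R * l x) *: tpow x k.-1.
Proof.
elim: k => [|k IH]; first by rewrite ann_unit mul0r scale0r.
rewrite tpowS ann_lcons IH (linpredZ (mulr _)) -natr1 mulrDl mul1r scalerDl addrC.
by congr (_ + _); case: k {IH} => [|k]; rewrite ?mul0r ?scale0r // tpowS.
Qed.

(** These are also the coefficients of [star] on powers, where contracting [t]
    pairs one after the other gives [k ^_ t * m ^_ t / t!]. *)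
Lemma wick_tpow (Lam : V -> V -> C) (Lam_bilin : bilinear_form Lam) x y k m :
  wick Lam_bilin (tpow x k) (tpow y m) = \sum_(t < k.+1)
    (('C(k, t) * m ^_ t)%:R * Lam x y ^+ t) *: mul (tpow x (k - t)) (tpow y (m - t)).
Proof.
elim: k m => [|k IH] m.
  by rewrite big_ord1 /= bin0 ffactn0 expr0 mulr1 scale1r !subn0 wick1l tmul1l.
rewrite tpowS wick_lcons ann_tpow (linpredZ (wick_linear_r _ _)) !IH.
rewrite (linpred_sum (mulr _)) scaler_sumr.
have -> : \sum_(t < k.+2) (('C(k.+1, t) * m ^_ t)%:R * Lam x y ^+ t) *:
     mul (tpow x (k.+1 - t)) (tpow y (m - t)) =
   \sum_(t < k.+2) (('C(k, t) * m ^_ t)%:R * Lam x y ^+ t) *: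
     mul (tpow x (k.+1 - t)) (tpow y (m - t)) +
   \sum_(t < k.+2) ((if val t is t'.+1 then 'C(k, t') * m ^_ t else 0)%:R * Lam x y ^+ t) *:
     mul (tpow x (k.+1 - t)) (tpow y (m - t)).
  rewrite -big_split; apply: eq_bigr => -[[|t] /= tk] _.
    by rewrite !bin0 mul0r scale0r addr0.
  by rewrite binS mulnDl natrD mulrDl scalerDl.
congr (_ + _).
  rewrite [RHS]big_ord_recr /= bin_small // mul0n mul0r scale0r addr0.
  apply: eq_bigr => -[t tk] _ /=; rewrite (linpredZ (mulr _)); congr (_ *: _).
  by rewrite tmulA -tpowS subSn.
rewrite [RHS]big_ord_recl /= mul0r scale0r add0r; apply: eq_bigr => -[t tk] _ /=.
rewrite /bump /= add1n scalerA subSS; case: m => [|m].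
  by rewrite mul0r mul0r scale0r ffact0n muln0 mul0r scale0r.
by rewrite ffactSS !natrM exprS subSS; congr (_ *: _); ring.
Qed.
End SymmetricTensors.

(** * The star product as a symmetrised Wick product *)

Lemma fsum_trunc (W : nmodType) (F : nat -> W) (N : nat) :
  (forall t, (N <= t)%N -> F t = 0) -> \sum_(t \in [set: nat]) F t = \sum_(t < N) F t.
Proof.
move=> F0; rewrite fsbig_ord; apply/esym/fsbig_widen => // t [_ /= /negP].
by rewrite -leqNgt => /F0.
Qed.

Section StarProduct.
Context (R : realType) (V : tvsType R[i]).
Local Notation C := R[i].
Local Notation TA := (tensor_algebra V).
Variables (Lam : V -> V -> C) (Lam_bilin : bilinear_form Lam).
Implicit Types (X Y Z : symt V).
Local Notation wickT := (@wick R V TA Lam Lam_bilin).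
Local Notation contract := (@Defs.contract R V).

Lemma to_symt_linear : linear (@to_symt R V).
Proof. by move=> a X Y; apply: val_inj; rewrite linearP /= tsym_linear. Qed.

Lemma symt_val_linear : linear (@symt_val R V).
Proof. by move=> a X Y; exact: (linearP val). Qed.

Lemma to_symt_val X : to_symt X = X.
Proof.
apply: val_inj => /=; case: X => X /= /symmetric_tensorP [Y _ <-].
exact: (@sym_id R V TA).
Qed.

Lemma to_symt_sym (X : tensor V) : to_symt (tsym X) = to_symt X.
Proof. by apply: val_inj; exact: (@sym_id R V TA). Qed.

Lemma contract_linear : linear (contract Lam).
Proof. exact: text2P (text_bilinear (contract_wordM Lam_bilin)). Qed.

Lemma iter_contract_linear t : linear (iter t (contract Lam)).
Proof. by elim: t => //= t IH; exact: linear_comp contract_linear IH. Qed.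

Lemma mu_bilinear : bilinear_map (fun X Y : tensor V => to_symt (tmul X Y)).
Proof.
split=> [Y|X]; first exact: linear_comp to_symt_linear (tm_mul_linear_l (t := TA) Y).
exact: linear_comp to_symt_linear (tm_mul_linear_r (t := TA) X).
Qed.

Lemma mu_vee_linear : linear (@mu_vee R V).
Proof. exact: text2P mu_bilinear. Qed.

Lemma mu_vee_touter (X Y : tensor V) : mu_vee (touter X Y) = to_symt (tmul X Y).
Proof. exact: text2_touter mu_bilinear. Qed.

Lemma touter_linear_l (Y : tensor V) : linear (fun X : tensor V => touter X Y).
Proof. exact (proj1 (@touter_bilinear R V) Y). Qed.

Lemma touter_linear_r (X : tensor V) : linear (touter X).
Proof. exact (proj2 (@touter_bilinear R V) X). Qed.

Lemma contract_nilpotent_word t (u v : seq V) : (size u < t)%N ->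
  iter t (contract Lam) (touter (tpure u) (tpure v)) = 0.
Proof.
elim: t u v => // t IH u v; rewrite ltnS iterSr contract_tpure // /contract_word.
case E: (rev u) => [|x u'] ut; first by rewrite (linpred0 (iter_contract_linear t)).
case: v => [|y v]; first by rewrite (linpred0 (iter_contract_linear t)).
rewrite (linpredZ (iter_contract_linear t)) IH ?scaler0 //.
by rewrite size_rev; apply: leq_trans ut; rewrite -(size_rev u) E.
Qed.

Lemma contract_nilpotent (X : tensor V) : exists N, forall t (Y : tensor V), (N <= t)%N ->
  iter t (contract Lam) (touter X Y) = 0.
Proof.
elim/tensor_ind: X => [|a w X [N hN]].
  by exists 0%N => t Y _; rewrite (linpred0 (touter_linear_l Y)) (linpred0 (iter_contract_linear t)).
exists (maxn N (size w).+1) => t Y; rewrite geq_max => /andP[Nt weighted].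
rewrite (touter_linear_l Y) (iter_contract_linear t a) hN // addr0.
have -> : iter t (contract Lam) (touter (tpure w) Y) = 0; last exact: scaler0.
elim/tensor_ind: Y => [|b v Y IH].
  by rewrite (linpred0 (touter_linear_r _)) (linpred0 (iter_contract_linear t)).
rewrite (touter_linear_r _ b) (iter_contract_linear t b) IH contract_nilpotent_word //.
by rewrite scaler0 addr0.
Qed.

Definition star_term t X Y : symt V :=
  t`!%:R^-1 *: mu_vee (iter t (contract Lam) (touter X Y)).

Lemma star_trunc X : exists N, forall M Y, (N <= M)%N ->
  star Lam X Y = \sum_(t < M) star_term t X Y.
Proof.
have [N hN] := contract_nilpotent X; exists N => M Y NM.
apply: fsum_trunc => t Mt; rewrite /star_term hN ?(leq_trans NM) //.
by rewrite (linpred0 mu_vee_linear) scaler0.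
Qed.

Lemma star_linear_r X : linear (star Lam X).
Proof.
move=> a Y Z; have [N hN] := star_trunc X; rewrite !(hN N) //.
rewrite scaler_sumr -big_split; apply: eq_bigr => t _ /=.
rewrite /star_term symt_val_linear (touter_linear_r _ a) (iter_contract_linear _ a).
by rewrite (mu_vee_linear a) scalerDr !scalerA [_ * a]mulrC.
Qed.

Lemma star_linear_l Y : linear (fun X => star Lam X Y).
Proof.
move=> a X X'; have [N1 h1] := star_trunc X; have [N2 h2] := star_trunc X'.
have [N3 h3] := star_trunc (a *: X + X').
pose N := maxn N1 (maxn N2 N3).
rewrite (h1 N) ?(h2 N) ?(h3 N) ?leq_max ?leqnn ?orbT //.
rewrite scaler_sumr -big_split; apply: eq_bigr => t _ /=.
rewrite /star_term symt_val_linear (touter_linear_l _ a) (iter_contract_linear _ a).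
by rewrite (mu_vee_linear a) scalerDr !scalerA [_ * a]mulrC.
Qed.

Lemma rev_nseqE (x : V) k : rev (nseq k x) = nseq k x.
Proof.
have : all (pred1 x) (rev (nseq k x)) by rewrite all_rev all_pred1_nseq.
by move/all_pred1P; rewrite size_rev size_nseq.
Qed.

Local Notation pow := (@tpow R V TA).

Lemma tsym_tpow x k : tsym (pow x k) = pow x k.
Proof. exact: (@sym_tpow R V TA). Qed.

Lemma tsym_wick (X Y : tensor V) : tsym (wickT (tsym X) (tsym Y)) = tsym (wickT X Y).
Proof.
by etransitivity; [exact: (@sym_wick_l R V TA)|exact: (@sym_wick_r R V TA)].
Qed.

Lemma contract_tpow x y k m : contract Lam (touter (pow x k) (pow y m)) =
  ((k * m)%:R * Lam x y) *: touter (pow x k.-1) (pow y m.-1).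
Proof.
rewrite (contract_tpure _ _ Lam_bilin) /contract_word rev_nseqE !size_nseq.
case: k => [|k]; first by rewrite mul0n mul0r scale0r.
case: m => [|m]; first by rewrite muln0 mul0r scale0r.
by rewrite /= rev_nseqE.
Qed.

Lemma iter_contract_tpow x y k m t :
  iter t (contract Lam) (touter (pow x k) (pow y m)) =
  ((k ^_ t * m ^_ t)%:R * Lam x y ^+ t) *: touter (pow x (k - t)) (pow y (m - t)).
Proof.
elim: t => [|t IH]; first by rewrite !ffactn0 !subn0 expr0 mulr1 scale1r.
rewrite iterS IH (linpredZ contract_linear) contract_tpow scalerA !ffactnSr exprS.
by rewrite -!subnS !natrM; congr (_ *: _); ring.
Qed.

Lemma star_tpow x y k m :
  star Lam (to_symt (pow x k)) (to_symt (pow y m)) = to_symt (wickT (pow x k) (pow y m)).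
Proof.
have [N hN] := star_trunc (to_symt (pow x k)).
rewrite (hN (maxn N k.+1)) ?leq_maxl // wick_tpow (linpred_sum to_symt_linear).
have term t : star_term t (to_symt (pow x k)) (to_symt (pow y m)) =
    (('C(k, t) * m ^_ t)%:R * Lam x y ^+ t) *:
       to_symt (tmul (pow x (k - t)) (pow y (m - t))).
  rewrite /star_term /= !tsym_tpow iter_contract_tpow (linpredZ mu_vee_linear).
  rewrite mu_vee_touter scalerA -bin_ffact; congr (_ *: _).
  by rewrite !natrM; field; rewrite pnatr_eq0 -lt0n fact_gt0.
rewrite (eq_bigr _ (fun t _ => term (val t))) /=.
rewrite -(subnKC (leq_maxr N k.+1)) big_split_ord /= [X in _ + X]big1 ?addr0.
  by apply: eq_bigr => t _; rewrite (linpredZ to_symt_linear).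
by move=> t _; rewrite bin_small ?mul0n ?mul0r ?scale0r //= addSn ltnS leq_addr.
Qed.

Lemma star_sym (X Y : tensor V) :
  star Lam (to_symt (tsym X)) (to_symt (tsym Y)) = to_symt (wickT (tsym X) (tsym Y)).
Proof.
have star0l Z : star Lam (to_symt 0) Z = 0.
  by rewrite (linpred0 to_symt_linear) (linpred0 (star_linear_l Z)).
have star0r Z : star Lam Z (to_symt 0) = 0.
  by rewrite (linpred0 to_symt_linear) (linpred0 (star_linear_r Z)).
have powl x k (Y' : tensor V) : star Lam (to_symt (pow x k)) (to_symt (tsym Y')) =
    to_symt (wickT (pow x k) (tsym Y')).
  pose P (Z : tensor V) := star Lam (to_symt (pow x k)) (to_symt Z) = to_symt (wickT (pow x k) Z).
  refine (@sym_tpow_ind R V TA P _ _ _ Y') => [|a Z Z' IZ IZ'|y m]; rewrite /P.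
  - by rewrite star0r (linpred0 (wick_linear_r _ _)) (linpred0 to_symt_linear).
  - rewrite (to_symt_linear a Z Z') (star_linear_r _ a) IZ IZ'.
    by rewrite (wick_linear_r _ _ a) (to_symt_linear a).
  exact: star_tpow.
pose P (Z : tensor V) := star Lam (to_symt Z) (to_symt (tsym Y)) = to_symt (wickT Z (tsym Y)).
refine (@sym_tpow_ind R V TA P _ _ _ X) => [|a Z Z' IZ IZ'|x k]; rewrite /P.
- by rewrite star0l (linpred0 (wick_linear_l _ _)) (linpred0 to_symt_linear).
- rewrite (to_symt_linear a Z Z') (star_linear_l _ a) IZ IZ'.
  by rewrite (wick_linear_l _ _ a) (to_symt_linear a).
exact: powl.
Qed.

(** Both sides are bilinear and depend on the symmetrised arguments only, so that
    by polarization it suffices to compare them on powers. *)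
Theorem star_to_symt (X Y : tensor V) :
  star Lam (to_symt X) (to_symt Y) = to_symt (wickT X Y).
Proof.
have e1 := f_equal2 (star Lam) (to_symt_sym X) (to_symt_sym Y).
have e2 : to_symt (wickT (tsym X) (tsym Y)) = to_symt (wickT X Y).
  by apply: val_inj; exact: tsym_wick.
exact (etrans (esym e1) (etrans (star_sym X Y) e2)).
Qed.

Definition sunit : symt V := to_symt (tpure [::]).

Lemma star_val X Y :
  symt_val (star Lam X Y) = tsym (wickT (symt_val X) (symt_val Y)).
Proof.
have e := f_equal2 (star Lam) (to_symt_val X) (to_symt_val Y).
exact (congr1 (@symt_val R V) (etrans (esym e) (star_to_symt (symt_val X) (symt_val Y)))).
Qed.

Lemma starA X Y Z : star Lam (star Lam X Y) Z = star Lam X (star Lam Y Z).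
Proof.
rewrite -(to_symt_val X) -(to_symt_val Y) -(to_symt_val Z).
rewrite !star_to_symt.
exact (congr1 (@to_symt R V) (@wickA R V TA Lam Lam_bilin (symt_val X) (symt_val Y) (symt_val Z))).
Qed.

Lemma star1l Y : star Lam sunit Y = Y.
Proof.
rewrite -[in LHS](to_symt_val Y) star_to_symt -[RHS]to_symt_val.
exact (congr1 (@to_symt R V) (@wick1l R V TA Lam Lam_bilin (symt_val Y))).
Qed.

Section Involution.
Variables (c : V -> V) (c_inv : antilinear_involution c).
Hypothesis Lam_herm : forall v w : V, Lam v w = (Lam (c w) (c v))^*.

Lemma sinvP a X Y : sinv c (a *: X + Y) = a^* *: sinv c X + sinv c Y.
Proof.
apply: val_inj.
have e1 : symt_val (sinv c (a *: X + Y)) =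
    a^* *: tinv c (symt_val X) + tinv c (symt_val Y).
  exact: etrans (sinvE c_inv _) (etrans (congr1 (tinv c) (symt_val_linear a X Y)) (tinvP c_inv _ _ _)).
have e2 : symt_val (a^* *: sinv c X + sinv c Y) = a^* *: tinv c (symt_val X) + tinv c (symt_val Y).
  apply: etrans (symt_val_linear a^* (sinv c X) (sinv c Y)) _.
  exact: (f_equal2 (fun u v : tensor V => a^* *: u + v) (sinvE c_inv X) (sinvE c_inv Y)).
exact: etrans e1 (esym e2).
Qed.

Lemma sinv_to_symt (X : tensor V) : sinv c (to_symt X) = to_symt (tinv c X).
Proof. by apply: val_inj => /=; rewrite (sinvE c_inv) /= tinv_tsym. Qed.

Lemma sinv_star X Y : sinv c (star Lam X Y) = star Lam (sinv c Y) (sinv c X).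
Proof.
rewrite -(to_symt_val X) -(to_symt_val Y) star_to_symt !sinv_to_symt star_to_symt.
exact (congr1 (@to_symt R V) (@conjt_wick R V TA Lam Lam_bilin c c_inv Lam_herm (symt_val X) (symt_val Y))).
Qed.
End Involution.
End StarProduct.

(** * Hermitian forms on the tensor algebra *)

Lemma sum_cauchy_schwarz (R : realType) n (a b : nat -> R) :
  (\sum_(i < n) a i * b i) ^+ 2 <= (\sum_(i < n) a i ^+ 2) * (\sum_(i < n) b i ^+ 2).
Proof.
elim: n => [|n IH]; first by rewrite !big_ord0 mul0r expr0n.
rewrite !big_ord_recr /=; move: IH.
set S := \sum_(i < n) _ * _; set A := \sum_(i < n) _ ^+ 2; set B := \sum_(i < n) _ ^+ 2.
have A0 : 0 <= A by apply: sumr_ge0 => i _; exact: sqr_ge0.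
have B0 : 0 <= B by apply: sumr_ge0 => i _; exact: sqr_ge0.
move: (a n) (b n) => x y SAB.
have x2 := sqr_ge0 x; have y2 := sqr_ge0 y.
have key : 2 * S * (x * y) <= A * y ^+ 2 + x ^+ 2 * B.
  apply: le_trans (ler_norm _) _.
  have Ay : 0 <= A * y ^+ 2 by exact: mulr_ge0.
  have xB : 0 <= x ^+ 2 * B by exact: mulr_ge0.
  rewrite -(@ler_pXn2r _ 2) ?nnegrE ?normr_ge0 ?addr_ge0 //.
  rewrite -normrX ger0_norm ?sqr_ge0 //.
  have : 0 <= (A * y ^+ 2 - x ^+ 2 * B) ^+ 2 by exact: sqr_ge0.
  have : S ^+ 2 * (x ^+ 2 * y ^+ 2) <= A * B * (x ^+ 2 * y ^+ 2).
    by apply: ler_wpM2r SAB; apply: mulr_ge0.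
  nra.
by rewrite sqrrD mulrDl !mulrDr; lra.
Qed.

Section WordForms.
Context (R : realType) (V : tvsType R[i]) (T : tensor_model V).
Local Notation C := R[i].
Local Notation pure := (@tm_pure R V T).
Local Notation mul := (@tm_mul R V T).
Local Notation ext := (@tm_ext R V T _).
Local Notation mull := (@tm_mul_linear_l R V T).
Local Notation mulr := (@tm_mul_linear_r R V T).
Local Notation sym := (@tm_sym R V T).
Local Notation syml := (@tm_sym_linear R V T).
Implicit Types (w u v : seq V) (X Y Z : T) (l : {linear V -> C^o}).

(** The span of the words satisfying [Q], encoded by its induction principle. *)
Definition spanned (Q : seq V -> Prop) (X : T) := forall P : T -> Prop, P 0 ->
  (forall a w Y, Q w -> P Y -> P (a *: pure w + Y)) -> P X.

Lemma spanned0 Q : spanned Q 0.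
Proof. by move=> P P0. Qed.

Lemma spanned_word Q w : Q w -> spanned Q (pure w).
Proof. by move=> Qw P P0 PD; rewrite -[pure w]scale1r -[X in P X]addr0; exact: PD. Qed.

Lemma spannedD Q X Y : spanned Q X -> spanned Q Y -> spanned Q (X + Y).
Proof.
move=> sX sY; apply: (sX (fun X => spanned Q (X + Y))); first by rewrite add0r.
by move=> a w Z Qw sZ P P0 PD; rewrite -addrA; exact: (PD _ _ _ Qw (sZ P P0 PD)).
Qed.

Lemma spannedZ Q a X : spanned Q X -> spanned Q (a *: X).
Proof.
move=> sX; apply: (sX (fun X => spanned Q (a *: X))); first by rewrite scaler0; exact: spanned0.
by move=> b w Z Qw sZ P P0 PD; rewrite scalerDr scalerA; exact: (PD _ _ _ Qw (sZ P P0 PD)).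
Qed.

Lemma spanned_sum Q (I : Type) (r : seq I) (F : I -> T) :
  (forall i, spanned Q (F i)) -> spanned Q (\sum_(i <- r) F i).
Proof. by move=> sF; apply: big_ind => //; exact: spannedD. Qed.

Lemma spanned_linear Q Q' (f : T -> T) : linear f ->
  (forall w, Q w -> spanned Q' (f (pure w))) -> forall X, spanned Q X -> spanned Q' (f X).
Proof.
move=> fl fQ X sX; apply: (sX (fun X => spanned Q' (f X))).
  by rewrite (linpred0 fl); exact: spanned0.
by move=> a w Y Qw sY; rewrite fl; exact: (spannedD (spannedZ _ (fQ _ Qw)) sY).
Qed.

Lemma spanned_ext Q (W : lmodType C) (f g : T -> W) : linear f -> linear g ->
  (forall w, Q w -> f (pure w) = g (pure w)) -> forall X, spanned Q X -> f X = g X.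
Proof.
move=> fl gl fg X sX; apply: (sX (fun X => f X = g X)).
  by rewrite (linpred0 fl) (linpred0 gl).
by move=> a w Y Qw E; rewrite fl gl E fg.
Qed.

Definition homog k := spanned (fun w => size w = k).
Definition bounded_degree n := spanned (fun w => (size w < n)%N).

Lemma exists_bounded_degree X : exists n, bounded_degree n X.
Proof.
elim/tm_ind: X => [|a w X [n sX]]; first by exists 0%N; exact: spanned0.
exists (maxn n (size w).+1); apply: spannedD.
  apply: spannedZ; apply: spanned_word; exact: leq_maxr.
apply: (sX (spanned _)) => [|b u Y un sY]; first exact: spanned0.
by apply: (spannedD _ sY); apply: spannedZ; apply: spanned_word; exact: (leq_trans un (leq_maxl _ _)).
Qed.

Lemma homog_mul k m X Y : homog k X -> homog m Y -> homog (k + m) (mul X Y).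
Proof.
move=> hX hY; apply: (spanned_linear (mull Y)) hX => u uk.
apply: (spanned_linear (mulr _)) hY => v vm.
by rewrite tm_mul_pure; apply: spanned_word; rewrite size_cat uk vm.
Qed.

Lemma homog_sym k X : homog k X -> homog k (sym X).
Proof.
apply: (spanned_linear syml) => w wk; rewrite tm_sym_pure; apply: spannedZ; apply: spanned_sum => s.
by apply: spanned_word; rewrite /= size_word_perm.
Qed.

(** Contraction of the first factor. With [const_coef] these maps are the
    coordinates of a tensor with respect to its first letter. *)
Definition head_word l w : T := if w is x :: u then l x *: pure u else 0.

Lemma head_word_multilinear l : multilinear idfun (head_word l).
Proof.
move=> [|z u] v a x y /=; first by rewrite linearP scalerDl scalerA.
by rewrite (tm_pureM T) scalerDr !scalerA [a * _]mulrC.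
Qed.

Definition head l : T -> T := ext idfun (head_word l).

Lemma head_linear l : linear (head l).
Proof. exact: tm_ext_semilinear (@head_word_multilinear l). Qed.

Lemma head_pure l w : head l (pure w) = head_word l w.
Proof. exact: tm_ext_pure _ (@head_word_multilinear l). Qed.

Lemma head_unit l : head l (pure [::]) = 0.
Proof. exact: head_pure. Qed.

Lemma head_lcons l x X : head l (mul (pure [:: x]) X) = l x *: X.
Proof.
move: X; apply: linear_ext => [||w].
- exact: linear_comp (head_linear _) (mulr _).
- exact: linear_scale.
by rewrite tm_mul_pure head_pure.
Qed.

Lemma homog_head l k X : homog k.+1 X -> homog k (head l X).
Proof.
apply: (spanned_linear (head_linear l)) => -[|x u] //= [uk].
by rewrite head_pure; apply: spannedZ; apply: spanned_word.
Qed.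

Lemma bounded_head l n X : bounded_degree n.+1 X -> bounded_degree n (head l X).
Proof.
apply: (spanned_linear (head_linear l)) => -[|x u] /= un; rewrite head_pure.
  exact: spanned0.
by apply: spannedZ; apply: spanned_word.
Qed.

Lemma head_comb (I : Type) (r : seq I) (a : I -> C) (lk : I -> {linear V -> C^o}) l X :
  (forall y, l y = \sum_(i <- r) a i * lk i y) ->
  head l X = \sum_(i <- r) a i *: head (lk i) X.
Proof.
move=> lE; move: X; apply: linear_ext => [||w]; first exact: head_linear.
  move=> b X Y; rewrite scaler_sumr -big_split; apply: eq_bigr => i _ /=.
  by rewrite (head_linear _ b) scalerDr !scalerA [_ * b]mulrC.
case: w => [|x u]; first by rewrite head_unit big1 // => i _; rewrite head_unit scaler0.
rewrite head_pure /= lE scaler_suml; apply: eq_bigr => i _.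
by rewrite head_pure /= scalerA.
Qed.

Definition const_word w : C^o := if w is [::] then 1 else 0.

Lemma const_word_multilinear : multilinear idfun const_word.
Proof. by move=> [|z u] v a x y /=; rewrite scaler0 addr0. Qed.

Definition const_coef : T -> C^o := ext idfun const_word.

Lemma const_coef_linear : linear const_coef.
Proof. exact: tm_ext_semilinear const_word_multilinear. Qed.

Lemma const_coef_pure w : const_coef (pure w) = const_word w.
Proof. exact: tm_ext_pure _ const_word_multilinear. Qed.

Lemma const_coef_lcons x X : const_coef (mul (pure [:: x]) X) = 0.
Proof.
move: X; apply: linear_ext => [||w]; first exact: linear_comp const_coef_linear (mulr _).
  by move=> a X Y; rewrite scaler0 addr0.
by rewrite tm_mul_pure const_coef_pure.
Qed.

Lemma split_first_letter X : exists s : seq (V * T),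
  X = const_coef X *: pure [::] + \sum_(p <- s) mul (pure [:: p.1]) p.2.
Proof.
elim/tm_ind: X => [|a w X [s E]].
  by exists [::]; rewrite (linpred0 const_coef_linear) scale0r big_nil addr0.
case: w => [|x u].
  exists s; rewrite const_coef_linear const_coef_pure /= scalerDl -addrA -E.
  by congr (_ *: _ + _); rewrite -[RHS]/(a * 1) mulr1.
exists ((x, a *: pure u) :: s); rewrite big_cons /= (linpredZ (mulr _)) tm_mul_pure.
by rewrite const_coef_linear const_coef_pure /= scaler0 add0r addrCA -E.
Qed.

Implicit Types (hs gs : nat -> V -> V -> C).

Definition shift hs : nat -> V -> V -> C := fun i => hs i.+1.

(** One form for each slot: the weight [k!] of the norm in degree [k] is a product
    of weights [1], ..., [k] attached to the slots ([weighted]), and the estimates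
    below change the form of the first slot alone. *)
Fixpoint slot_prod hs w w' : C :=
  match w, w' with
  | [::], [::] => 1
  | x :: u, y :: v => hs 0%N x y * slot_prod (shift hs) u v
  | _, _ => 0
  end.

Definition sform hs X Y : C :=
  tm_ext (W := C^o) idfun
    (fun w' => tm_ext (W := C^o) Num.conj (fun w => slot_prod hs w w') X) Y.

Section Hermitian.
Definition slots_positive hs := forall i, positive_hermitian (hs i).

Lemma shift_positive hs : slots_positive hs -> slots_positive (shift hs).
Proof. by move=> hp i; exact: hp. Qed.

Lemma slot_prod_multilinear hs w : slots_positive hs ->
  multilinear (W := C^o) idfun (slot_prod hs w).
Proof.
move=> + u v a x y; elim: u w hs => [|z u IH] [|t w] hs hp /=.
- by rewrite scaler0 addr0.
- by rewrite (herm_Dr (hp 0%N)) (herm_Zr (hp 0%N)) mulrDl -mulrA.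
- by rewrite scaler0 addr0.
rewrite IH; last exact: shift_positive.
by rewrite mulrDr -[a *: (_ * _)]/(a * _) -[a *: _]/(a * _) mulrCA.
Qed.

Lemma slot_prodC hs w w' : slots_positive hs -> slot_prod hs w' w = (slot_prod hs w w')^*.
Proof.
elim: w w' hs => [|x u IH] [|y v] hs hp /=; rewrite ?conjC0 ?conjC1 //.
by rewrite conjCM -IH; [rewrite -(herm_C (hp 0%N))|exact: shift_positive].
Qed.

Lemma slot_prod_conj_multilinear hs w' : slots_positive hs ->
  multilinear (W := C^o) Num.conj (fun w => slot_prod hs w w').
Proof.
move=> hp u v a x y; rewrite !(slot_prodC w' _ hp) (slot_prod_multilinear _ hp).
by rewrite conjCD conjCM.
Qed.

Variables (hs : nat -> V -> V -> C) (hp : slots_positive hs).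

Let inner w' X : C^o := tm_ext (W := C^o) Num.conj (fun w => slot_prod hs w w') X.

Let inner_pure w' w : inner w' (pure w) = slot_prod hs w w'.
Proof. by rewrite /inner tm_ext_pure //; exact: slot_prod_conj_multilinear. Qed.

Let inner_conj w' a X Y : inner w' (a *: X + Y) = a^* *: inner w' X + inner w' Y.
Proof. exact: tm_ext_semilinear (slot_prod_conj_multilinear _ hp) _ _ _. Qed.

Let inner_multilinear X : multilinear idfun (inner^~ X).
Proof.
move=> u v a x y; move: X; apply: (@tensor_ext _ _ T _ Num.conj) => [b X Y|b X Y|w].
- exact: inner_conj.
- by rewrite !inner_conj !scalerDr !scalerA [a * _]mulrC addrACA; congr (_ + _).
by rewrite !inner_pure slot_prod_multilinear.
Qed.

Lemma sform_pure w w' : sform hs (pure w) (pure w') = slot_prod hs w w'.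
Proof.
by rewrite /sform (tm_ext_pure T w' (inner_multilinear (pure w))) -/(inner w' (pure w)) inner_pure.
Qed.

Lemma sform_linear_r X : linear (sform hs X : T -> C^o).
Proof. exact: tm_ext_semilinear (inner_multilinear X). Qed.

Lemma sform_pure_r X w' : sform hs X (pure w') = inner w' X.
Proof. exact: (tm_ext_pure T w' (inner_multilinear X)). Qed.

Lemma sform_conj_l Y a X X' :
  sform hs (a *: X + X') Y = a^* * sform hs X Y + sform hs X' Y.
Proof.
move: Y; apply: (linear_ext (W := C^o)) => [||w].
- exact: sform_linear_r.
- exact: linear_add (linear_scale (W' := C^o) _ (sform_linear_r _)) (sform_linear_r _).
by rewrite !sform_pure_r inner_conj.
Qed.

Lemma sformC X Y : sform hs Y X = (sform hs X Y)^*.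
Proof.
move: X; apply: (linear_ext (W := C^o)) => [||w]; first exact: sform_linear_r.
  by move=> a X X'; rewrite sform_conj_l conjCD conjCM conjCK.
move: Y; apply: (@tensor_ext _ _ T C^o Num.conj) => [a X X'|a X X'|w'].
- exact: sform_conj_l.
- by rewrite sform_linear_r conjCD -[a *: _]/(a * _) conjCM.
by rewrite !sform_pure; exact: slot_prodC.
Qed.

Lemma sform_unit_l Y : sform hs (pure [::]) Y = const_coef Y.
Proof.
move: Y; apply: (linear_ext (W := C^o)) => [||w]; first exact: sform_linear_r.
  exact: const_coef_linear.
by rewrite sform_pure const_coef_pure; case: w.
Qed.
End Hermitian.

Lemma sform_lcons hs x y X Y : slots_positive hs ->
  sform hs (mul (pure [:: x]) X) (mul (pure [:: y]) Y) =
  hs 0%N x y * sform (shift hs) X Y.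
Proof.
move=> hp; have hp' := shift_positive hp.
move: Y; apply: (linear_ext (W := C^o)) => [||v].
- exact: (linear_comp (W'' := C^o) (sform_linear_r hp _) (mulr _)).
- exact: (linear_scale (W' := C^o) _ (sform_linear_r hp' _)).
move: X; apply: (@tensor_ext _ _ T C^o Num.conj) => [a X X'|a X X'|u].
- by rewrite (mulr _ a) (sform_conj_l hp).
- by rewrite (sform_conj_l hp') mulrDr mulrCA.
by rewrite !tm_mul_pure !sform_pure.
Qed.

Lemma sform_lcons_head hs x X Y : slots_positive hs ->
  forall l, (forall y, l y = hs 0%N x y) ->
  sform hs (mul (pure [:: x]) X) Y = sform (shift hs) X (head l Y).
Proof.
move=> hp l lE; have hp' := shift_positive hp.
move: Y; apply: (linear_ext (W := C^o)) => [||v].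
- exact: sform_linear_r.
- exact: (linear_comp (W'' := C^o) (sform_linear_r hp' _) (head_linear _)).
case: v => [|y v].
  rewrite head_unit (linpred0 (sform_linear_r hp' X)).
  by rewrite (sformC hp) (sform_unit_l hp) const_coef_lcons conjC0.
rewrite [pure (y :: v)]pure_cons sform_lcons // head_lcons lE.
by rewrite (linpredZ (sform_linear_r hp' X)).
Qed.

Lemma sform_suml hs (hp : slots_positive hs) (I : Type) (r : seq I) (F : I -> T) Y :
  sform hs (\sum_(p <- r) F p) Y = \sum_(p <- r) sform hs (F p) Y.
Proof.
apply: (big_morph (fun X => sform hs X Y)) => [X X'|].
  by rewrite -[X in LHS]scale1r (sform_conj_l hp) conjC1 mul1r.
by rewrite (sformC hp) (linpred0 (sform_linear_r hp Y)) conjC0.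
Qed.

Lemma sform_conjZ hs (hp : slots_positive hs) a X Y : sform hs (a *: X) Y = a^* * sform hs X Y.
Proof.
by rewrite -[_ *: X]addr0 (sform_conj_l hp) [X in _ + X](sformC hp)
  (linpred0 (sform_linear_r hp Y)) conjC0 addr0.
Qed.

Definition hlin (h : V -> V -> C) (hh : positive_hermitian h) (x : V) : {linear V -> C^o} :=
  HB.pack (h x : V -> C^o)
    (GRing.isLinear.Build C V C^o _ _ (fun a y z => let: And3 H _ _ := hh in H x a y z)).

Section Parseval.
Variables (hs : nat -> V -> V -> C) (hp : slots_positive hs).

(** Expansion of the first slot along vectors that resolve the first letters of
    [X]. It expresses [sform hs] by [sform (shift hs)] in one degree less, which
    opens positivity and monotonicity to induction on the degree. *)
Lemma parseval n (e : nat -> V) X Y (s : seq (V * T)) :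
  X = const_coef X *: pure [::] + \sum_(p <- s) mul (pure [:: p.1]) p.2 ->
  (forall p, p \in s -> resolves (hs 0%N) n e p.1) ->
  sform hs X Y = (const_coef X)^* * const_coef Y +
    \sum_(i < n) sform (shift hs) (head (hlin (hp 0%N) (e i)) X) (head (hlin (hp 0%N) (e i)) Y).
Proof.
move=> XE rs; have hp' := shift_positive hp.
rewrite {1}XE (sform_conj_l hp) (sform_unit_l hp); congr (_ + _).
have headX i : head (hlin (hp 0%N) (e i)) X = \sum_(p <- s) hs 0%N (e i) p.1 *: p.2.
  rewrite {1}XE (linpredD (head_linear _)) (linpredZ (head_linear _)) head_unit scaler0 add0r.
  rewrite (linpred_sum (head_linear _)); apply: eq_bigr => p _.
  by rewrite head_lcons.
rewrite (sform_suml hp) big_seq_cond [RHS](eq_bigr (fun i : 'I_n => \sum_(p <- s | p \in s)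
   hs 0%N p.1 (e i) * sform (shift hs) p.2 (head (hlin (hp 0%N) (e i)) Y))); last first.
  move=> i _; rewrite headX (sform_suml hp') big_seq; apply: eq_bigr => p _.
  by rewrite (sform_conjZ hp') -(herm_C (hp 0%N)).
rewrite exchange_big /=; apply: eq_big => p; first by rewrite andbT.
rewrite andbT => ps; rewrite (sform_lcons_head _ _ hp (l := hlin (hp 0%N) p.1)) //.
rewrite (head_comb (r := index_enum 'I_n) (a := fun i => hs 0%N p.1 (e i))
  (lk := fun i => hlin (hp 0%N) (e i))).
  rewrite (linpred_sum (sform_linear_r hp' _)); apply: eq_bigr => i _.
  by rewrite (linpredZ (sform_linear_r hp' _)).
by move=> y; exact: rs.
Qed.

Lemma parseval_exists X : exists n e, orthonormal_upto (hs 0%N) n e /\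
  forall Y, sform hs X Y = (const_coef X)^* * const_coef Y +
    \sum_(i < n) sform (shift hs) (head (hlin (hp 0%N) (e i)) X) (head (hlin (hp 0%N) (e i)) Y).
Proof.
have [s XE] := split_first_letter X.
have [n [e [on rs]]] := gram_schmidt (hp 0%N) (map fst s).
exists n, e; split=> // Y; apply: parseval XE _ => p ps.
by apply: rs; apply: map_f.
Qed.
End Parseval.

Lemma sform_ge0 hs X : slots_positive hs -> 0 <= sform hs X X.
Proof.
have [n] := exists_bounded_degree X; elim: n X hs => [|n IH] X hs bX hp.
  by rewrite (bX (fun X => X = 0)) ?(linpred0 (sform_linear_r hp 0)).
have [m [e [_ ->]]] := parseval_exists hp X.
rewrite addr_ge0 ?sumr_ge0 // => [|i _]; first by rewrite mulrC mul_conjC_ge0.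
by apply: IH (shift_positive hp); exact: bounded_head.
Qed.

Lemma sform_positive hs : slots_positive hs -> positive_hermitian (sform hs).
Proof.
move=> hp; split=> [X a Y Z|X Y|X]; first exact: sform_linear_r.
  exact: sformC.
exact: sform_ge0.
Qed.

Lemma const_coef_le hs X : slots_positive hs -> `|const_coef X : C| ^+ 2 <= sform hs X X.
Proof.
move=> hp; have [m [e [_ ->]]] := parseval_exists hp X.
rewrite normCK mulrC lerDl sumr_ge0 // => i _.
exact: sform_ge0 (shift_positive hp).
Qed.

(** The hypothesis says that [hs 0] minus the sum of the forms [(lk i x)^* lk i y]
    is positive; put into the first slot, this difference makes the claim an
    instance of [const_coef_le]. *)
Lemma bessel_head hs (hp : slots_positive hs) m (lk : nat -> {linear V -> C^o}) X :
  (forall y, \sum_(i < m) `|lk i y : C| ^+ 2 <= hs 0%N y y) ->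
  \sum_(i < m) sform (shift hs) (head (lk i) X) (head (lk i) X) + `|const_coef X : C| ^+ 2 <=
  sform hs X X.
Proof.
move=> bl; pose g x y := hs 0%N x y - \sum_(i < m) (lk i x)^* * lk i y.
pose gs i := if i is j.+1 then hs i else g.
have hp' := shift_positive hp.
have gp : slots_positive gs.
  case=> [|i]; last exact: hp; split=> [x a y z|x y|x] /=; rewrite /g.
  - rewrite (herm_Dr (hp 0%N)) (herm_Zr (hp 0%N)) mulrBr addrACA -opprD; congr (_ - _).
    rewrite big_distrr -big_split; apply: eq_bigr => i _ /=.
    by rewrite linearP /= mulrDr -[a *: _]/(a * _) mulrCA.
  - rewrite conjCD conjCN -(herm_C (hp 0%N)) conjC_sum; congr (_ - _).
    by apply: eq_bigr => i _; rewrite conjCM conjCK mulrC.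
  rewrite subr_ge0; apply: le_trans (bl x); rewrite le_eqVlt; apply/orP; left; apply/eqP.
  by apply: eq_bigr => i _; rewrite normCK mulrC.
pose B Y Z : C^o := \sum_(i < m) sform (shift hs) (head (lk i) Y) (head (lk i) Z).
have Br Y : linear (B Y).
  move=> a Z Z'; rewrite /B scaler_sumr -big_split; apply: eq_bigr => i _ /=.
  by rewrite (head_linear _ a) (sform_linear_r hp' _ a).
have Bl Z a Y Y' : B (a *: Y + Y') Z = a^* * B Y Z + B Y' Z.
  rewrite /B big_distrr -big_split; apply: eq_bigr => i _ /=.
  by rewrite (head_linear _ a) (sform_conj_l hp').
have E Y Z : sform gs Y Z = sform hs Y Z - B Y Z.
  move: Z; apply: (linear_ext (W := C^o)) => [|a Z Z'|v]; first exact: sform_linear_r.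
    by rewrite (sform_linear_r hp _ a) (Br Y a) scalerBr opprD addrACA.
  move: Y; apply: (@tensor_ext _ _ T C^o Num.conj) => [a Y Y'|a Y Y'|u].
  - exact: sform_conj_l.
  - by rewrite (sform_conj_l hp) Bl opprD addrACA -[_ *: _]/(_ * _) mulrBr.
  rewrite !sform_pure // /B; case: u v => [|x u] [|y v] /=.
  - by rewrite big1 ?subr0 // => i _; rewrite head_unit (linpred0 (sform_linear_r hp' _)).
  - rewrite sub0r big1 ?oppr0 // => i _.
    by rewrite head_unit (sformC hp') (linpred0 (sform_linear_r hp' _)) conjC0.
  - by rewrite sub0r big1 ?oppr0 // => i _; rewrite head_unit (linpred0 (sform_linear_r hp' _)).
  rewrite /g mulrBl; congr (_ - _); rewrite big_distrl; apply: eq_bigr => i _ /=.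
  rewrite !head_pure /= (linpredZ (sform_linear_r hp' _)) (sform_conjZ hp') sform_pure //.
  by rewrite -[_ *: _]/(_ * _) mulrCA mulrA.
have := const_coef_le X gp; rewrite E lerBrDr addrC; exact.
Qed.

(** [parseval] for the smaller form and [bessel_head] for the larger one, by
    induction on the degree. *)
Lemma sform_mono gs hs X : slots_positive gs -> slots_positive hs ->
  (forall i y, gs i y y <= hs i y y) -> sform gs X X <= sform hs X X.
Proof.
have [n] := exists_bounded_degree X; elim: n X gs hs => [|n IH] X gs hs bX gp hp gh.
  rewrite (bX (fun X => X = 0)) // (linpred0 (sform_linear_r hp 0)).
  by rewrite (linpred0 (sform_linear_r gp 0)).
have [m [e [on ->]]] := parseval_exists gp X.
have bl y : \sum_(i < m) `|hlin (gp 0%N) (e i) y : C| ^+ 2 <= hs 0%N y y.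
  exact: le_trans (bessel (gp 0%N) on y) (gh 0%N y).
apply: le_trans (@bessel_head hs hp m (fun i => hlin (gp 0%N) (e i)) X bl).
rewrite [X in X + _]mulrC -normCK addrC lerD // ler_sum // => i _.
apply: IH; [exact: bounded_head|exact: shift_positive|exact: shift_positive|].
by move=> k y; exact: gh.
Qed.

End WordForms.

Section UniformForms.
Context (R : realType) (V : tvsType R[i]) (T : tensor_model V).
Local Notation C := R[i].
Local Notation pure := (@tm_pure R V T).
Local Notation sym := (@tm_sym R V T).
Local Notation syml := (@tm_sym_linear R V T).
Implicit Types (w u v : seq V) (X Y Z : T) (l : {linear V -> C^o}).

(** The weights of the first [k] slots multiply to [k!]. *)
Definition weighted (h : V -> V -> C) (i : nat) : V -> V -> C := fun x y => i.+1%:R * h x y.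

Lemma scaled_positive (h : V -> V -> C) (a : C) : 0 <= a -> positive_hermitian h ->
  positive_hermitian (fun x y => a * h x y).
Proof.
move=> a0 hh; split=> [x b y z|x y|x].
- by rewrite (herm_Dr hh) (herm_Zr hh) mulrDr mulrCA.
- by rewrite conjCM -(herm_C hh) (conj_Creal (ger0_real a0)).
- by rewrite mulr_ge0 // herm_ge0.
Qed.

Lemma slot_prod_const h w w' : slot_prod (fun=> h) w w' =
  if size w == size w' then \prod_(p <- zip w w') h p.1 p.2 else 0.
Proof.
elim: w w' => [|x u IH] [|y v] //=; first by rewrite big_nil.
by rewrite -/(shift (fun=> h)) IH eqSS big_cons; case: ifP; rewrite ?mulr0.
Qed.

Lemma slot_prod_weighted_shift h j w w' :
  j`!%:R * slot_prod (fun i => weighted h (i + j)) w w' =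
  (size w + j)`!%:R * slot_prod (fun=> h) w w'.
Proof.
elim: w w' j => [|x u IH] [|y v] j //=; rewrite ?mulr0 //.
rewrite (_ : shift _ = fun i => weighted h (i + j.+1)); last first.
  by apply/funext => i; rewrite /shift addSnnS.
rewrite /weighted add0n addSnnS -/(shift (fun=> h)).
rewrite (_ : shift (fun=> h) = fun=> h) //.
transitivity (h x y * (j.+1`!%:R * slot_prod (fun i => weighted h (i + j.+1)) u v)).
  by rewrite factS natrM; ring.
by rewrite IH; ring.
Qed.

Lemma slot_prod_weighted h w w' :
  slot_prod (weighted h) w w' = (size w)`!%:R * slot_prod (fun=> h) w w'.
Proof.
have := slot_prod_weighted_shift h 0 w w'; rewrite fact0 mul1r addn0 => <-.
by congr (slot_prod _ w w'); apply/funext => i; rewrite addn0.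
Qed.

Section OneForm.
Variables (h : V -> V -> C) (hh : positive_hermitian h).

Lemma const_positive : slots_positive (fun=> h).
Proof. by move=> i. Qed.
Lemma weighted_positive : slots_positive (weighted h).
Proof. by move=> i; apply: scaled_positive. Qed.

Local Notation uf := (@sform R V T (fun=> h)).
Local Notation tf := (@sform R V T (weighted h)).
Let ufp := const_positive.
Let tfp := weighted_positive.
Let ufh : positive_hermitian uf := sform_positive T const_positive.
Let tfh : positive_hermitian tf := sform_positive T weighted_positive.

Lemma weighted_form_homog k X Y : homog k X -> tf X Y = k`!%:R * uf X Y.
Proof.
move=> hX; apply: (hX (fun X => tf X Y = k`!%:R * uf X Y)).
  by rewrite (herm_0l tfh) (herm_0l ufh) mulr0.
move=> a w Z wk IH; rewrite (herm_Dl tfh) (herm_Dl ufh) (herm_Zl tfh) (herm_Zl ufh) IH mulrDr.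
congr (_ + _); rewrite mulrCA; congr (_ * _); move: Y {IH}.
apply: (linear_ext (W := C^o)) => [||v]; first exact: sform_linear_r.
  exact: (linear_scale (W' := C^o) _ (sform_linear_r ufp _)).
by rewrite !sform_pure // slot_prod_weighted wk.
Qed.

Lemma weighted_form_orthogonal k m X Y : k != m -> homog k X -> homog m Y -> tf X Y = 0.
Proof.
move=> km hX hY; apply: (hX (fun X => tf X Y = 0)); first exact: herm_0l.
move=> a u Z uk IH; rewrite (herm_Dl tfh) (herm_Zl tfh) IH addr0.
have -> : tf (pure u) Y = 0; last exact: mulr0.
apply: (hY (fun Y => tf (pure u) Y = 0)); first exact: herm_0r.
move=> b v Z' vm IH'; rewrite (herm_Dr tfh) (herm_Zr tfh) IH' addr0 sform_pure //.
by rewrite slot_prod_weighted slot_prod_const uk vm (negbTE km) !mulr0.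
Qed.

Lemma slot_prod_const_perm k w w' (s : 'S_k) : size w = k -> size w' = k ->
  slot_prod (fun=> h) (word_perm w s) w' = slot_prod (fun=> h) w (word_perm w' s^-1%g).
Proof.
move=> wk wk'; rewrite !slot_prod_const !size_word_perm wk wk' eqxx.
have zipE u v : size u = k -> size v = k ->
    \prod_(p <- zip u v) h p.1 p.2 = \prod_(i < k) h (nth 0 u i) (nth 0 v i).
  move=> uk vk; rewrite (big_nth (0, 0)) size1_zip ?uk ?vk // big_mkord.
  by apply: eq_bigr => i _; rewrite nth_zip ?uk ?vk.
rewrite !zipE ?size_word_perm // [RHS](reindex_inj (@perm_inj _ s)) /=.
by apply: eq_bigr => i _; rewrite !word_perm_nth permK.
Qed.

Lemma sym_self_adjoint X Y : tf (sym X) Y = tf X (sym Y).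
Proof.
move: X; apply: (@tensor_ext _ _ T C^o Num.conj) => [a X X'|a X X'|w].
- by rewrite syml (sform_conj_l tfp).
- by rewrite (sform_conj_l tfp).
move: Y; apply: (linear_ext (W := C^o)) => [||w'].
- exact: sform_linear_r.
- exact: (linear_comp (W'' := C^o) (sform_linear_r tfp _) syml).
have hw u : homog (size u) (pure u) by apply: spanned_word.
have [E|ne] := eqVneq (size w) (size w'); last first.
  rewrite (weighted_form_orthogonal ne (homog_sym (hw w)) (hw w')).
  by rewrite (weighted_form_orthogonal ne (hw w) (homog_sym (hw w'))).
rewrite (sym_pureE T (erefl (size w))) (sym_pureE T (esym E)).
rewrite (herm_Zl tfh) (herm_Zr tfh) (herm_suml tfh) (herm_sumr tfh).
rewrite conj_Creal ?rpredV ?realn //; congr (_ * _).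
have inj : injective (fun s : 'S_(size w) => s^-1%g) by exact: invg_inj.
rewrite [RHS](reindex_inj inj) /=; apply: eq_bigr => s _.
by rewrite !sform_pure // !slot_prod_weighted size_word_perm slot_prod_const_perm.
Qed.

(** A self-adjoint idempotent does not increase the norm. *)
Lemma sym_contraction X : tf (sym X) (sym X) <= tf X X.
Proof.
have E : tf (sym X) (sym X) = tf X (sym X) by rewrite sym_self_adjoint sym_id.
have E' : tf (sym X) (sym X) = tf (sym X) X by rewrite [RHS]sym_self_adjoint E.
have := herm_ge0 tfh (X - sym X).
by rewrite (herm_Br tfh) !(herm_Bl tfh) -E -E' subrr subr0 subr_ge0.
Qed.

(** [bessel_head] for the single functional [l], with [M h] in the first slot. *)
Lemma head_bound (M : R) l Z : 0 <= M -> (forall y, `|l y : C| ^+ 2 <= M%:C%C * h y y) ->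
  uf (head l Z) (head l Z) <= M%:C%C * uf Z Z.
Proof.
move=> M0 lM; pose hs i : V -> V -> C := if i is _.+1 then h else fun x y => M%:C%C * h x y.
have MC : 0 <= M%:C%C :> C by rewrite ler0c.
have hp : slots_positive hs by case=> [|i] //; apply: scaled_positive.
have E X Y : sform hs X Y =
    M%:C%C * (uf X Y - (const_coef X)^* * const_coef Y) + (const_coef X)^* * const_coef Y.
  move: Y; apply: (linear_ext (W := C^o)) => [|a Y Y'|v]; first exact: sform_linear_r.
    rewrite (sform_linear_r ufp _ a) (const_coef_linear a) -![a *: _]/(a * _); ring.
  move: X; apply: (@tensor_ext _ _ T C^o Num.conj) => [a X X'|a X X'|u].
  - exact: sform_conj_l.
  - rewrite (sform_conj_l ufp) (const_coef_linear a) conjCD -![a *: _]/(a * _) conjCM.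
    by rewrite -![_^* *: _]/(_ * _); ring.
  rewrite !sform_pure // !const_coef_pure; case: u v => [|x u] [|y v] /=.
  - by rewrite conjC1 mulr1 subrr mulr0 add0r.
  - by rewrite mulr0 subrr mulr0 addr0.
  - by rewrite conjC0 mul0r subrr mulr0 addr0.
  by rewrite conjC0 mul0r subr0 addr0 mulrA.
have bl y : \sum_(i < 1) `|l y : C| ^+ 2 <= hs 0%N y y by rewrite big_ord1 lM.
have := bessel_head hp (lk := fun=> l) Z bl.
rewrite big_ord1 E -normCKC lerD2r => /le_trans; apply.
by rewrite ler_wpM2l // gerBl exprn_ge0.
Qed.
End OneForm.
End UniformForms.

(** * Growth of powers of elements of degree at most two *)

Section Growth.
Context (R : realType) (V : tvsType R[i]) (T : tensor_model V).
Local Notation C := R[i].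
Local Notation pure := (@tm_pure R V T).
Local Notation mul := (@tm_mul R V T).
Local Notation mull := (@tm_mul_linear_l R V T).
Local Notation mulr := (@tm_mul_linear_r R V T).
Local Notation sym := (@tm_sym R V T).
Local Notation syml := (@tm_sym_linear R V T).
Implicit Types (w u v : seq V) (X Y Z : T) (l : {linear V -> C^o}).

Definition number : T -> T :=
  tm_ext idfun (fun w => (size w)%:R *: pure w).

Lemma number_multilinear : multilinear idfun (fun w => (size w)%:R *: pure w).
Proof.
move=> u v a x y; rewrite !size_cat /= (tm_pureM T) scalerDr !scalerA.
by rewrite [_ * a]mulrC.
Qed.

Lemma number_linear : linear number.
Proof. exact: tm_ext_semilinear number_multilinear. Qed.

Lemma number_pure w : number (pure w) = (size w)%:R *: pure w.
Proof. exact: tm_ext_pure _ number_multilinear. Qed.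

Lemma number_homog k X : homog k X -> number X = k%:R *: X.
Proof.
apply: spanned_ext => [||w wk]; first exact: number_linear.
  exact: linear_scale.
by rewrite number_pure wk.
Qed.

(** On the power [x^k] both sides are [k * l x] times [x^(k - 1)]. *)
Lemma ann_head l X : ann l (sym X) = head l (number (sym X)).
Proof.
pose P X := ann l X = head l (number X).
refine (@sym_tpow_ind R V T P _ _ _ X) => [|a Y Z IY IZ|x k]; rewrite /P.
- by rewrite (linpred0 (ann_linear _)) (linpred0 number_linear) (linpred0 (head_linear _)).
- by rewrite (ann_linear _ a) (number_linear a) (head_linear _ a) IY IZ.
rewrite ann_tpow number_pure (linpredZ (head_linear _)) head_pure size_nseq.
by case: k => [|k] /=; rewrite ?mul0r ?scale0r // scalerA.
Qed.

Lemma ann_symmetric l X : sym (ann l (sym X)) = ann l (sym X).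
Proof.
pose P X := sym (ann l X) = ann l X.
refine (@sym_tpow_ind R V T P _ _ _ X) => [|a Y Z IY IZ|x k]; rewrite /P.
- by rewrite (linpred0 (ann_linear _)) (linpred0 syml).
- by rewrite (ann_linear _ a) syml IY IZ.
by rewrite ann_tpow (linpredZ syml) sym_tpow.
Qed.

Definition degree_part k : T -> T := tm_ext idfun (fun w => if size w == k then pure w else 0).

Lemma degree_part_multilinear k : multilinear idfun (fun w => if size w == k then pure w else 0).
Proof.
move=> u v a x y; rewrite !size_cat /=.
by case: eqP => _; rewrite ?(tm_pureM T) // scaler0 addr0.
Qed.

Lemma degree_part_linear k : linear (degree_part k).
Proof. exact: tm_ext_semilinear (@degree_part_multilinear k). Qed.

Lemma degree_part_pure k w : degree_part k (pure w) = if size w == k then pure w else 0.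
Proof. exact: tm_ext_pure _ (@degree_part_multilinear k). Qed.

Lemma homog_degree_part k X : homog k (degree_part k X).
Proof.
elim/tm_ind: X => [|a w X IH].
  by rewrite (linpred0 (degree_part_linear k)); exact: spanned0.
rewrite (degree_part_linear k) degree_part_pure.
apply: spannedD => //; apply: spannedZ.
by case: eqP => [wk|_]; [exact: spanned_word|exact: spanned0].
Qed.

Lemma degree_part_homog k X : homog k X -> degree_part k X = X.
Proof.
by apply: spanned_ext => [||w wk]; [exact: degree_part_linear|by []|rewrite degree_part_pure wk eqxx].
Qed.

Lemma homog_ann l k X : homog k.+1 X -> homog k (ann l X).
Proof.
apply: (spanned_linear (ann_linear l)) => w; elim: w k => [|x u IH] k //= [uk].
rewrite pure_cons ann_lcons; apply: spannedD.
  by apply: spannedZ; apply: spanned_word.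
case: k uk => [|k] uk.
  by move/size0nil: uk => ->; rewrite ann_unit (linpred0 (mulr _)); exact: spanned0.
by apply: (@homog_mul R V T 1 k); [exact: spanned_word|exact: IH].
Qed.

Lemma ann_homog0 l X : homog 0 X -> ann l X = 0.
Proof.
move=> hX; rewrite (spanned_ext (ann_linear l) (g := fun=> 0) _ _ hX) //.
  by move=> a Y Z; rewrite scaler0 addr0.
by move=> w /size0nil ->; rewrite ann_unit.
Qed.

Section Estimates.
Variables (h : V -> V -> C) (hh : positive_hermitian h).
Variables (Lam : V -> V -> C) (Lam_bilin : bilinear_form Lam).
Hypothesis Lam_le : forall x y, `|Lam x y| ^+ 2 <= h x x * h y y.
Local Notation uf := (@sform R V T (fun=> h)).
Local Notation tf := (@sform R V T (weighted h)).
Let ufp := const_positive hh.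
Let tfp := weighted_positive hh.
Let ufh : positive_hermitian uf := sform_positive T ufp.
Let tfh : positive_hermitian tf := sform_positive T tfp.
Local Notation lamr := (lamr Lam_bilin).
Local Notation nh := (hnorm h).
Local Notation nu := (hnorm uf).
Local Notation nt := (hnorm tf).

Lemma weighted_norm_homog k X : homog k X -> nt X ^+ 2 = k`!%:R * nu X ^+ 2.
Proof.
move=> hX; apply: (@complexI R); rewrite (RcM k`!%:R) -(hnormE tfh) -(hnormE ufh).
rewrite (weighted_form_homog hh _ hX).
by rewrite Rc_nat.
Qed.

Lemma weighted_norm_natZ n X : nt (n%:R *: X) = n%:R * nt X.
Proof. by rewrite -(Rc_nat R) (hnormZr tfh). Qed.

Lemma weighted_norm_sym X : nt (sym X) <= nt X.
Proof.
rewrite -(@ler_pXn2r _ 2) ?nnegrE ?hnorm_ge0 // -lecR -!(hnormE tfh).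
exact: sym_contraction.
Qed.

Lemma lam_le_norm x y : `|Lam x y| ^+ 2 <= (nh x ^+ 2)%:C%C * h y y.
Proof. by rewrite -(hnormE hh); exact: Lam_le. Qed.

Lemma head_lam_le x Z : nu (head (lamr x) Z) ^+ 2 <= nh x ^+ 2 * nu Z ^+ 2.
Proof.
rewrite -lecR (RcM (nh x ^+ 2)) -!(hnormE ufh); apply: head_bound => // [|y]; first exact: sqr_ge0.
exact: lam_le_norm.
Qed.

(** By duality: the sum is [Lam x y] for the combination [x] of the [e k] with
    conjugate coefficients, and it is also [h x x]. *)
Lemma lam_bessel n e y : orthonormal_upto h n e ->
  \sum_(k < n) `|Lam (e k) y| ^+ 2 <= h y y.
Proof.
move=> on; set S := \sum_(k < n) _.
have S0 : 0 <= S by apply: sumr_ge0 => i _; exact: exprn_ge0.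
pose x := \sum_(k < n) (Lam (e k) y)^* *: e k.
have xy : Lam x y = S.
  have ll := lam_linear_l Lam_bilin y.
  rewrite /x (linpred_sum ll); apply: eq_bigr => k _.
  by rewrite (linpredZ ll) -[_ *: _]/(_ * _) normCKC.
have xx : h x x = S.
  rewrite (orthonormal_comb_norm hh on (fun k => (Lam (e k) y)^*)).
  by apply: eq_bigr => k _; rewrite norm_conjC.
have := Lam_le x y; rewrite xy xx (ger0_norm S0) expr2.
have [->|Sn] := eqVneq S 0; first by rewrite herm_ge0.
by rewrite ler_pM2l // lt_def Sn.
Qed.

Lemma mul_letter_norm x Z : nu (mul (pure [:: x]) Z) ^+ 2 = nh x ^+ 2 * nu Z ^+ 2.
Proof.
by apply: (@complexI R); rewrite (RcM (nh x ^+ 2)) -!(hnormE ufh) -(hnormE hh) sform_lcons.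
Qed.

Lemma mul_words u u' Z : size u = size u' ->
  uf (mul (pure u) Z) (mul (pure u') Z) = uf (pure u) (pure u') * uf Z Z.
Proof.
elim: u u' => [|x u IH] [|y u'] //= sz; first by rewrite tmul1l sform_pure // mul1r.
rewrite (pure_cons _ x u) (pure_cons _ y u') -!tmulA !sform_lcons // -mulrA; congr (_ * _).
by apply: IH; case: sz.
Qed.

Lemma mul_norm k X Z : homog k X -> nu (mul X Z) ^+ 2 = nu X ^+ 2 * nu Z ^+ 2.
Proof.
move=> hX; apply: (@complexI R); rewrite (RcM (nu X ^+ 2)) -!(hnormE ufh).
suff H X' : homog k X' -> uf (mul X Z) (mul X' Z) = uf X X' * uf Z Z by exact: H.
move=> hX'; apply: (hX (fun X => uf (mul X Z) (mul X' Z) = uf X X' * uf Z Z)).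
  by rewrite (linpred0 (mull _)) !(herm_0l ufh) mul0r.
move=> a u Y uk IH; rewrite (mull Z a) !(sform_conj_l ufp) IH mulrDl -mulrA.
congr (_ * _ + _).
apply: (hX' (fun X' => uf (mul (pure u) Z) (mul X' Z) = uf (pure u) X' * uf Z Z)).
  by rewrite (linpred0 (mull _)) !(herm_0r ufh) mul0r.
move=> b v Y' vk IH'; rewrite (mull Z b) !(herm_Dr ufh) !(herm_Zr ufh) IH' mulrDl -mulrA.
by rewrite mul_words // uk vk.
Qed.

Section Quadratic.
(* Every symmetric tensor of degree two has this form, by [homog2_squares]. *)
Variable s : seq (C * V).
Let X2 : T := \sum_(p <- s) p.1 *: pure [:: p.2; p.2].
Variable (Z : T).

(** The parts of the Wick product of [X2] with [Z] in which one or two letters of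
    [X2] are contracted are multiples of these two tensors; see
    [wick_quadratic_bound]. *)
Definition single_contraction : T :=
  \sum_(p <- s) p.1 *: mul (pure [:: p.2]) (head (lamr p.2) Z).
Definition double_contraction : T :=
  \sum_(p <- s) p.1 *: head (lamr p.2) (head (lamr p.2) Z).

Let lam_comb (I : Type) (r : seq I) (a : I -> C) (x : I -> V) y :
  Lam (\sum_(i <- r) a i *: x i) y = \sum_(i <- r) a i * Lam (x i) y.
Proof.
have ll := lam_linear_l Lam_bilin y; rewrite (linpred_sum ll).
by apply: eq_bigr => i _; rewrite (linpredZ ll).
Qed.

(** Hilbert-Schmidt estimates, independent of the choice of the squares. Let [e]
    resolve the letters of [X2] and let [v k] be the contraction of [X2] with
    [e k]; the squared norm of [X2] is the sum of those of the [v k]. By [parseval]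
    that of the single contraction is the sum over [k] of those of
    [head (lamr (v k)) Z]. The double contraction is the sum over [k] of
    [head (lamr (v k)) (head (lamr (e k)) Z)], to which the Cauchy-Schwarz
    inequality and [lam_bessel] apply. *)
Lemma quadratic_estimates :
  nu single_contraction ^+ 2 <= nu X2 ^+ 2 * nu Z ^+ 2 /\
  nu double_contraction ^+ 2 <= nu X2 ^+ 2 * nu Z ^+ 2.
Proof.
have [n [e [on rs]]] := gram_schmidt hh (map snd s).
have rp p : p \in s -> resolves h n e p.2 by move=> ps; apply: rs; apply: map_f.
pose v k := \sum_(p <- s) (p.1 * h (e k) p.2) *: p.2.
have lin1 := @pure_letter_linear R V T.
have X2v : nu X2 ^+ 2 = \sum_(k < n) nh (v k) ^+ 2.
  apply: (@complexI R); rewrite -(hnormE ufh) Rc_sum.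
  have c0 : const_coef X2 = 0.
    rewrite (linpred_sum (@const_coef_linear R V T)) big1 // => p _.
    by rewrite (linpredZ (@const_coef_linear R V T)) const_coef_pure scaler0.
  rewrite (@parseval _ _ _ _ ufp n e X2 X2 [seq (p.2, p.1 *: pure [:: p.2]) | p <- s]).
  - rewrite c0 mulr0 add0r; apply: eq_bigr => k _.
    have -> : head (hlin (ufp 0%N) (e k)) X2 = pure [:: v k].
      rewrite (linpred_sum (head_linear _)) (linpred_sum lin1); apply: eq_bigr => p _.
      rewrite (linpredZ (head_linear _)) head_pure (linpredZ lin1) scalerA.
      by [].
    by rewrite sform_pure //= mulr1 -(hnormE hh).
  - rewrite c0 scale0r add0r big_map; apply: eq_bigr => p _ /=.
    by rewrite (linpredZ (mulr _)) tm_mul_pure.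
  - by move=> q /mapP [p ps ->]; exact: rp.
split.
  apply: (@le_trans _ _ (\sum_(k < n) nh (v k) ^+ 2 * nu Z ^+ 2)); last first.
    by rewrite -big_distrl X2v.
  have c0 : const_coef single_contraction = 0.
    rewrite (linpred_sum (@const_coef_linear R V T)) big1 // => p _.
    by rewrite (linpredZ (@const_coef_linear R V T)) const_coef_lcons scaler0.
  rewrite -lecR -(hnormE ufh) Rc_sum.
  rewrite (@parseval _ _ _ _ ufp n e _ single_contraction
     [seq (p.2, p.1 *: head (lamr p.2) Z) | p <- s]).
  - rewrite c0 mulr0 add0r; apply: ler_sum => k _.
    have -> : head (hlin (ufp 0%N) (e k)) single_contraction = head (lamr (v k)) Z.
      rewrite (linpred_sum (head_linear _)).
      rewrite (head_comb (r := s) (a := fun p => p.1 * h (e k) p.2) (lk := fun p => lamr p.2)).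
        apply: eq_bigr => p _; rewrite (linpredZ (head_linear _)) head_lcons scalerA.
        by [].
      by move=> y; rewrite /= lam_comb.
    by rewrite (hnormE ufh) lecR; exact: head_lam_le.
  - rewrite c0 scale0r add0r big_map; apply: eq_bigr => p _ /=.
    by rewrite (linpredZ (mulr _)).
  - by move=> q /mapP [p ps ->]; exact: rp.
have -> : double_contraction = \sum_(k < n) head (lamr (v k)) (head (lamr (e k)) Z).
  transitivity (\sum_(p <- s) \sum_(k < n)
      (p.1 * h (e k) p.2) *: head (lamr p.2) (head (lamr (e k)) Z)).
    rewrite /double_contraction big_seq [RHS]big_seq; apply: eq_bigr => p ps.
    rewrite [X in head _ X](head_comb (r := index_enum 'I_n) (a := fun k => h (e k) p.2)
       (lk := fun k => lamr (e k))).
      rewrite (linpred_sum (head_linear _)) scaler_sumr; apply: eq_bigr => k _.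
      by rewrite (linpredZ (head_linear _)) scalerA.
    move=> y; rewrite /= -lam_comb; apply/eqP; rewrite -subr_eq0.
    have ll := lam_linear_l Lam_bilin y; rewrite -[_ - _](linpredB ll).
    have := Lam_le (p.2 - \sum_(k < n) h (e k) p.2 *: e k) y.
    rewrite (resolves_defect hh (rp p ps)) mul0r => le0.
    have : `|Lam (p.2 - \sum_(k < n) h (e k) p.2 *: e k) y| ^+ 2 == 0.
      by rewrite eq_le le0 exprn_ge0.
    by rewrite expf_eq0 /= normr_eq0.
  rewrite exchange_big; apply: eq_bigr => k _ /=.
  rewrite [RHS](head_comb (r := s) (a := fun p => p.1 * h (e k) p.2) (lk := fun p => lamr p.2)) //.
  by move=> y; rewrite /= lam_comb.
apply: (@le_trans _ _ ((\sum_(k < n) nh (v k) * nu (head (lamr (e k)) Z)) ^+ 2)).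
  rewrite ler_pXn2r ?nnegrE ?hnorm_ge0 ?sumr_ge0 // => [|k _]; last by rewrite mulr_ge0 ?hnorm_ge0.
  apply: le_trans (hnorm_sum ufh _ _ _) _; apply: ler_sum => k _.
  rewrite -(@ler_pXn2r _ 2) ?nnegrE ?mulr_ge0 ?hnorm_ge0 // exprMn.
  exact: head_lam_le.
apply: le_trans (sum_cauchy_schwarz _ (fun k => nh (v k)) (fun k => nu (head (lamr (e k)) Z))) _.
rewrite X2v ler_wpM2l ?sumr_ge0 // => [k _|]; first exact: sqr_ge0.
rewrite -lecR Rc_sum -(hnormE ufh).
rewrite (eq_bigr (fun k : 'I_n => uf (head (lamr (e k)) Z) (head (lamr (e k)) Z))); last first.
  by move=> k _; rewrite (hnormE ufh).
apply: le_trans (@bessel_head R V T (fun=> h) ufp n (fun k => lamr (e k)) Z _); last first.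
  by move=> y; exact: lam_bessel.
by rewrite lerDl exprn_ge0.
Qed.
End Quadratic.

Lemma graded_norm X0 X1 X2 : homog 0 X0 -> homog 1 X1 -> homog 2 X2 ->
  nt (X0 + X1 + X2) ^+ 2 = nt X0 ^+ 2 + nt X1 ^+ 2 + nt X2 ^+ 2.
Proof.
move=> h0 h1 h2; apply: (@complexI R).
rewrite (RcD (_ + _)) (RcD (nt X0 ^+ 2)) -!(hnormE tfh).
have o k m Y Z (km : k != m) hY hZ := @weighted_form_orthogonal R V T h hh k m Y Z km hY hZ.
rewrite !(herm_Dl tfh) !(herm_Dr tfh).
rewrite (o 0%N 1%N _ _ _ h0 h1) // (o 0%N 2%N _ _ _ h0 h2) // (o 1%N 0%N _ _ _ h1 h0) //.
rewrite (o 1%N 2%N _ _ _ h1 h2) // (o 2%N 0%N _ _ _ h2 h0) // (o 2%N 1%N _ _ _ h2 h1) //.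
by rewrite !addr0 !add0r.
Qed.

(** The sum of the norms of homogeneous parts, rather than the norm, is what
    propagates: the estimate for one more product depends on the degree of each
    part. *)
Definition graded_bound M (b : R) Y := exists s : seq (nat * T),
  [/\ Y = \sum_(p <- s) p.2,
      forall p, p \in s -> [/\ (p.1 <= M)%N, homog p.1 p.2 & sym p.2 = p.2] &
      \sum_(p <- s) nt p.2 <= b].

Lemma graded_boundD M b b' Y Y' :
  graded_bound M b Y -> graded_bound M b' Y' -> graded_bound M (b + b') (Y + Y').
Proof.
move=> [s [-> sp sb]] [s' [-> sp' sb']]; exists (s ++ s'); split.
- by rewrite big_cat.
- by move=> p; rewrite mem_cat => /orP[/sp|/sp'].
- by rewrite big_cat lerD.
Qed.

Lemma graded_bound0 M b : 0 <= b -> graded_bound M b 0.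
Proof. by move=> b0; exists [::]; split=> //; rewrite big_nil. Qed.

Lemma graded_bound_norm M b Y : graded_bound M b Y -> nt Y <= b.
Proof. by move=> [s [-> _ sb]]; apply: le_trans sb; exact: hnorm_sum. Qed.

Lemma graded_bound_sym k M b Y : (k <= M)%N -> homog k Y -> 0 <= b ->
  nt Y ^+ 2 <= b ^+ 2 -> graded_bound M b (sym Y).
Proof.
move=> kM hY b0 le; exists [:: (k, sym Y)]; split; first by rewrite big_seq1.
  move=> p; rewrite inE => /eqP -> /=.
  by split=> //; [exact: homog_sym|exact: sym_id].
rewrite big_seq1; apply: le_trans (weighted_norm_sym Y) _.
by move: le; rewrite ler_pXn2r // nnegrE // hnorm_ge0.
Qed.

Lemma homog0P X : homog 0 X -> exists a, X = a *: pure [::].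
Proof.
move=> hX; apply: (hX (fun X => exists a, X = a *: pure [::])).
  by exists 0; rewrite scale0r.
by move=> a w _ /size0nil -> [b ->]; exists (a + b); rewrite scalerDl.
Qed.

Lemma homog1P X : homog 1 X -> exists x, X = pure [:: x].
Proof.
move=> hX; apply: (hX (fun X => exists x, X = pure [:: x])).
  by exists 0; rewrite (linpred0 (@pure_letter_linear R V T)).
move=> a [|x [|z w]] // _ _ [y ->]; exists (a *: x + y).
by rewrite (@pure_letter_linear R V T a).
Qed.

Lemma homog2_squares X : homog 2 X -> sym X = X ->
  exists s : seq (C * V), X = \sum_(p <- s) p.1 *: pure [:: p.2; p.2].
Proof.
pose P Z := exists s : seq (C * V), degree_part 2 Z = \sum_(p <- s) p.1 *: pure [:: p.2; p.2].
move=> hX sX; suff [s E] : P (sym X) by exists s; rewrite -E sX degree_part_homog.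
have prl := degree_part_linear 2.
apply: (@sym_tpow_ind R V T P) => [|a Y Z [t Et] [t' Et']|x k].
- by exists [::]; rewrite big_nil (linpred0 prl).
- exists ([seq (a * p.1, p.2) | p <- t] ++ t'); rewrite (prl a) Et Et' big_cat big_map.
  by congr (_ + _); rewrite scaler_sumr; apply: eq_bigr => p _; rewrite scalerA.
have [->|k2] := eqVneq k 2.
  by exists [:: (1, x)]; rewrite big_seq1 scale1r degree_part_pure.
by exists [::]; rewrite big_nil degree_part_pure size_nseq (negbTE k2).
Qed.

Lemma ann_symmetric_homog l k Z : homog k Z -> sym Z = Z -> ann l Z = k%:R *: head l Z.
Proof.
by move=> hZ sZ; rewrite -[in LHS]sZ ann_head sZ (number_homog hZ) (linpredZ (head_linear _)).
Qed.

Section Step.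
Variables (X0 X1 X2 : T).
Hypotheses (h0 : homog 0 X0) (h1 : homog 1 X1) (h2 : homog 2 X2) (s2 : sym X2 = X2).
Variables (r : R) (r0 : 0 <= r).
Hypotheses (n0 : nt X0 <= r) (n1 : nt X1 <= r) (n2 : nt X2 <= r).

Section Homogeneous.
Variables (k : nat) (Z : T) (hZ : homog k Z) (sZ : sym Z = Z).

(* A bound for each of the six homogeneous terms of the product. *)
Let B : R := 2 * (k + 2)%:R * r * nt Z.

Let B0 : 0 <= B. Proof. by rewrite /B !mulr_ge0 // hnorm_ge0. Qed.

Let B_le (c x : R) : c <= (2 * (k + 2)%:R) ^+ 2 -> 0 <= x -> x <= r ^+ 2 * nt Z ^+ 2 ->
  c * x <= B ^+ 2.
Proof.
move=> cc x0 xx; rewrite /B -!mulrA mulrA !exprMn mulrA -(exprMn 2).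
apply: le_trans (ler_wpM2r x0 cc) _.
by rewrite -[leRHS]mulrA ler_wpM2l // sqr_ge0.
Qed.

Let square_le (m : nat) : (m <= 2 * (k + 2))%N -> m%:R ^+ 2 <= (2 * (k + 2)%:R : R) ^+ 2.
Proof.
by move=> mk; rewrite ler_pXn2r ?nnegrE ?mulr_ge0 // -natrM ler_nat.
Qed.

Lemma wick_scalar_bound : graded_bound (k + 2) B (sym (wick Lam_bilin X0 Z)).
Proof.
have [a E] := homog0P h0.
have -> : wick Lam_bilin X0 Z = a *: Z.
  by rewrite E (linpredZ (wick_linear_l Lam_bilin Z)) wick1l.
apply: (@graded_bound_sym k) => //; [exact: leq_addr|exact: spannedZ|].
have aZ : nt (a *: Z) = nt X0 * nt Z.
  apply: (@complexI R); rewrite E (hnormZ tfh) RcM (hnormZ tfh) -mulrA; congr (_ * _).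
  have -> : nt (pure [::]) = 1.
    by rewrite /hnorm sform_pure //= sqrtr1.
  by rewrite mul1r.
rewrite aZ -[leLHS]mul1r; apply: B_le; last first.
  by rewrite exprMn ler_wpM2r ?sqr_ge0 // ler_pXn2r ?nnegrE ?hnorm_ge0.
- exact: sqr_ge0.
- by have := @square_le 1%N; rewrite expr1n; apply; lia.
Qed.

Let letter_bound x : X1 = pure [:: x] -> nh x ^+ 2 <= r ^+ 2.
Proof.
move=> E; apply: (@le_trans _ _ (nt X1 ^+ 2)); last by rewrite ler_pXn2r ?nnegrE ?hnorm_ge0.
rewrite (weighted_norm_homog h1) (_ : 1`! = 1%N) // mul1r E -[pure [:: x]]tmul1r mul_letter_norm.
have -> : nu (pure [::]) = 1 by rewrite /hnorm sform_pure //= sqrtr1.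
by rewrite expr1n mulr1.
Qed.

Lemma wick_letter_bound : graded_bound (k + 2) (B + B) (sym (wick Lam_bilin X1 Z)).
Proof.
have [x E] := homog1P h1; have xr := letter_bound E.
have -> : wick Lam_bilin X1 Z = mul (pure [:: x]) Z + ann (lamr x) Z.
  by rewrite E -{1}[pure [:: x]]tmul1r wick_lcons !wick1l.
rewrite (linpredD syml); apply: graded_boundD.
  have hW : homog k.+1 (mul (pure [:: x]) Z).
    by rewrite -add1n; apply: homog_mul => //; exact: spanned_word.
  apply: (graded_bound_sym _ hW) => //; first by rewrite addn2.
  rewrite (weighted_norm_homog hW) mul_letter_norm factS natrM -mulrA.
  apply: B_le.
  - apply: le_trans (square_le (m := k.+1) _); last by lia.
    by rewrite -natrX ler_nat leq_pmull.
  - by apply: mulr_ge0 => //; apply: mulr_ge0; exact: sqr_ge0.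
  - rewrite (weighted_norm_homog hZ) mulrCA; apply: ler_wpM2r => //.
    by apply: mulr_ge0 => //; exact: sqr_ge0.
case: (posnP k) => [k0|kp].
  move: hZ; rewrite k0 => hZ0; rewrite ann_homog0 // (linpred0 syml).
  exact: graded_bound0.
have hW : homog k.-1 (head (lamr x) Z) by apply: homog_head; rewrite prednK.
rewrite (ann_symmetric_homog _ hZ sZ).
apply: (@graded_bound_sym k.-1) => //; [by lia|exact: spannedZ|].
apply: (@le_trans _ _ (k%:R * (nh x ^+ 2 * nt Z ^+ 2))).
  rewrite weighted_norm_natZ exprMn (weighted_norm_homog hW) (weighted_norm_homog hZ).
  rewrite -[in k`!](prednK kp) factS prednK //.
  rewrite natrM; have := head_lam_le x Z; set a := nu _ ^+ 2; set b := nu Z ^+ 2 => le.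
  rewrite (_ : k%:R * _ = k%:R ^+ 2 * (k.-1`!%:R * (nh x ^+ 2 * b))); last by ring.
  by rewrite !ler_wpM2l // exprn_ge0.
apply: B_le.
- apply: le_trans (square_le (m := k) _); last by lia.
  by rewrite -natrX ler_nat leq_pmull.
- by rewrite mulr_ge0 ?sqr_ge0.
- by rewrite ler_wpM2r ?sqr_ge0.
Qed.

Lemma wick_quadratic_bound : graded_bound (k + 2) (B + (B + B)) (sym (wick Lam_bilin X2 Z)).
Proof.
have [s E] := homog2_squares h2 s2.
pose G1 := single_contraction s Z; pose G2 := double_contraction s Z.
have wE : wick Lam_bilin X2 Z = mul X2 Z + ((2 * k)%:R *: G1 + (k * k.-1)%:R *: G2).
  rewrite E (linpred_sum (wick_linear_l Lam_bilin Z)) (linpred_sum (mull Z)).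
  rewrite /G1 /G2 !scaler_sumr -!big_split; apply: eq_bigr => p _ /=.
  rewrite (linpredZ (wick_linear_l Lam_bilin Z)) (linpredZ (mull Z)) !scalerA ![_%:R * p.1]mulrC.
  rewrite -!scalerA -!scalerDr; congr (_ *: _); set x := p.2.
  have D l : ann l Z = k%:R *: head l Z := ann_symmetric_homog l hZ sZ.
  have DD l : ann l (ann l Z) = (k * k.-1)%:R *: head l (head l Z).
    case: (posnP k) => [k0|kp].
      by move: hZ; rewrite k0 => hZ0; rewrite (ann_homog0 l hZ0) (linpred0 (ann_linear _)) scale0r.
    have hD : homog k.-1 (ann l Z) by apply: homog_ann; rewrite prednK.
    have sD : sym (ann l Z) = ann l Z by rewrite -sZ ann_symmetric.
    rewrite (ann_symmetric_homog l hD sD) D (linpredZ (head_linear _)) scalerA.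
    by rewrite -natrM mulnC.
  rewrite (_ : pure [:: x; x] = mul (pure [:: x]) (mul (pure [:: x]) (pure [::]))); last first.
    by rewrite !tm_mul_pure.
  rewrite !wick_lcons !wick1l DD (linpredD (mulr _)) -tmulA -tmulA tmul1l -!addrA; congr (_ + _).
  rewrite addrA; congr (_ + _); rewrite D (linpredZ (mulr _)).
  by rewrite -scalerDl -natrD addnn -mul2n.
rewrite wE !(linpredD syml).
have X2r : nu X2 ^+ 2 <= r ^+ 2.
  apply: (@le_trans _ _ (nt X2 ^+ 2)); last by rewrite ler_pXn2r ?nnegrE ?hnorm_ge0.
  by rewrite (weighted_norm_homog h2) ler_peMl ?sqr_ge0 // ler1n fact_gt0.
have [b1 b2] := quadratic_estimates s Z; rewrite -E -/G1 -/G2 in b1 b2.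
apply: graded_boundD.
  have hW : homog (2 + k) (mul X2 Z) by exact: homog_mul.
  apply: (graded_bound_sym _ hW) => //; first by lia.
  rewrite (weighted_norm_homog hW) (mul_norm _ h2).
  have -> : (2 + k)`! = ((k + 2) * (k + 1) * k`!)%N by rewrite add2n !factS; lia.
  apply: (@le_trans _ _ (((k + 2) * (k + 1))%:R * (nu X2 ^+ 2 * nt Z ^+ 2))).
    by rewrite (weighted_norm_homog hZ) (natrM _ (_ * _)%N) le_eqVlt; apply/orP; left; apply/eqP; ring.
  apply: B_le.
  - apply: le_trans (square_le (m := k + 2) _); last by lia.
    by rewrite -natrX ler_nat -mulnn leq_mul2l; lia.
  - by rewrite mulr_ge0 ?sqr_ge0.
  - by rewrite ler_wpM2r ?sqr_ge0.
apply: graded_boundD.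
  case: (posnP k) => [k0|kp].
    by rewrite k0 muln0 scale0r (linpred0 syml); exact: graded_bound0.
  have hW : homog k G1.
    apply: spanned_sum => p; apply: spannedZ.
    have -> : k = (1 + k.-1)%N by rewrite add1n prednK.
    apply: homog_mul; first exact: spanned_word.
    by apply: homog_head; rewrite prednK.
  apply: (@graded_bound_sym k) => //; [by lia|exact: spannedZ|].
  rewrite weighted_norm_natZ exprMn (weighted_norm_homog hW).
  apply: (@le_trans _ _ ((2 * k)%:R ^+ 2 * (nu X2 ^+ 2 * nt Z ^+ 2))).
    rewrite (weighted_norm_homog hZ) [leRHS](_ : _ = (2 * k)%:R ^+ 2 * (k`!%:R * (nu X2 ^+ 2 * nu Z ^+ 2))).
      by rewrite !ler_wpM2l // exprn_ge0.
    by ring.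
  apply: B_le.
  - by apply: square_le; lia.
  - by rewrite mulr_ge0 ?sqr_ge0.
  - by rewrite ler_wpM2r ?sqr_ge0.
case: (ltnP 1 k) => [k1|k1]; last first.
  have -> : (k * k.-1)%N = 0%N by lia.
  by rewrite scale0r (linpred0 syml); exact: graded_bound0.
have [m km] : exists m, k = m.+2 by exists k.-2; lia.
have hW : homog m G2.
  apply: spanned_sum => p; apply: spannedZ.
  by apply: homog_head; apply: homog_head; rewrite -km.
apply: (@graded_bound_sym m) => //; [by lia|exact: spannedZ|].
rewrite weighted_norm_natZ exprMn (weighted_norm_homog hW).
apply: (@le_trans _ _ ((k * k.-1)%:R * (nu X2 ^+ 2 * nt Z ^+ 2))).
  have kf : k`! = (k * k.-1 * m`!)%N by rewrite km !factS /= mulnA.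
  rewrite (weighted_norm_homog hZ) kf (natrM _ (k * k.-1)).
  rewrite [leRHS](_ : _ = (k * k.-1)%:R ^+ 2 * (m`!%:R * (nu X2 ^+ 2 * nu Z ^+ 2))).
    by rewrite !ler_wpM2l // exprn_ge0.
  by ring.
apply: B_le.
- apply: le_trans (square_le (m := k) _); last by lia.
  by rewrite -natrX ler_nat -mulnn leq_mul2l; lia.
- by rewrite mulr_ge0 ?sqr_ge0.
- by rewrite ler_wpM2r ?sqr_ge0.
Qed.

Lemma wick_homogeneous_bound : graded_bound (k + 2) (6 * B) (sym (wick Lam_bilin (X0 + X1 + X2) Z)).
Proof.
rewrite !(linpredD (wick_linear_l Lam_bilin Z)) !(linpredD syml).
rewrite (_ : 6 * B = B + (B + B) + (B + (B + B))); last by ring.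
apply: graded_boundD; last exact: wick_quadratic_bound.
by apply: graded_boundD; [exact: wick_scalar_bound|exact: wick_letter_bound].
Qed.
End Homogeneous.

Lemma graded_bound_wick M b Y : graded_bound M b Y ->
  graded_bound (M + 2) (12 * (M + 2)%:R * r * b) (sym (wick Lam_bilin (X0 + X1 + X2) Y)).
Proof.
move=> [s [-> sp sb]].
have c0 : 0 <= 12 * (M + 2)%:R * r :> R by rewrite !mulr_ge0.
suff : graded_bound (M + 2) (12 * (M + 2)%:R * r * (\sum_(p <- s) nt p.2))
    (sym (wick Lam_bilin (X0 + X1 + X2) (\sum_(p <- s) p.2))).
  case=> t [tE tp tb]; exists t; split=> //; apply: le_trans tb _.
  by rewrite ler_wpM2l.
elim: s sp {sb} => [|p s IH] sp.
  rewrite !big_nil mulr0 (linpred0 (wick_linear_r _ _)) (linpred0 syml).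
  exact: graded_bound0.
rewrite !big_cons mulrDr (linpredD (wick_linear_r _ _)) (linpredD syml).
apply: graded_boundD; last by apply: IH => q qs; apply: sp; rewrite inE qs orbT.
have [pM hp spp] := sp p (mem_head _ _).
have [t [-> tp tb]] := wick_homogeneous_bound hp spp; exists t; split=> // [q qt|].
  by have [qM hq sq] := tp q qt; split=> //; apply: leq_trans qM _; rewrite leq_add2r.
apply: le_trans tb _; rewrite mulrA mulrA mulrA (_ : 6 * 2 = 12 :> R); last by ring.
rewrite !ler_wpM2r ?hnorm_ge0 // ler_wpM2l // ler_nat leq_add2r //.
Qed.

(** The power before the [m + 1]-st product has degree at most [2 m], so that this
    product contributes the factor [12 (2 m + 2) r]. *)
Lemma wick_power_norm m :
  nt (iter m (fun Y => sym (wick Lam_bilin (X0 + X1 + X2) Y)) (pure [::])) <=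
  (24 * r) ^+ m * m`!%:R.
Proof.
suff : graded_bound (2 * m) ((24 * r) ^+ m * m`!%:R)
    (iter m (fun Y => sym (wick Lam_bilin (X0 + X1 + X2) Y)) (pure [::])).
  exact: graded_bound_norm.
elim: m => [|m IH].
  exists [:: (0%N, pure [::])]; rewrite !big_seq1 /= expr0 fact0 mulr1; split=> //.
    move=> p; rewrite inE => /eqP -> /=; split=> //; first exact: spanned_word.
    exact: (@sym_tpow R V T 0 0).
  by rewrite /hnorm sform_pure //= sqrtr1.
rewrite iterS; have := graded_bound_wick IH.
rewrite -[(2 * m + 2)%N]/(2 * m + 2 * 1)%N -mulnDr addn1.
have -> : 12 * (2 * m.+1)%:R * r * ((24 * r) ^+ m * m`!%:R) = (24 * r) ^+ m.+1 * m.+1`!%:R.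
  by rewrite factS !natrM exprS (_ : (24 : R) = 12 * 2) ?exprMn; ring.
by [].
Qed.
End Step.

End Estimates.
End Growth.

(** * Continuous bilinear forms and functionals *)

Section Seminorms.
Context (R : realType).
Local Notation C := R[i].

Lemma sup_is_seminorm (E : lmodType C) (I : Type) (D : set I) (f : I -> E -> C) (i0 : I) :
  D i0 -> (forall i a x y, D i -> f i (a *: x + y) = a * f i x + f i y) ->
  (forall x, exists M, forall i, D i -> nrm (f i x) <= M) ->
  let p x := sup [set nrm (f i x) | i in D] in
  is_seminorm p /\ forall i x, D i -> nrm (f i x) <= p x.
Proof.
move=> D0 flin fbd p.
have f0 i : D i -> f i 0 = 0.
  by move=> Di; apply: (@linpred0 _ _ C^o (f i)) => a x y; exact: flin.
have fle i x : D i -> nrm (f i x) <= p x.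
  move=> Di; apply: ub_le_sup; last by exists i.
  by have [M fM] := fbd x; exists M => _ [k Dk <-]; exact: fM.
have ple x M : (forall i, D i -> nrm (f i x) <= M) -> p x <= M.
  move=> fM; apply: ge_sup; first by exists (nrm (f i0 x)), i0.
  by move=> _ [k Dk <-]; exact: fM.
have pZ a x : p (a *: x) <= nrm a * p x.
  apply: ple => i Di; rewrite -[a *: x]addr0 flin // f0 // addr0 nrmM.
  by rewrite ler_wpM2l ?nrm_ge0 // fle.
split=> //; split=> [x y|a x].
  apply: ple => i Di; rewrite -[x]scale1r flin // mul1r.
  by apply: le_trans (nrmD _ _) _; rewrite scale1r lerD // fle.
rewrite nrmE -RcM; congr (_%:C)%C; apply/eqP; rewrite eq_le pZ /=.
have [->|a0] := eqVneq a 0.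
  rewrite nrm0 mul0r scale0r; apply: le_trans (fle i0 _ D0); exact: nrm_ge0.
have na : 0 < nrm a by rewrite -ltcR -nrmE normr_gt0.
by have := pZ a^-1 (a *: x); rewrite scalerA mulVf // scale1r nrmV ler_pdivlMl.
Qed.

Section Tvs.
Variable (V : tvsType C).

Lemma tvs_absorb (U : set V) (x : V) : nbhs 0 U -> exists2 s : R, 0 < s & U (s%:C%C *: x).
Proof.
move=> U0; have := @scale_continuous _ V (0, x) U; rewrite /= scale0r => /(_ U0).
move=> [[B1 B2] /= [B10 B2x] BU].
have /nbhs_ballP [e /= e0 eB] := B10.
have r0 : 0 < complex.Re e.
  by rewrite -ltcR (RRe_real (gtr0_real e0)).
exists (complex.Re e / 2); first by rewrite divr_gt0.
apply: (BU ((complex.Re e / 2)%:C%C, x)); split=> /=; last exact: nbhs_singleton.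
apply: eB; rewrite -ball_normE /ball_ /= sub0r normrN ger0_norm ?ler0c ?divr_ge0 ?ltW //.
rewrite -[ltRHS](RRe_real (gtr0_real e0)) ltcR; lra.
Qed.

Lemma tvs_nbhs_scale (U : set V) (s : C) : nbhs 0 U -> nbhs 0 [set x | U (s *: x)].
Proof.
move=> U0; have := @scale_continuous _ V (s, 0) U; rewrite /= scaler0 => /(_ U0).
move=> [[B1 B2] /= [B1s B20] BU]; apply: filterS B20 => x B2x.
by apply: (BU (s, x)); split=> //=; exact: (nbhs_singleton B1s).
Qed.

Lemma tvs_nbhs_sub (U : set V) (x : V) : nbhs 0 U -> nbhs x [set y | U (y - x)].
Proof.
move=> U0; have := @sub_continuous V (x, x) U; rewrite /= subrr => /(_ U0).
move=> [[B1 B2] /= [B1x B2x] BU]; apply: filterS B1x => y B1y.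
by apply: (BU (y, x)); split=> //=; exact: nbhs_singleton.
Qed.

Lemma seminorm_continuous (p : V -> R) (U : set V) : is_seminorm p -> nbhs 0 U ->
  (forall x, U x -> p x <= 1) -> continuous p.
Proof.
move=> [pD pZ] U0 pU x; apply/cvgrPdist_le => /= e e0.
have pN y : p (- y) = p y.
  by apply: (@complexI R); rewrite -scaleN1r pZ normrN1 mul1r.
have pU' : nbhs x [set y | U ((e^-1)%:C%C *: (y - x))].
  exact: (tvs_nbhs_sub x (tvs_nbhs_scale (e^-1)%:C%C U0)).
apply: filterS pU' => y /= /pU.
have -> : p ((e^-1)%:C%C *: (y - x)) = e^-1 * p (y - x).
  by apply: (@complexI R); rewrite pZ RcM ger0_norm // ler0c invr_ge0 ltW.
rewrite mulrC ler_pdivrMr // mul1r => le; apply: le_trans le.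
have h1 := pD (y - x) x; have h2 := pD (x - y) y.
rewrite subrK in h1; rewrite subrK in h2.
have h3 : p (x - y) = p (y - x) by rewrite -pN opprB.
by rewrite ler_norml; apply/andP; split; lra.
Qed.

Lemma hilbert_formD (h k : V -> V -> C) : hilbert_form h -> hilbert_form k ->
  hilbert_form (fun x y => h x y + k x y).
Proof.
move=> [hh ch] [hk ck]; split; last first.
  by move=> x; apply: (@cvgD _ C^o); [exact: ch|exact: ck].
split=> [x a y z|x y|x].
- by rewrite (herm_Dr hh) (herm_Zr hh) (herm_Dr hk) (herm_Zr hk) mulrDr addrACA.
- by rewrite conjCD -(herm_C hh) -(herm_C hk).
- by rewrite addr_ge0 // herm_ge0.
Qed.

(** [Lam] is bounded by a product [p x * q y] of continuous seminorms: [p x] is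
    the supremum of [|Lam x y|] over a neighbourhood of zero on which [Lam] is
    bounded, and [q y] its supremum over the unit ball of [p]. The sum of the
    Hilbert forms that dominate [p] and [q] dominates both. *)
Lemma bilinear_dominated (Lam : V -> V -> C) : hilbert_seminorms_cofinal V ->
  bilinear_form Lam -> continuous (fun p : V * V => Lam p.1 p.2 : C^o) ->
  exists2 h, hilbert_form h & forall x y, `|Lam x y| ^+ 2 <= h x x * h y y.
Proof.
move=> VH [Ll Lr] Lc.
have Lll y : linear (Lam^~ y : V -> C^o) by move=> a x x'; exact: Ll.
have Lrl x : linear (Lam x : V -> C^o) by move=> a y y'; exact: Lr.
have L0l y : Lam 0 y = 0 := linpred0 (Lll y).
have LZr a x y : Lam x (a *: y) = a * Lam x y := linpredZ (Lrl x) a y.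
have LZl a x y : Lam (a *: x) y = a * Lam x y := linpredZ (Lll y) a x.
have [U U0 LU] : exists2 U : set V, nbhs 0 U & forall x y, U x -> U y -> nrm (Lam x y) <= 1.
  have := Lc (0, 0) (ball (0 : C^o) 1); rewrite /= L0l.
  have b1 : nbhs (0 : C^o) (ball (0 : C^o) 1) by exact: nbhsx_ballx.
  move=> /(_ b1) [[B1 B2] /= [B10 B20] BB].
  exists (B1 `&` B2); first exact: filterI.
  move=> x y [x1 _] [_ y2]; have /= := BB (x, y) (conj x1 y2).
  rewrite -ball_normE /ball_ /= sub0r normrN nrmE => lt.
  by apply: ltW; rewrite -ltcR.
pose p x := sup [set nrm (Lam x y) | y in U].
have [pS pL] : is_seminorm p /\ forall y x, U y -> nrm (Lam x y) <= p x.
  apply: (@sup_is_seminorm V V U (fun y x => Lam x y) 0) => [|y a x x' _|x].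
  - exact: nbhs_singleton.
  - exact: Ll.
  have [s s0 sx] := tvs_absorb x U0; exists s^-1 => y Uy.
  have := LU _ _ sx Uy; rewrite LZl nrmM nrmR ?(ltW s0) //.
  by move=> le; rewrite -[s^-1]mulr1 ler_pdivlMl.
have pU x : U x -> p x <= 1.
  move=> Ux; apply: ge_sup; last by move=> _ [y Uy <-]; exact: LU.
  by exists (nrm (Lam x 0)), 0 => //; exact: nbhs_singleton.
pose q y := sup [set nrm (Lam x y) | x in [set x | p x <= 1]].
have p0 : p 0 = 0.
  by apply: (@complexI R); case: pS => _ pZ; rewrite -[X in p X](scale0r (0 : V)) pZ normr0 mul0r.
have pge0 x : 0 <= p x.
  by apply: le_trans (pL 0 x _); [exact: nrm_ge0|exact: nbhs_singleton].
have [qS qL] : is_seminorm q /\ forall x y, p x <= 1 -> nrm (Lam x y) <= q y.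
  apply: (@sup_is_seminorm V V [set x | p x <= 1] (fun x y => Lam x y) 0) => [|x a y y' _|y].
  - by rewrite /= p0.
  - exact: Lr.
  have [s s0 sy] := tvs_absorb y U0; exists s^-1 => x /= px.
  have := le_trans (pL _ x sy) px; rewrite LZr nrmM nrmR ?(ltW s0) //.
  by move=> le; rewrite -[s^-1]mulr1 ler_pdivlMl.
have qU y : U y -> q y <= 1.
  move=> Uy; apply: ge_sup; first by exists (nrm (Lam 0 y)), 0 => //=; rewrite p0.
  by move=> _ [x /= px <-]; exact: le_trans (pL y x Uy) px.
have Lpq x y : nrm (Lam x y) <= p x * q y.
  have [px|px] := eqVneq (p x) 0.
    have [s s0 sy] := tvs_absorb y U0.
    have := pL _ x sy; rewrite px LZr nrmM nrmR ?(ltW s0) //.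
    by rewrite mul0r pmulr_rle0.
  have px0 : 0 < p x by rewrite lt_def px pge0.
  have := qL ((p x)^-1%:C%C *: x) y.
  have -> : p ((p x)^-1%:C%C *: x) = 1.
    apply: (@complexI R); case: pS => _ ->; rewrite ger0_norm ?ler0c ?invr_ge0 //.
    by rewrite -RcM mulVf.
  rewrite lexx => /(_ isT); rewrite LZl nrmM nrmR ?invr_ge0 //.
  by rewrite ler_pdivrMl.
have [h1 h1H ph1] := VH p pS (seminorm_continuous pS U0 pU).
have [h2 h2H qh2] := VH q qS (seminorm_continuous qS U0 qU).
exists (fun x y => h1 x y + h2 x y); first exact: hilbert_formD.
move=> x y; have [h1p _] := h1H; have [h2p _] := h2H.
apply: (@le_trans _ _ (h1 x x * h2 y y)); last first.
  apply: ler_pM; rewrite ?herm_ge0 // ?lerDl ?lerDr ?herm_ge0 //.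
rewrite (hnormE h1p) (hnormE h2p) -RcM nrmE -RcX lecR -exprMn.
rewrite ler_pXn2r ?nnegrE ?nrm_ge0 ?mulr_ge0 ?hnorm_ge0 //.
apply: le_trans (Lpq x y) _; apply: ler_pM => //.
by apply: le_trans (qL 0 y _); [exact: nrm_ge0|rewrite p0].
Qed.
End Tvs.
End Seminorms.

Section HilbertTopology.
Context (R : realType) (V : tvsType R[i]).
Local Notation C := R[i].
Local Notation TA := (tensor_algebra V).

Lemma word_form_slots (h : V -> V -> C) : word_form h = slot_prod (weighted h).
Proof.
apply/funext => w; apply/funext => w'; rewrite slot_prod_weighted slot_prod_const /word_form.
by case: eqP; rewrite ?mulr0.
Qed.

Lemma tform_sform (h : V -> V -> C) : tform h = @sform R V TA (weighted h).
Proof. by rewrite /tform word_form_slots. Qed.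

Lemma tform_positive h : positive_hermitian h -> positive_hermitian (@tform R V h).
Proof. by move=> hh; rewrite tform_sform; exact: (@sform_positive R V TA _ (weighted_positive hh)). Qed.

Lemma tform_mono (g h : V -> V -> C) (X : tensor V) :
  positive_hermitian g -> positive_hermitian h -> (forall x, g x x <= h x x) ->
  hnorm (tform g) X <= hnorm (tform h) X.
Proof.
move=> gp hp gh.
rewrite -(@ler_pXn2r _ 2) ?nnegrE ?hnorm_ge0 // -lecR -!hnormE; try exact: tform_positive.
rewrite !tform_sform; apply: (@sform_mono R V TA (weighted g) (weighted h) X); try exact: weighted_positive.
by move=> i y; rewrite /weighted ler_wpM2l.
Qed.

(** Finitely many Hilbert forms are dominated by their sum. *)
Lemma hilbert_dominates (h0 : V -> V -> C) (Q : set (tensor V -> R)) :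
  hilbert_form h0 -> finite_set Q -> Q `<=` @tensor_seminorms R V ->
  exists h, [/\ hilbert_form h, forall x, h0 x x <= h x x &
    forall p X, Q p -> p X <= hnorm (tform h) X].
Proof.
move=> h0H /finite_seqP [s ->]; elim: s => [|p s IH] sQ.
  by exists h0; split=> // p X; rewrite /= in_nil.
have [|h [hH h0h hs]] := IH.
  by move=> q qs; apply: sQ; rewrite /= inE qs orbT.
have [k kH kp] : @tensor_seminorms R V p by apply: sQ; rewrite /= mem_head.
have hp := proj1 hH; have kpos := proj1 kH.
have sH := hilbert_formD hH kH.
exists (fun x y => h x y + k x y); split=> // [x|q X].
  by apply: le_trans (h0h x) _; rewrite lerDl herm_ge0.
rewrite /= inE => /orP[/eqP ->|qs].
  rewrite -kp; apply: tform_mono => // [|x]; [exact: (proj1 sH)|by rewrite lerDr herm_ge0].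
apply: le_trans (hs q X qs) _.
by apply: tform_mono => // [|x]; [exact: (proj1 sH)|rewrite lerDl herm_ge0].
Qed.

Lemma open_hnorm_ball (h : V -> V -> C) : hilbert_form h ->
  open [set X : symt V | hnorm (tform h) (symt_val X) < 1].
Proof.
move=> hH; have hp := tform_positive (proj1 hH).
exists [set X : tensor V | hnorm (tform h) X < 1] => //.
move=> X /= X1; exists [set hnorm (tform h)], (1 - hnorm (tform h) X); split.
- exact: finite_set1.
- by move=> _ ->; exists h.
- by rewrite subr_gt0.
move=> Y /(_ _ erefl) YX; rewrite -[Y](subrK X).
by apply: le_lt_trans (hnormD hp _ _) _; rewrite -ltrBrDr.
Qed.

Section InCompletion.
Variables (A : tvsType C) (j : {linear symt V -> A}) (j_cpl : is_completion j).

Lemma completion_open_preimage (W : set A) : open W -> open (j @^-1` W).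
Proof. by case: j_cpl => _ _ H _ oW; apply/H; exists W. Qed.

(** Taking the form above a given [h0] makes it serve both for [phi] and for
    the bilinear form that [h0] dominates. *)
Lemma functional_bound (phi : A -> C^o) (h0 : V -> V -> C) :
  linear phi -> continuous phi -> hilbert_form h0 ->
  exists h K, [/\ hilbert_form h, forall x, h0 x x <= h x x, 0 <= K &
    forall Z : symt V, nrm (phi (j Z)) <= K * hnorm (tform h) (symt_val Z)].
Proof.
move=> phil phic h0H.
have oU : open (j @^-1` (phi @^-1` (ball (0 : C^o) 1)°)).
  apply: completion_open_preimage; move/continuousP: phic; apply.
  exact: open_interior.
have [Om oO OU] := oU.
have O0 : Om (0 : tensor V).
  have : ((@symt_val R V) @^-1` Om) (0 : symt V).
    rewrite OU /= linear0 (linpred0 phil); exact: nbhsx_ballx.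
  by [].
have [Q [e [fQ sQ e0 hQ]]] := oO 0 O0.
have [h [hH h0h Qh]] := hilbert_dominates h0H fQ sQ.
have hp := tform_positive (proj1 hH).
have small Z : hnorm (tform h) (symt_val Z) < e -> nrm (phi (j Z)) < 1.
  move=> Ze; have : Om (symt_val Z).
    apply: hQ => p Qp; rewrite subr0; apply: le_lt_trans (Qh p _ Qp) Ze.
  move=> OZ; have : ((@symt_val R V) @^-1` Om) Z by [].
  rewrite OU /= => /interior_subset.
  by rewrite -ball_normE /ball_ /= sub0r normrN nrmE -ltcR.
exists h, e^-1; split=> //; first by rewrite invr_ge0 ltW.
move=> Z; set N := hnorm _ _; apply/ler_addgt0Pr => d d0.
have N0 : 0 <= N by exact: hnorm_ge0.
have Nd : 0 < N + d * e by rewrite ltr_wpDl // mulr_gt0.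
pose t := e / (N + d * e); have t0 : 0 < t by rewrite divr_gt0.
have := small (t%:C%C *: Z).
have -> : symt_val (t%:C%C *: Z) = t%:C%C *: symt_val Z by exact: (linpredZ (@symt_val_linear R V)).
rewrite (hnormZr hp) ?(ltW t0) // -/N linearZ /= (linpredZ phil).
rewrite -[_ *: phi _]/(_ * _) nrmM nrmR ?(ltW t0) //.
have -> : t * N < e by rewrite /t mulrAC ltr_pdivrMr // ltr_pM2l // ltrDl mulr_gt0.
move=> /(_ isT); rewrite /t mulrAC ltr_pdivrMr // mul1r => lt.
by rewrite -(ler_pM2l e0) mulrDr mulrA divff ?gt_eqF // mul1r [e * d]mulrC ltW.
Qed.

(** Near [X] all approximants differ by vectors of norm below one. *)
Lemma closure_norm_bound (S : set (symt V)) (h : V -> V -> C) (X : A) :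
  hilbert_form h -> closure (j @` S) X ->
  exists2 r, 0 <= r & closure (j @` (S `&` [set Y | hnorm (tform h) (symt_val Y) < r])) X.
Proof.
move=> hH clX; have hp := tform_positive (proj1 hH).
have [_ _ cO _] := j_cpl.
have [W oW WE] := (proj1 (cO _)) (open_hnorm_ball hH).
have W0 : nbhs 0 W.
  apply: open_nbhs_nbhs; split=> //.
  have : (j @^-1` W) 0 by rewrite -WE /= (hnorm0 hp).
  by rewrite /= linear0.
have := @sub_continuous A (X, X) W; rewrite /= subrr => /(_ W0) [[B1 B2] /= [B1X B2X] BW].
have BX : nbhs X (B1 `&` B2) by exact: filterI.
have [_ [[Y0 SY0 <-] [_ BY0]]] := clX _ BX.
exists (1 + hnorm (tform h) (symt_val Y0)); first by rewrite addr_ge0 // hnorm_ge0.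
move=> B BB; have [_ [[Y SY <-] [By [BY _]]]] := clX _ (filterI BB BX).
exists (j Y); split=> //; exists Y => //; split=> //=.
have : (j @^-1` W) (Y - Y0).
  by rewrite /= linearB; exact: (BW (j Y, j Y0)).
rewrite -WE /= => lt.
have -> : symt_val Y = (symt_val Y - symt_val Y0) + symt_val Y0 by rewrite subrK.
by apply: le_lt_trans (hnormD hp _ _) _; rewrite ltrD2r.
Qed.
End InCompletion.
End HilbertTopology.

(** * The GNS representation *)

Section SesquilinearPositive.
Context (R : realType) (E : lmodType R[i]).
Local Notation C := R[i].

(** Hermitian symmetry is a consequence of positivity, by polarization with the
    scalars [1] and [i]. *)
Lemma sesquilinear_positive (h : E -> E -> C) :
  (forall x a y z, h x (a *: y + z) = a * h x y + h x z) ->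
  (forall x a y z, h (a *: y + z) x = a^* * h y x + h z x) ->
  (forall x, 0 <= h x x) -> positive_hermitian h.
Proof.
move=> hr hl h0; split=> // x y.
have re z : (h z z)^* = h z z by rewrite conj_Creal // ger0_real.
have key a : a^* * h x y + a * h y x = a * (h x y)^* + a^* * (h y x)^*.
  have := re (a *: x + y); rewrite hl !hr !(conjCD, conjCM) conjCK !re => e.
  apply/eqP; rewrite -subr_eq0; apply/eqP; move/eqP: e; rewrite -subr_eq0 => /eqP e.
  by rewrite -[RHS]oppr0 -[in RHS]e; ring.
have k1 := key 1; have ki := key 'i.
rewrite conjC1 !mul1r in k1; rewrite conjCi in ki.
have {}ki : - h x y + h y x = (h x y)^* - (h y x)^*.
  apply: (mulfI (neq0Ci C)); rewrite !mulrDr mulrN.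
  by move: ki; rewrite !mulNr mulrN.
have two : 2 != 0 :> C by rewrite pnatr_eq0.
apply: (mulfI two).
transitivity ((h x y + h y x) + (- h x y + h y x)); first by ring.
by rewrite k1 ki; ring.
Qed.
End SesquilinearPositive.

Section GNSConstruction.
Context (R : realType) (A : lmodType R[i]).
Local Notation C := R[i].
Variables (mul : A -> A -> A) (inv : A -> A) (omega : A -> C) (X : A).
Local Notation H := (gns_space mul inv omega).
Local Notation cls := (@gns_class R A mul inv omega).
Local Notation ip := (@gns_inner R A mul inv omega).
Local Notation piX := (@gns_rep R A mul inv omega X).
Let B (Y Z : A) : C := omega (mul (inv Y) Z).

(** The quotient of [A] by everything is zero. *)
Lemma gns_trivial : (forall Y Z, B Y Z = 0) ->
  (forall psi : H, analytic_vector ip piX psi) /\ essentially_self_adjoint ip piX.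
Proof.
move=> B0.
have all_eq (x y : H) : x = y.
  have [u ->] := qprojW x; have [v ->] := qprojW y.
  by apply/qprojP => M [_]; apply; exact: B0.
have ip0 (x y : H) : ip x y = 0 by exact: B0.
have ipp : positive_hermitian ip.
  by split=> *; rewrite !ip0 ?mulr0 ?addr0 ?conjC0.
have an psi : analytic_vector ip piX psi.
  exists 1 => //; rewrite (_ : (fun n => _) = fun=> 0); last first.
    by apply/funext => n; rewrite /hnorm ip0 sqrtr0 mulr0.
  rewrite (_ : series _ = fun=> 0); first exact: is_cvg_cst.
  by apply/funext => n; rewrite /series /= big1.
split=> //; apply: nelson_analytic => // [a x y|x y].
  exact: all_eq.
by rewrite !ip0.
Qed.

Hypotheses (mul_l : forall Y, linear (mul^~ Y)) (mul_r : forall Y, linear (mul Y)).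
Hypothesis (mulA : forall Y Z W, mul (mul Y Z) W = mul Y (mul Z W)).
Hypothesis (inv_P : forall a Y Z, inv (a *: Y + Z) = a^* *: inv Y + inv Z).
Hypothesis (inv_mul : forall Y Z, inv (mul Y Z) = mul (inv Z) (inv Y)).
Hypothesis (omega_P : forall a Y Z, omega (a *: Y + Z) = a * omega Y + omega Z).
Hypothesis (omega_pos : positive_functional mul inv omega).
Hypothesis (X_herm : inv X = X).
Hypothesis (X_growth : forall Y, exists D K, [/\ 0 <= D, 0 <= K &
  forall m, nrm (omega (mul (inv Y) (iter m (mul X) Y))) <= D * (K ^+ m * m`!%:R)]).

Lemma gns_form_positive : positive_hermitian B.
Proof.
apply: sesquilinear_positive => [Z a Y W|Z a Y W|Y]; last exact: omega_pos.
- by rewrite /B (mul_r _ a) omega_P.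
- by rewrite /B inv_P (mul_l _ a^*) omega_P.
Qed.

Let Bp := gns_form_positive.

Lemma gns_form_symmetric Y Z : B (mul X Y) Z = B Y (mul X Z).
Proof. by rewrite /B inv_mul X_herm mulA. Qed.

Lemma gns_kernelP Y : lspan (gns_kernel mul inv omega) Y <-> B Y Y = 0.
Proof. by rewrite (lspan_id (gns_kernel_submodule Bp)). Qed.

Lemma gns_classP Y Z : cls Y = cls Z <-> B (Y - Z) (Y - Z) = 0.
Proof. by rewrite /gns_class qprojP; exact: gns_kernelP. Qed.

Lemma gns_repr Y : B (repr (cls Y) - Y) (repr (cls Y) - Y) = 0.
Proof. by apply/gns_kernelP; exact: repr_qproj. Qed.

Lemma gns_inner_class Y Z : ip (cls Y) (cls Z) = B Y Z.
Proof.
rewrite /gns_inner -/(B _ _).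
rewrite -[repr (cls Y)](subrK Y) (herm_Dl Bp) (herm_kernel Bp _ (gns_repr Y)) add0r.
rewrite -[repr (cls Z)](subrK Z) (herm_Dr Bp) (herm_C Bp _ Y) (herm_kernel Bp _ (gns_repr Z)).
by rewrite conjC0 add0r.
Qed.

Lemma gns_rep_class Y : piX (cls Y) = cls (mul X Y).
Proof.
apply/gns_classP; rewrite -(linpredB (mul_r X)) gns_form_symmetric.
exact: herm_kernel (gns_repr Y).
Qed.

Lemma gns_class_surj (y : H) : exists Y, y = cls Y.
Proof. exact: qprojW. Qed.

Lemma gns_inner_positive : positive_hermitian ip.
Proof.
split=> [x a y z|x y|x].
- have [[Y ->] [Z ->] [W ->]] := And3 (gns_class_surj x) (gns_class_surj y) (gns_class_surj z).
  have -> : a *: cls Z + cls W = cls (a *: Z + W) by rewrite /gns_class linearP.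
  by rewrite !gns_inner_class (herm_Dr Bp) (herm_Zr Bp).
- have [Y ->] := gns_class_surj x; have [Z ->] := gns_class_surj y.
  by rewrite !gns_inner_class (herm_C Bp).
- by have [Y ->] := gns_class_surj x; rewrite gns_inner_class; exact: herm_ge0.
Qed.

Lemma gns_rep_linear : linear piX.
Proof.
move=> a y z; have [Y ->] := gns_class_surj y; have [Z ->] := gns_class_surj z.
have E Y' Z' : a *: cls Y' + cls Z' = cls (a *: Y' + Z') by rewrite /gns_class linearP.
by rewrite E !gns_rep_class E (mul_r _ a).
Qed.

Lemma gns_rep_symmetric y z : ip (piX y) z = ip y (piX z).
Proof.
have [Y ->] := gns_class_surj y; have [Z ->] := gns_class_surj z.
by rewrite !gns_rep_class !gns_inner_class gns_form_symmetric.
Qed.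

Lemma gns_iter n Y : iter n piX (cls Y) = cls (iter n (mul X) Y).
Proof. by elim: n => //= n ->; rewrite gns_rep_class. Qed.

(** The squared norm of [piX^n [Y]] is [omega(Y^* X^(2n) Y)], hence at most
    [D K^(2n) (2n)!], and [(2n)!] is at most [2^(2n) n!^2]. *)
Lemma gns_analytic psi : analytic_vector ip piX psi.
Proof.
have [Y ->] := gns_class_surj psi; have [D [K [D0 K0 gr]]] := X_growth Y.
pose N n := hnorm ip (iter n piX (cls Y)).
have N2 n : N n ^+ 2 <= D * (2 * K) ^+ (2 * n) * n`!%:R ^+ 2.
  have -> : N n ^+ 2 = nrm (omega (mul (inv Y) (iter (n + n) (mul X) Y))).
    apply: (@complexI R); rewrite /N -(hnormE gns_inner_positive) -nrmE.
    rewrite (ip_iter gns_rep_symmetric) gns_iter gns_inner_class ger0_norm //.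
    rewrite -/(B _ _) -gns_inner_class -gns_iter -(ip_iter gns_rep_symmetric).
    exact: herm_ge0 gns_inner_positive _.
  apply: le_trans (gr (n + n)%N) _; rewrite -mulrA ler_wpM2l //.
  have := fact_add_le n n; rewrite -(ler_nat R) !natrM natrX => le.
  apply: le_trans (ler_wpM2l (exprn_ge0 _ K0) le) _.
  by rewrite addnn -mul2n exprMn le_eqVlt; apply/orP; left; apply/eqP; ring.
(* Adding one keeps [L] positive when [K] is zero. *)
pose M := Num.sqrt D; pose L := 2 * K + 1.
have L0 : 0 < L by rewrite ltr_wpDl // mulr_ge0.
have Nn n : N n <= M * (L ^+ n * n`!%:R).
  rewrite -(@ler_pXn2r _ 2) ?nnegrE ?hnorm_ge0 //; last first.
    by rewrite !mulr_ge0 ?sqrtr_ge0 ?exprn_ge0 // ltW.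
  apply: le_trans (N2 n) _; rewrite [leRHS]exprMn [M ^+ 2]sqr_sqrtr // -mulrA ler_wpM2l // [leRHS]exprMn.
  rewrite ler_wpM2r ?sqr_ge0 // -exprM mulnC lerXn2r ?nnegrE ?mulr_ge0 ?(ltW L0) //.
  by rewrite /L lerDl.
exists (2 * L)^-1; first by rewrite invr_gt0 mulr_gt0.
have L2 : 0 < (2 * L)^-1 by rewrite invr_gt0 mulr_gt0.
have c0 n : 0 <= (2 * L)^-1 ^+ n / n`!%:R by rewrite divr_ge0 // exprn_ge0 // ltW.
apply: (@series_le_cvg _ _ (geometric M 2^-1)) => [n|n|n|].
- by rewrite mulr_ge0 ?hnorm_ge0.
- by rewrite /geometric /= mulr_ge0 ?sqrtr_ge0 // exprn_ge0.
- rewrite /geometric /= -/(N n).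
  have n0 : n`!%:R != 0 :> R by rewrite pnatr_eq0 -lt0n fact_gt0.
  apply: le_trans (ler_wpM2l (c0 n) (Nn n)) _.
  have Ln : L ^+ n != 0 by rewrite expf_neq0 // gt_eqF.
  rewrite invfM exprMn le_eqVlt; apply/orP; left; apply/eqP; rewrite exprVn [L^-1 ^+ n]exprVn.
  by field; rewrite ?n0 ?Ln ?expf_neq0.
apply: is_cvg_geometric_series; rewrite ger0_norm; last by rewrite invr_ge0.
by rewrite invf_lt1 ?ltr1n.
Qed.

Theorem gns_essentially_self_adjoint :
  (forall psi : H, analytic_vector ip piX psi) /\ essentially_self_adjoint ip piX.
Proof.
split; first exact: gns_analytic.
apply: nelson_analytic; [exact: gns_inner_positive|exact: gns_rep_linear|
  exact: gns_rep_symmetric|exact: gns_analytic].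
Qed.
End GNSConstruction.

(** * Transfer to the completion *)

Section CompletedStar.
Context (R : realType) (V : tvsType R[i]).
Local Notation C := R[i].
Local Notation TA := (tensor_algebra V).
Variables (Lam : V -> V -> C) (Lam_bilin : bilinear_form Lam).

Lemma symt_sym (X : symt V) : tsym (symt_val X) = symt_val X.
Proof. exact: (congr1 (@symt_val R V) (to_symt_val X)). Qed.

Lemma iter_star_val (X : symt V) m : symt_val (iter m (star Lam X) (@sunit R V)) =
  iter m (fun Y => tsym (@wick R V TA Lam Lam_bilin (symt_val X) Y)) (tpure [::]).
Proof.
elim: m => [|m IH]; first exact: (@sym_tpow R V TA 0 0).
have e := star_val Lam_bilin X (iter m (star Lam X) (@sunit R V)).
by rewrite !iterS -IH; exact: e.
Qed.

Lemma star_power_norm (h : V -> V -> C) (X : symt V) (r : R) m :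
  positive_hermitian h -> (forall x y, `|Lam x y| ^+ 2 <= h x x * h y y) ->
  symt_le2 X -> hnorm (tform h) (symt_val X) <= r ->
  hnorm (tform h) (symt_val (iter m (star Lam X) (@sunit R V))) <= (24 * r) ^+ m * m`!%:R.
Proof.
move=> hh Lh [X0 [X1 [X2 [t0 t1 t2 ->]]]].
have valE : symt_val (X0 + X1 + X2) = symt_val X0 + symt_val X1 + symt_val X2.
  by rewrite !(linpredD (@symt_val_linear R V)).
have h0 : @homog R V TA 0 (symt_val X0).
  by have := @homog_degree_part R V TA 0 (symt_val X0); rewrite -[X in homog _ X -> _]/(tdeg 0 X0) t0.
have h1 : @homog R V TA 1 (symt_val X1).
  by have := @homog_degree_part R V TA 1 (symt_val X1); rewrite -[X in homog _ X -> _]/(tdeg 1 X1) t1.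
have h2 : @homog R V TA 2 (symt_val X2).
  by have := @homog_degree_part R V TA 2 (symt_val X2); rewrite -[X in homog _ X -> _]/(tdeg 2 X2) t2.
rewrite iter_star_val valE tform_sform => le.
have r0 : 0 <= r by apply: le_trans le; exact: hnorm_ge0.
have g := @graded_norm R V TA h hh _ _ _ h0 h1 h2.
have le2 : hnorm (@sform R V TA (weighted h)) (symt_val X0 + symt_val X1 + symt_val X2) ^+ 2 <= r ^+ 2.
  by rewrite ler_pXn2r ?nnegrE ?hnorm_ge0.
have comp (Y : tensor V) : hnorm (@sform R V TA (weighted h)) Y ^+ 2 <= r ^+ 2 ->
    hnorm (@sform R V TA (weighted h)) Y <= r.
  by rewrite ler_pXn2r ?nnegrE ?hnorm_ge0.
move: le2; rewrite [X in X <= _]g => le2.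
apply: (@wick_power_norm R V TA h hh Lam Lam_bilin Lh _ _ _ h0 h1 h2 (symt_sym X2) r r0);
  apply: comp; apply: le_trans le2.
- by rewrite -addrA lerDl addr_ge0 ?sqr_ge0.
- by rewrite addrAC lerDr addr_ge0 ?sqr_ge0.
- by rewrite lerDr addr_ge0 ?sqr_ge0.
Qed.
End CompletedStar.

Section Density.
Context (R : realType) (A : tvsType R[i]).
Local Notation C := R[i].

Lemma dense_ext (D : Type) (S : topologicalType) (B : topologicalType) (i : D -> S) (f g : S -> B) :
  hausdorff_space B -> dense (range i) -> continuous f -> continuous g ->
  (forall d, f (i d) = g (i d)) -> f =1 g.
Proof.
move=> hB di cf cg fg x; apply: hB => P Q Pf Qg.
have nx : nbhs x (f @^-1` P `&` g @^-1` Q) by apply: filterI; [exact: cf|exact: cg].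
have [y [/interior_subset [Py Qy] [d _ dy]]] :=
  di _ (ex_intro _ x nx) (open_interior _).
by exists (f y); split=> //; move: Qy; rewrite /= -dy fg.
Qed.

Lemma continuous_add (S : topologicalType) (f g : S -> A) :
  continuous f -> continuous g -> continuous (fun x => f x + g x).
Proof.
move=> cf cg x; have h := @add_continuous A (f x, g x).
exact: (@continuous2_cvg _ _ _ _ (nbhs x) _ f g (fun a b : A => a + b) _ _ h (cf x) (cg x)).
Qed.

Lemma continuous_scale (S : topologicalType) (a : C) (f : S -> A) :
  continuous f -> continuous (fun x => a *: f x).
Proof.
move=> cf x; have h := @scale_continuous C A (a, f x).
have ca : (fun _ : S => a : C^o) @ x --> (a : C^o) by exact: cvg_cst.
exact: (@continuous2_cvg _ _ _ _ (nbhs x) _ (fun=> a : C^o) f (fun (b : C^o) (c : A) => b *: c)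
  _ _ h ca (cf x)).
Qed.

Lemma closure_norm_le (S : topologicalType) (f : S -> C^o) (D : set S) (M : R) :
  continuous f -> (forall x, D x -> nrm (f x) <= M) ->
  forall x, closure D x -> nrm (f x) <= M.
Proof.
move=> cf fM x clx; apply/ler_addgt0Pr => e e0.
have [B Bfx Be] : exists2 B : set C^o, nbhs (f x : C^o) B & forall z, B z -> nrm (f x - z) < e.
  exists (ball (f x : C^o) e%:C%C); first by apply: nbhsx_ballx; rewrite ltcR.
  by move=> z; rewrite -ball_normE /ball_ /= nrmE ltcR.
have [y [Dy By]] := clx (f @^-1` B) (cf x B Bfx).
rewrite -[f x](subrK (f y)) addrC; apply: le_trans (nrmD _ _) _.
by apply: lerD; [exact: fM|exact: ltW (Be _ By)].
Qed.

Lemma continuous_extension_cases (D : Type) (E F : topologicalType) (i : D -> E) (k : D -> F)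
    (y0 : F) (g := continuous_extension i k y0) :
  (continuous g /\ forall x, g (i x) = k x) \/ (forall x, g x = y0).
Proof.
rewrite /g /continuous_extension; case: xgetP => [f _ [cf fk]|nf]; first by left.
by right.
Qed.
End Density.

Section CompletedAlgebra.
Context (R : realType) (V : tvsType R[i]).
Local Notation C := R[i].
Variables (Lam : V -> V -> C) (Lam_bilin : bilinear_form Lam).
Variables (c : V -> V) (c_inv : antilinear_involution c).
Hypothesis Lam_herm : forall v w : V, Lam v w = (Lam (c w) (c v))^*.
Variables (A : tvsType C) (j : {linear symt V -> A}) (j_cpl : is_completion j).
Variable (mul : A -> A -> A).
Hypothesis mul_cont : continuous (fun p : A * A => mul p.1 p.2).
Hypothesis mul_j : forall X Y, mul (j X) (j Y) = j (star Lam X Y).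

Let A_hausdorff : hausdorff_space A. Proof. by case: j_cpl. Qed.
Let j_dense : dense (range j). Proof. by case: j_cpl. Qed.

Lemma continuous_mul (S : topologicalType) (f g : S -> A) :
  continuous f -> continuous g -> continuous (fun x => mul (f x) (g x)).
Proof.
move=> cf cg x; have h := @mul_cont (f x, g x).
exact: (@continuous2_cvg _ _ _ _ (nbhs x) _ f g mul _ _ h (cf x) (cg x)).
Qed.

Let cid : continuous (fun x : A => x). Proof. by move=> x; exact: cvg_id. Qed.
Let ccst (y : A) : continuous (fun _ : A => y). Proof. by move=> x; exact: cvg_cst. Qed.

Ltac solve_continuous := repeat first
  [exact: cid | exact: ccst | apply: continuous_mul | apply: continuous_add | apply: continuous_scale].

(** This law and the next ones are equalities of continuous functions of each
    variable that hold on the dense image of [j]. *)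
Lemma mul_linear_l Y : linear (mul^~ Y).
Proof.
move=> a X X'; move: Y; apply: (dense_ext A_hausdorff j_dense) => [||y]; try by solve_continuous.
move: X'; apply: (dense_ext A_hausdorff j_dense) => [||x']; try by solve_continuous.
move: X; apply: (dense_ext A_hausdorff j_dense) => [||x]; try by solve_continuous.
by rewrite -linearP !mul_j -linearP (star_linear_l Lam_bilin y a).
Qed.

Lemma mul_linear_r X : linear (mul X).
Proof.
move=> a Y Y'; move: X; apply: (dense_ext A_hausdorff j_dense) => [||x]; try by solve_continuous.
move: Y'; apply: (dense_ext A_hausdorff j_dense) => [||y']; try by solve_continuous.
move: Y; apply: (dense_ext A_hausdorff j_dense) => [||y]; try by solve_continuous.
by rewrite -linearP !mul_j -linearP (star_linear_r Lam_bilin x a).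
Qed.

Lemma mul_assoc X Y Z : mul (mul X Y) Z = mul X (mul Y Z).
Proof.
move: X; apply: (dense_ext A_hausdorff j_dense) => [||x]; try by solve_continuous.
move: Y; apply: (dense_ext A_hausdorff j_dense) => [||y]; try by solve_continuous.
move: Z; apply: (dense_ext A_hausdorff j_dense) => [||z]; try by solve_continuous.
by rewrite !mul_j (starA Lam_bilin).
Qed.

Lemma mul_unit_l Y : mul (j (@sunit R V)) Y = Y.
Proof.
move: Y; apply: (dense_ext A_hausdorff j_dense) => [||y]; try by solve_continuous.
by rewrite mul_j (star1l Lam_bilin).
Qed.

Lemma iter_mul X Y m : iter m (mul X) Y = mul (iter m (mul X) (j (@sunit R V))) Y.
Proof. by elim: m => [|m IH] /=; rewrite ?mul_unit_l // mul_assoc -IH. Qed.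

Lemma iter_mul_continuous m : continuous (fun X => iter m (mul X) (j (@sunit R V))).
Proof. by elim: m => [|m IH] /=; [exact: ccst|exact: continuous_mul cid IH]. Qed.

Lemma iter_mul_j X m : iter m (mul (j X)) (j (@sunit R V)) = j (iter m (star Lam X) (@sunit R V)).
Proof. by elim: m => //= m ->; rewrite mul_j. Qed.

Section Involution.
Variable (inv : A -> A).
Hypothesis inv_cont : continuous inv.
Hypothesis inv_j : forall X, inv (j X) = j (sinv c X).

Let cinv (f : A -> A) : continuous f -> continuous (fun x => inv (f x)).
Proof. by move=> cf x; apply: continuous_comp; [exact: cf|exact: inv_cont]. Qed.

Lemma inv_antilinear a X Y : inv (a *: X + Y) = a^* *: inv X + inv Y.
Proof.
move: X; apply: (dense_ext A_hausdorff j_dense) => [||x];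
  try by repeat (solve_continuous; try apply: cinv).
move: Y; apply: (dense_ext A_hausdorff j_dense) => [||y];
  try by repeat (solve_continuous; try apply: cinv).
by rewrite -linearP !inv_j (sinvP c_inv) linearP.
Qed.

Lemma inv_mul X Y : inv (mul X Y) = mul (inv Y) (inv X).
Proof.
move: X; apply: (dense_ext A_hausdorff j_dense) => [||x];
  try by repeat (solve_continuous; try apply: cinv).
move: Y; apply: (dense_ext A_hausdorff j_dense) => [||y];
  try by repeat (solve_continuous; try apply: cinv).
by rewrite !(mul_j, inv_j) (sinv_star Lam_bilin c_inv Lam_herm).
Qed.

Section Growth.
Hypothesis V_hilbert : hilbert_seminorms_cofinal V.
Hypothesis Lam_cont : continuous (fun p : V * V => Lam p.1 p.2 : C^o).
Variable (omega : {linear A -> C^o}).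
Hypothesis omega_cont : continuous omega.
Variable (X : A).
Hypothesis X_le2 : closure [set j Y | Y in @symt_le2 R V] X.

(** One Hilbert form [h] bounds both [Lam] and the functional sending [Z] to
    [omega(Y^* Z Y)]. As [X] is a limit of elements of degree at most two of bounded
    [h]-norm, [star_power_norm] passes to the limit. *)
Lemma power_growth Y : exists D K, [/\ 0 <= D, 0 <= K &
  forall m, nrm (omega (mul (inv Y) (iter m (mul X) Y))) <= D * (K ^+ m * m`!%:R)].
Proof.
pose phi (Z : A) : C^o := omega (mul (inv Y) (mul Z Y)).
have phil : linear phi.
  by move=> a Z Z'; rewrite /phi (mul_linear_l Y a) (mul_linear_r _ a) linearP.
have phic : continuous phi.
  move=> Z; apply: continuous_comp; last exact: omega_cont.
  by move: Z; solve_continuous.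
have [h0 h0H h0L] := bilinear_dominated V_hilbert Lam_bilin Lam_cont.
have [h [D [hH h0h D0 hD]]] := functional_bound j_cpl phil phic h0H.
have Lh x y : `|Lam x y| ^+ 2 <= h x x * h y y.
  apply: le_trans (h0L x y) _; apply: ler_pM; rewrite ?h0h //.
    exact: herm_ge0 (proj1 h0H) x.
  exact: herm_ge0 (proj1 h0H) y.
have [r r0 Xr] := closure_norm_bound j_cpl hH X_le2.
exists D, (24 * r); split=> // [|m]; first by rewrite mulr_ge0.
rewrite iter_mul -/(phi _).
have cX : continuous (fun Z => phi (iter m (mul Z) (j (@sunit R V)))).
  move=> Z; exact: (@continuous_comp _ _ _ (fun Z => iter m (mul Z) (j (@sunit R V))) phi Z
    (@iter_mul_continuous m Z) (@phic _)).
apply: (closure_norm_le cX _ Xr) => _ [Z [Zle Zr] <-].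
rewrite iter_mul_j; apply: le_trans (hD _) _; rewrite ler_wpM2l //.
by apply: (star_power_norm Lam_bilin m (proj1 hH) Lh Zle); exact: ltW.
Qed.
End Growth.
End Involution.
End CompletedAlgebra.

Theorem theorem3p40 (R : realType) (V : tvsType R[i])
    (V_hausdorff : hausdorff_space V)
    (V_hilbert : hilbert_seminorms_cofinal V)
    (c : V -> V) (c_inv : antilinear_involution c) (c_cont : continuous c)
    (Lam : V -> V -> R[i]) (Lam_bilin : bilinear_form Lam)
    (Lam_cont : continuous (fun p : V * V => Lam p.1 p.2 : R[i]^o))
    (Lam_herm : forall v w : V, Lam v w = (Lam (c w) (c v))^*)
    (A : tvsType R[i]) (j : {linear symt V -> A}) (j_cpl : is_completion j)
    (omega : {linear A -> R[i]^o}) (omega_cont : continuous omega)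
    (omega_pos : positive_functional (cpl_star j Lam) (cpl_inv j c) omega)
    (X : A) (X_herm : X = cpl_inv j c X)
    (X_le2 : closure [set j Y | Y in @symt_le2 R V] X) :
  let H := gns_space (cpl_star j Lam) (cpl_inv j c) omega in
  let ip : H -> H -> R[i] :=
    @gns_inner R A (cpl_star j Lam) (cpl_inv j c) omega in
  let piX : H -> H :=
    @gns_rep R A (cpl_star j Lam) (cpl_inv j c) omega X in
  (forall psi : H, analytic_vector ip piX psi) /\
  essentially_self_adjoint ip piX.
Proof.
set mul := cpl_star j Lam; set inv := cpl_inv j c => H ip piX.
(* Without a continuous extension [mul] is its default value, the zero map, and the
   GNS space is trivial; likewise for [inv]. *)
have [[mul_c mul_j]|mul0] := @continuous_extension_cases (symt V * symt V) (A * A)%type A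
  (fun p => (j p.1, j p.2)) (fun p => j (star Lam p.1 p.2)) 0; last first.
  by apply: gns_trivial => Y Z; rewrite /mul /cpl_star mul0 linear0.
have mul_cont : continuous (fun p : A * A => mul p.1 p.2).
  suff -> : (fun p : A * A => mul p.1 p.2) =
    continuous_extension (fun p : symt V * symt V => (j p.1, j p.2))
      (fun p => j (star Lam p.1 p.2)) 0 by exact: mul_c.
  by apply/funext => -[].
have {}mul_j Y Z : mul (j Y) (j Z) = j (star Lam Y Z) by exact: (mul_j (Y, Z)).
have mull := mul_linear_l Lam_bilin j_cpl mul_cont mul_j.
have mulr := mul_linear_r Lam_bilin j_cpl mul_cont mul_j.
have [[inv_c inv_j]|inv0] := @continuous_extension_cases (symt V) A A
  j (fun Y => j (sinv c Y)) 0; last first.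
  apply: gns_trivial => Y Z; rewrite /inv /cpl_inv inv0.
  by rewrite (linpred0 (mull Z)) linear0.
apply: gns_essentially_self_adjoint.
- exact: mull.
- exact: mulr.
- by move=> Y Z W; exact: (mul_assoc Lam_bilin j_cpl mul_cont mul_j).
- by move=> a Y Z; exact: (inv_antilinear c_inv j_cpl inv_c inv_j).
- by move=> Y Z; exact: (inv_mul Lam_bilin c_inv Lam_herm j_cpl mul_cont mul_j inv_c inv_j).
- by move=> a Y Z; rewrite linearP.
- exact: omega_pos.
- exact: esym X_herm.
- by move=> Y; exact: (power_growth Lam_bilin j_cpl mul_cont mul_j inv).
Qed.
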